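(* Let $G \subset \mathbb{C}$ be a simply connected domain and let $(\varphi_n)_{n\in\mathbb{N}}$ be a strongly frequently runaway sequence of univalent holomorphic self-maps $\varphi_n : G \to G$. Then the set $FHC((C_{\varphi_n})_n)$ is maximal dense-lineable in $H(G)$; that is, there exists a dense vector subspace $M\subset H(G)$ with $\dim(M)=\dim(H(G))$ (algebraic dimension) such that $M\subset FHC((C_{\varphi_n})_n)\cup\{0\}$.
   Context: $\mathbb{N}=\{1,2,3,\dots\}$. A domain is a nonempty connected open subset of $\mathbb{C}$; a domain $G$ (possibly $G=\mathbb{C}$) is simply connected if $\mathbb{C}_\infty\setminus G$ is connected, where $\mathbb{C}_\infty=\mathbb{C}\cup\{\infty\}$ is the one-point compactification of $\mathbb{C}$. $H(G)$ is the space of holomorphic functions $G\to\mathbb{C}$ with the topology of uniform convergence on compact subsets of $G$. For a holomorphic map $\varphi:G\to G$, the composition operator is $C_\varphi: H(G)\to H(G)$, $C_\varphi f = f\circ\varphi$. Univalent means one-to-one. For $A\subset\mathbb{N}$, the lower density is $\underline{\rm dens}(A)=\liminf_{n\to\infty}\frac{{\rm card}(A\cap\{1,\dots,n\})}{n}$. For a sequence $(T_n)_n$ of continuous linear maps $X\to Y$ between topological vector spaces, a vector $x_0\in X$ is frequently hypercyclic for $(T_n)_n$ if $\underline{\rm dens}(\{n\in\mathbb{N}: T_n x_0\in V\})>0$ for every nonempty open set $V\subset Y$; $FHC((T_n)_n)$ is the set of such vectors. A sequence $(K_\nu)_{\nu\in\mathbb{N}}$ of compact subsets of $G$ is exhaustive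 if $G=\bigcup_{\nu} K_\nu$ and $K_\nu$ is contained in the interior of $K_{\nu+1}$ for all $\nu$. $\mathcal{M}(G)$ is the family of compact sets $K\subset G$ such that $\mathbb{C}\setminus K$ is connected. A sequence $(\varphi_n)_n$ of holomorphic self-maps of $G$ is strongly frequently runaway if there exist an exhaustive sequence $(K_\nu)_{\nu}\subset\mathcal{M}(G)$ and a family $\{A(\nu):\nu\in\mathbb{N}\}$ of subsets of $\mathbb{N}$ such that: (P1) $\underline{\rm dens}(A(\nu))>0$ for all $\nu\in\mathbb{N}$; (P2) the sets $A(\nu)$ ($\nu\in\mathbb{N}$) are pairwise disjoint, and the sets $\varphi_n(K_\nu)$ ($\nu\in\mathbb{N}$, $n\in A(\nu)$) are pairwise disjoint (i.e. sets corresponding to different indices $\nu$, respectively to different index pairs $(n,\nu)$, are disjoint); (P3) for every compact $K\subset G$ there are only finitely many pairs $(n,\nu)$ with $\nu\in\mathbb{N}$, $n\in A(\nu)$ and $K\cap\varphi_n(K_\nu)\neq\varnothing$. *)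

(* Defs.v *)
From HB Require Import structures.
From mathcomp Require Import all_boot all_order all_algebra finmap.
From mathcomp Require Import all_classical all_reals all_analysis.
From mathcomp Require Import complex.

Set Implicit Arguments.
Unset Strict Implicit.
Unset Printing Implicit Defensive.

Import Order.TTheory GRing.Theory Num.Theory.
Import numFieldNormedType.Exports.

Local Open Scope classical_set_scope.
Local Open Scope ring_scope.

(* The set {1, 2, 3, ...} is [set n : nat | (0 < n)%N]: sequences are functions
   on nat whose value at 0 is never used. *)

(* The regular algebra R[i]^o carries the topology and the normed module
   structure over R[i]. *)
Notation plane R := (R[i]^o).

Section Domains.
Variable R : realType.
Local Notation C := (plane R).

Record domain := Domain {
  domain_set :> set C;
  domain_nonempty : domain_set !=set0;
  domain_open : open domain_set;
  domain_connected : connected domain_set }.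

Definition simply_connected (G : domain) : Prop :=
  connected (~` (Some @` G) : set (one_point_compactification C)).

(* derivable over the scalar field R[i]: complex differentiability *)
Definition holomorphic_on (A : set C) (f : C -> C) : Prop :=
  forall z, A z -> derivable f z 1.

Variable G : domain.

Record holSelfMap := HolSelfMap {
  holSelfMap_fun :> C -> C;
  holSelfMap_hol : holomorphic_on G holSelfMap_fun;
  holSelfMap_self : set_fun G G holSelfMap_fun }.

Definition univalent (f : holSelfMap) : Prop := set_inj G f.

(* A function on G is represented by its extension by 0 to the plane. *)
Definition hol_fun : {pred C -> C} :=
  mem [set f : C -> C | holomorphic_on G f /\ forall z, ~ domain_set G z -> f z = 0].

Record hol := Hol { hol_val :> C -> C; holP : hol_val \in hol_fun }.

HB.instance Definition _ := [isSub for hol_val].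
HB.instance Definition _ := [Choice of hol by <:].

Lemma hol_fun_submod_closed : submod_closed hol_fun.
Proof.
split=> [|a f g]; rewrite !inE.
  by split=> // z _; exact: derivable_cst.
move=> [fG f0] [gG g0]; split=> z Gz.
  by apply: derivableD; [apply: derivableZ; exact: fG|exact: gG].
by rewrite [LHS](_ : _ = a *: f z + g z)// f0// g0// scaler0 addr0.
Qed.

HB.instance Definition _ :=
  GRing.isSubmodClosed.Build _ _ hol_fun hol_fun_submod_closed.
HB.instance Definition _ := [SubChoice_isSubLmodule of hol by <:].

HB.instance Definition _ := Uniform.copy hol
  (@initial_topology hol {family compactly_in G, C -> C} hol_val).

Lemma comp_op_subproof (phi : holSelfMap) (f : hol) :
  (f \o phi) \_ G \in hol_fun.
Proof.
have := holP f; rewrite !inE => -[fG _]; split=> z Gz; last first.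
  by rewrite patchE memNset.
apply: (@near_eq_derivable _ _ _ (f \o phi)).
- have := open_nbhs_nbhs (conj (@domain_open G) Gz).
  by apply: filterS => w Gw; rewrite patchE mem_set.
- apply/derivable1_diffP/differentiable_comp; apply/derivable1_diffP.
    exact: holSelfMap_hol.
  by apply: fG; exact: holSelfMap_self.
Qed.

Definition comp_op (phi : holSelfMap) (f : hol) : hol :=
  Hol (comp_op_subproof phi f).

End Domains.

Definition lower_density (R : realType) (A : set nat) : \bar R :=
  limn_einf (fun n =>
    (#|` fset_set (A `&` [set k | (1 <= k <= n)%N])|%:R / n%:R : R)%:E).

Definition FHC (R : realType) (X Y : topologicalType) (T : nat -> X -> Y) :
    set X :=
  [set x | forall V : set Y, open V -> V !=set0 ->
    (0 < lower_density R [set n | V (T n x)])%E].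

Section Runaway.
Variables (R : realType) (G : domain R).
Local Notation C := (plane R).

Definition exhaustive (K : nat -> set C) : Prop :=
  [/\ forall nu, (0 < nu)%N -> compact (K nu),
      \bigcup_(nu in [set nu | (0 < nu)%N]) K nu = G :> set C &
      forall nu, (0 < nu)%N -> K nu `<=` (K nu.+1)°].

Definition calM : set (set C) :=
  [set K | [/\ compact K, K `<=` G & connected (~` K)]].

Definition strongly_frequently_runaway (phi : nat -> holSelfMap G) : Prop :=
  exists (K : nat -> set C) (A : nat -> set nat),
    let idx := [set p : nat * nat | [/\ (0 < p.2)%N & A p.2 p.1]] in
    let img p := phi p.1 @` K p.2 in
    [/\ exhaustive K,
        forall nu, (0 < nu)%N -> calM (K nu),
        forall nu, (0 < nu)%N -> A nu `<=` [set n | (0 < n)%N] &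
        [/\ forall nu, (0 < nu)%N -> (0 < lower_density R (A nu))%E,
            trivIset [set nu | (0 < nu)%N] A,
            trivIset idx img &
            forall L : set C, compact L -> L `<=` G ->
              finite_set [set p | idx p /\ L `&` img p !=set0]]].

End Runaway.

Section Lineability.
Variables (F : fieldType) (X : lmodType F).

Definition linear_span (B : set X) : set X :=
  [set v | exists (s : seq X) (a : X -> F),
    [set` s] `<=` B /\ v = \sum_(x <- s) a x *: x].

Definition linearly_independent (B : set X) : Prop :=
  forall (s : seq X) (a : X -> F), uniq s -> [set` s] `<=` B ->
    \sum_(x <- s) a x *: x = 0 -> forall x, x \in s -> a x = 0.

Definition hamel_basis (M B : set X) : Prop :=
  linearly_independent B /\ linear_span B = M.

Definition same_dim (M N : set X) : Prop :=
  exists B B' : set X, [/\ hamel_basis M B, hamel_basis N B' & (B #= B')%card].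

End Lineability.

Definition maximal_dense_lineable (F : numFieldType)
    (X : preTopologicalLmodType F) (S : set X) : Prop :=
  exists M : set X,
    [/\ submod_closed (mem M), dense M, same_dim M setT &
        M `<=` S `|` [set 0]].

(* Main.v *)
(* For a holomorphic [f] let [l_i f] be its suitably scaled Taylor coefficients at
   a point of the domain. The subspace is the range of an injective linear
   operator [T f = \sum_i l_i f g_i], where the [g_i] are built so that
   - [g_i] is tiny on an exhausting sequence of compact sets and close to a
     multiple of a prescribed polynomial, so that the range is dense;
   - on [phi_n (K_nu)], for [n] in [A nu], [g_i (phi_n z)] is close to a
     prescribed polynomial [Q_nu z] if [i] is the index attached to [nu], and
     close to 0 otherwise. For [f <> 0] some [l_i f] is nonzero, so that [T f]
     is frequently universal: composed with [phi_n] it approximates [l_i f Q_nu]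
     on [K_nu] for all but finitely many [n] in [A nu].
   The [g_i] are limits of polynomials given by Runge's theorem, applied to
   unions of compact sets with connected complement. That images of such sets
   under univalent maps, and disjoint unions of them, still have connected
   complement is shown by characterizing the points [a] of the unbounded
   component of the complement of a compact [X] as those for which [z - a] has a
   continuous square root on [X]. Runge's theorem follows from a Goursat lemma
   for midpoint sums over grids of squares. *)

(* The equality of dimensions is obtained without computing a cardinal: an injective linear operator
   carries a Hamel basis to one of its range. Injectivity itself follows from universality, since
   [T f = 0] could not approximate the constant 1. The obstacle in building [g_i] is that an image
   [phi_n (K_nu)] may straddle the boundary of a member of the exhaustion, where smallness and
   prescribed values would conflict. The exhausting sets are therefore enlarged by every image that
   meets them and their holes are filled ([filled]); outside such a set an image leaves only a
   compact remainder. Values are prescribed for [g_i (phi_n z)], so Runge's theorem is proved for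
   approximation by polynomials in an injective holomorphic [psi], with Cauchy's kernel written in
   the variable [psi], instead of inverting [psi]. The derivative of [psi] is shown to be nonzero
   only at points arbitrarily near each given one. Square roots are preferred to logarithms because
   the two branches [s] and [-s] turn the winding number into a parity in [F_2]. *)
Require Import Defs.
From HB Require Import structures.
From mathcomp Require Import finmap all_boot all_order all_algebra.
From mathcomp Require Import all_classical all_reals all_analysis.
From mathcomp Require Import complex.
From mathcomp Require Import ring lra zify.

Set Implicit Arguments.
Unset Strict Implicit.
Unset Printing Implicit Defensive.

Import Order.TTheory GRing.Theory Num.Theory.
Import numFieldNormedType.Exports.

Local Open Scope classical_set_scope.
Local Open Scope ring_scope.

(** * The modulus of a complex number *)

Section Modulus.
Variable R : realType.
Local Notation C := R[i].
Implicit Types (x y z w : C).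

(** The norm of [R[i]] takes its values in [R[i]], whose order is only partial; a modulus with
    values in [R] opens the estimates to linear arithmetic. *)
Definition cm (z : C) : R := Num.sqrt (complex.Re z ^+ 2 + complex.Im z ^+ 2).

Lemma normcE z : `|z| = (cm z)%:C%C.
Proof. by rewrite normc_def. Qed.

Lemma cm_ge0 z : 0 <= cm z. Proof. exact: sqrtr_ge0. Qed.

Lemma sqr_cm z : cm z ^+ 2 = complex.Re z ^+ 2 + complex.Im z ^+ 2.
Proof. by rewrite sqr_sqrtr// addr_ge0// sqr_ge0. Qed.

Lemma cmM x y : cm (x * y) = cm x * cm y.
Proof. by apply: complexI; rewrite rmorphM/= -!normcE normrM. Qed.

Lemma cmD x y : cm (x + y) <= cm x + cm y.
Proof. by rewrite -lecR rmorphD/= -!normcE ler_normD. Qed.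

Lemma cmN x : cm (- x) = cm x.
Proof. by apply: complexI; rewrite -!normcE normrN. Qed.

Lemma cmC x y : cm (x - y) = cm (y - x).
Proof. by rewrite -cmN opprB. Qed.

Lemma cm0 : cm 0 = 0.
Proof. by apply: complexI; rewrite -!normcE normr0. Qed.

Lemma cm1 : cm 1 = 1.
Proof. by apply: complexI; rewrite -!normcE normr1. Qed.

Lemma cm_eq0 z : (cm z == 0) = (z == 0).
Proof. by rewrite -(inj_eq (@complexI R)) -normcE normr_eq0. Qed.

Lemma cm_gt0 z : (0 < cm z) = (z != 0).
Proof. by rewrite lt_def cm_ge0 andbT cm_eq0. Qed.

Lemma cmV z : cm z^-1 = (cm z)^-1.
Proof. by apply: complexI; rewrite fmorphV/= -!normcE normfV. Qed.

Lemma cmX z n : cm (z ^+ n) = cm z ^+ n.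
Proof. by apply: complexI; rewrite rmorphXn/= -!normcE normrX. Qed.

Lemma cmf x y : cm (x / y) = cm x / cm y.
Proof. by rewrite cmM cmV. Qed.

Lemma cm_real (r : R) : cm r%:C%C = `|r|.
Proof. by rewrite /cm /= expr0n addr0 sqrtr_sqr. Qed.

Lemma cm_Re z : `|complex.Re z| <= cm z.
Proof. by rewrite -lecR -normcE normc_ge_Re. Qed.

Lemma cm_Im z : `|complex.Im z| <= cm z.
Proof.
rewrite -(@ler_pXn2r _ 2)// ?nnegrE ?cm_ge0// sqr_cm real_normK ?num_real//.
by rewrite lerDr sqr_ge0.
Qed.

Lemma cm_le z : cm z <= `|complex.Re z| + `|complex.Im z|.
Proof.
rewrite -(@ler_pXn2r _ 2)// ?nnegrE ?cm_ge0 ?addr_ge0// sqr_cm sqrrD.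
by rewrite !real_normK ?num_real// -addrA lerD2l lerDr mulrn_wge0// mulr_ge0.
Qed.

Lemma cmB x y : cm (x - y) <= cm x + cm y.
Proof. by rewrite -(cmN y); exact: cmD. Qed.

Lemma cm_tri z x y : cm (x - y) <= cm (x - z) + cm (z - y).
Proof. by rewrite -(subrKA z); exact: cmD. Qed.

Lemma cm_rev x y : cm x - cm y <= cm (x - y).
Proof. by rewrite lerBlDr -{1}(subrK y x) cmD. Qed.

Lemma eq_cm0 z : (forall e, 0 < e -> cm z <= e) -> z = 0.
Proof.
move=> h; apply/eqP; rewrite -cm_eq0; apply/eqP/le_anti; rewrite cm_ge0 andbT.
by apply/ler_addgt0Pl => e /h; rewrite addr0.
Qed.

Lemma ler_cmM (a b : C) (A B : R) :
  cm a <= A -> cm b <= B -> cm (a * b) <= A * B.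
Proof. by move=> aA bB; rewrite cmM ler_pM// cm_ge0. Qed.

Lemma cReD x y : complex.Re (x + y) = complex.Re x + complex.Re y.
Proof. by case: x; case: y. Qed.
Lemma cImD x y : complex.Im (x + y) = complex.Im x + complex.Im y.
Proof. by case: x; case: y. Qed.
Lemma cReN x : complex.Re (- x) = - complex.Re x.
Proof. by case: x. Qed.
Lemma cImN x : complex.Im (- x) = - complex.Im x.
Proof. by case: x. Qed.
Lemma cReM x y : complex.Re (x * y) =
  complex.Re x * complex.Re y - complex.Im x * complex.Im y.
Proof. by case: x; case: y. Qed.
Lemma cImM x y : complex.Im (x * y) =
  complex.Re x * complex.Im y + complex.Im x * complex.Re y.
Proof. by case: x => a b; case: y => c d. Qed.

Definition cE := (cReD, cImD, cReN, cImN, cReM, cImM).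

Lemma complex_ext x y :
  complex.Re x = complex.Re y -> complex.Im x = complex.Im y -> x = y.
Proof. by case: x => a b; case: y => c d /= -> ->. Qed.

Definition ccvg (u : nat -> C) (l : C) :=
  forall e : R, 0 < e -> exists N, forall n, (N <= n)%N -> cm (u n - l) <= e.

Lemma ccvg_unique u l l' : ccvg u l -> ccvg u l' -> l = l'.
Proof.
move=> ul ul'; apply/eqP; rewrite -subr_eq0; apply/eqP/eq_cm0 => e e0.
have e20 : 0 < e / 2 by lra.
have [N hN] := ul _ e20; have [N' hN'] := ul' _ e20.
have := cm_tri (u (maxn N N')) l l'.
have := hN _ (leq_maxl N N'); have := hN' _ (leq_maxr N N').
by rewrite (cmC (u _) l); lra.
Qed.

End Modulus.

(** * Complex derivatives and compact sets *)

Section Calculus.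
Variable R : realType.
Local Notation C := R[i].
Implicit Types (x y z w : C) (X Y K : C -> Prop) (f g : C -> C).

Definition ccont f z := forall e : R, 0 < e -> exists2 d : R, 0 < d &
  forall w, cm (w - z) < d -> cm (f w - f z) < e.

(** No quotient occurs, so [h = 0] need not be excluded; [derivable_cdiff] relates this to the
    derivative of the library. *)
Definition cderiv f z (d : C) := forall e : R, 0 < e -> exists2 r : R, 0 < r &
  forall h : C, cm h < r -> cm (f (z + h) - f z - d * h) <= e * cm h.

Definition cdiff f z := exists d, cderiv f z d.

Lemma ccont_cst c z : ccont (fun=> c) z.
Proof. by move=> e e0; exists 1 => // w _; rewrite subrr cm0. Qed.

Lemma ccont_id z : ccont id z.
Proof. by move=> e e0; exists e. Qed.

Lemma ccont_near f g z (r : R) : 0 < r -> (forall w, cm (w - z) < r -> f w = g w) ->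
  ccont f z -> ccont g z.
Proof.
move=> r0 fg fz e /fz[d d0 h]; exists (Num.min d r); rewrite ?lt_min ?d0//.
move=> w; rewrite lt_min => /andP[wd wr]; rewrite -!fg ?subrr ?cm0//; exact: h.
Qed.

Lemma ccontD f g z : ccont f z -> ccont g z -> ccont (fun w => f w + g w) z.
Proof.
move=> fz gz e e0; have e2 : 0 < e / 2 by lra.
have [d d0 hd] := fz _ e2; have [d' d0' hd'] := gz _ e2.
exists (Num.min d d'); rewrite ?lt_min ?d0// => w; rewrite lt_min => /andP[/hd a /hd' b].
rewrite opprD addrACA (le_lt_trans (cmD _ _))//; lra.
Qed.

Lemma ccont_bounded f z : ccont f z -> exists2 r : R, 0 < r &
  forall w, cm (w - z) < r -> cm (f w) <= cm (f z) + 1.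
Proof.
move=> /(_ 1 ltr01)[r r0 h]; exists r => // w /h; have := cm_rev (f w) (f z); lra.
Qed.

Lemma ccontM f g z : ccont f z -> ccont g z -> ccont (fun w => f w * g w) z.
Proof.
move=> fz gz e e0; have [r r0 hr] := ccont_bounded fz.
have A0 := cm_ge0 (f z); have B0 := cm_ge0 (g z).
set A := cm (f z) + 1; set B := cm (g z) + 1.
have eA : 0 < e / 2 / A by rewrite divr_gt0//; rewrite /A; lra.
have eB : 0 < e / 2 / B by rewrite divr_gt0//; rewrite /B; lra.
have [d d0 hd] := fz _ eB; have [d' d0' hd'] := gz _ eA.
exists (Num.min r (Num.min d d')); rewrite ?lt_min ?r0 ?d0// => w.
rewrite !lt_min => /and3P[/hr a /hd b /hd' c].
have -> : f w * g w - f z * g z = f w * (g w - g z) + (f w - f z) * g z by ring.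
rewrite (le_lt_trans (cmD _ _))// !cmM.
have h1 : cm (f w) * cm (g w - g z) <= A * cm (g w - g z).
  by rewrite ler_wpM2r// cm_ge0.
have h2 : A * cm (g w - g z) < e / 2.
  by rewrite mulrC -ltr_pdivlMr//; rewrite /A; lra.
have h3 : cm (f w - f z) * cm (g z) <= cm (f w - f z) * B.
  by rewrite ler_wpM2l ?cm_ge0//; rewrite /B; lra.
have h4 : cm (f w - f z) * B < e / 2.
  by rewrite -ltr_pdivlMr//; rewrite /B; lra.
lra.
Qed.

Lemma ccontN f z : ccont f z -> ccont (fun w => - f w) z.
Proof. by move=> fz e /fz[d d0 h]; exists d => // w /h; rewrite -opprD cmN. Qed.

Lemma ccontV f z : ccont f z -> f z != 0 -> ccont (fun w => (f w)^-1) z.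
Proof.
move=> fz fz0 e e0.
have a0 : 0 < cm (f z) by rewrite cm_gt0.
set a := cm (f z) in a0.
have [d d0 hd] := fz _ (divr_gt0 a0 (ltr0n R 2)).
have e1 : 0 < e * a * a / 2 by rewrite divr_gt0// !mulr_gt0.
have [d' d0' hd'] := fz _ e1.
exists (Num.min d d'); rewrite ?lt_min ?d0// => w.
rewrite !lt_min => /andP[/hd b /hd' c].
have fw : a / 2 < cm (f w).
  by have := cm_rev (f z) (f w); rewrite (cmC (f z)); rewrite -/a; lra.
have fw0 : f w != 0 by rewrite -cm_gt0; lra.
have -> : (f w)^-1 - (f z)^-1 = (f z - f w) / (f w * f z).
  by field; rewrite fw0 fz0.
rewrite cmf cmM cmC -/a ltr_pdivrMr ?mulr_gt0//; last lra.
apply: (lt_trans c).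
rewrite -mulrA -mulrA ltr_pM2l// (_ : a * (a / 2) = (a / 2) * a); last by ring.
by rewrite ltr_pM2r.
Qed.

(** Caratheodory's slope functions turn the rules of differentiation into algebraic identities; the
    only analysis left is continuity of the slope at 0. *)
Lemma caratheodory f z d : cderiv f z d <->
  exists q : C -> C, [/\ q 0 = d, ccont q 0 & forall h, f (z + h) = f z + h * q h].
Proof.
split=> [fd|[q [q0 qc qf]]].
  exists (fun h => if h == 0 then d else (f (z + h) - f z) / h); split=> //.
  - by rewrite eqxx.
  - move=> e e0; have [r r0 hr] := fd _ (divr_gt0 e0 (ltr0n R 2)); exists r => // w.
    rewrite subr0 eqxx => /hr; have [->|w0] := eqVneq w 0; first by rewrite subrr cm0.
    have w1 : 0 < cm w by rewrite cm_gt0.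
    have -> : (f (z + w) - f z) / w - d = (f (z + w) - f z - d * w) / w by field.
    rewrite cmf -ler_pdivrMr// => h; apply: (le_lt_trans h); lra.
  - by move=> h; have [->|h0] := eqVneq h 0; [rewrite addr0 mul0r addr0|field].
move=> e e0; have [r r0 hr] := qc _ e0; exists r => // h.
rewrite -{1}(subr0 h) => /hr; rewrite q0 qf => hh.
have -> : f z + h * q h - f z - d * h = (q h - d) * h by ring.
by rewrite cmM ler_wpM2r ?cm_ge0// ltW.
Qed.

Lemma cderiv_cont f z d : cderiv f z d -> ccont f z.
Proof.
move=> /caratheodory[q [_ qc qf]].
have qc' : ccont (fun h => f z + h * q h) 0.
  by apply: ccontD; [exact: ccont_cst|apply: ccontM => //; exact: ccont_id].
move=> e /qc'[r r0 h]; exists r => // w wr.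
by have := h (w - z); rewrite subr0 -!qf addr0 subrKC; exact.
Qed.

Lemma cdiff_cont f z : cdiff f z -> ccont f z.
Proof. by case=> d; exact: cderiv_cont. Qed.

Lemma cderiv_unique f z d d' : cderiv f z d -> cderiv f z d' -> d = d'.
Proof.
move=> fd fd'; apply/eqP; rewrite -subr_eq0; apply/eqP/eq_cm0 => e e0.
have e2 : 0 < e / 2 by lra.
have [r r0 hr] := fd _ e2; have [s s0 hs] := fd' _ e2.
pose m := Num.min r s / 2.
have m0 : 0 < m by rewrite divr_gt0// lt_min r0.
have mr : m < r by rewrite ltr_pdivrMr// gt_min; apply/orP; left; lra.
have ms : m < s by rewrite ltr_pdivrMr// gt_min; apply/orP; right; lra.
have cmm : cm (m%:C)%C = m by rewrite cm_real gtr0_norm.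
have := hr (m%:C)%C; have := hs (m%:C)%C; rewrite cmm => /(_ ms) h1 /(_ mr) h2.
set u := f _ in h1 h2.
have : cm ((d - d') * (m%:C)%C) <= e * m.
  have -> : (d - d') * (m%:C)%C = (u - f z - d' * (m%:C)%C) - (u - f z - d * (m%:C)%C) by ring.
  by rewrite (le_trans (cmB _ _))//; lra.
by rewrite cmM cmm ler_pM2r.
Qed.

Lemma cderiv_near f g z d (r : R) : 0 < r ->
  (forall w, cm (w - z) < r -> f w = g w) -> cderiv f z d -> cderiv g z d.
Proof.
move=> r0 fg fd e /fd[s s0 hs]; exists (Num.min s r); rewrite ?lt_min ?s0// => h.
rewrite lt_min => /andP[/hs a hr]; rewrite -!fg ?subrr ?cm0//.
by rewrite addrC addKr.
Qed.

Lemma cderiv_cst c z : cderiv (fun=> c) z 0.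
Proof.
by move=> e e0; exists 1 => // h _; rewrite subrr mul0r subrr cm0 mulr_ge0 ?cm_ge0// ltW.
Qed.

Lemma cderiv_id z : cderiv id z 1.
Proof.
move=> e e0; exists 1 => // h _.
by rewrite mul1r (addrC z) addrK subrr cm0 mulr_ge0 ?cm_ge0// ltW.
Qed.

Lemma cderivD f g z a b : cderiv f z a -> cderiv g z b ->
  cderiv (fun w => f w + g w) z (a + b).
Proof.
move=> /caratheodory[q [q0 qc qf]] /caratheodory[p [p0 pc pf]].
apply/caratheodory; exists (fun h => q h + p h); split; first by rewrite q0 p0.
  exact: ccontD.
by move=> h; rewrite qf pf; ring.
Qed.

Lemma cderivM f g z a b : cderiv f z a -> cderiv g z b ->
  cderiv (fun w => f w * g w) z (a * g z + f z * b).
Proof.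
move=> fd gd; have gc := cderiv_cont gd; move: fd gd.
move=> /caratheodory[q [q0 qc qf]] /caratheodory[p [p0 pc pf]].
apply/caratheodory; exists (fun h => q h * (g z + h * p h) + f z * p h); split.
- by rewrite q0 p0 mul0r addr0.
- apply: ccontD; apply: ccontM => //; last exact: ccont_cst.
  apply: ccontD; first exact: ccont_cst.
  by apply: ccontM => //; exact: ccont_id.
- by move=> h; rewrite qf pf; ring.
Qed.

Lemma cderivV f z a : cderiv f z a -> f z != 0 ->
  cderiv (fun w => (f w)^-1) z (- (a / f z ^+ 2)).
Proof.
move=> fd fz0; have /cderiv_cont fc := fd; move: fd.
move=> /caratheodory[q [q0 qc qf]].
have fc1 : ccont (fun h => f z + h * q h) 0.
  by apply: ccontD; [exact: ccont_cst|apply: ccontM => //; exact: ccont_id].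
have fz1 : 0 < cm (f z) by rewrite cm_gt0.
have [r r0 hr] := fc _ fz1.
have nz h : cm h < r -> f z + h * q h != 0.
  move=> hr'; rewrite -qf -cm_gt0.
  have := hr (z + h); rewrite (addrC z) addrK => /(_ hr').
  by have := cm_rev (f z) (f (h + z)); rewrite (cmC (f z)); lra.
(* The closed formula for the slope breaks down where [f (z + h)] vanishes; far from 0, where no
   continuity is asked, the raw difference quotient replaces it. *)
pose q' h := if cm h < r then - (q h / ((f z + h * q h) * f z))
  else ((f (z + h))^-1 - (f z)^-1) / h.
apply/caratheodory; exists q'; split.
- by rewrite /q' cm0 r0 q0 mul0r addr0 expr2.
- apply: (@ccont_near (fun h => - (q h / ((f z + h * q h) * f z))) _ _ r) => //.
    by move=> w; rewrite subr0 /q' => ->.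
  apply: ccontN; apply: ccontM => //; apply: (@ccontV (fun h => (f z + h * q h) * f z)).
    by apply: ccontM => //; exact: ccont_cst.
  by rewrite mul0r addr0 mulf_neq0.
- move=> h; rewrite /q'; case: ifPn => [hr'|].
    by rewrite qf; field; rewrite fz0 nz.
  rewrite -leNgt => hr'; have h0 : h != 0 by rewrite -cm_gt0; lra.
  by rewrite mulrC divfK// subrKC.
Qed.

Lemma cdiff_near f g z (r : R) : 0 < r ->
  (forall w, cm (w - z) < r -> f w = g w) -> cdiff f z -> cdiff g z.
Proof. by move=> r0 fg [d fd]; exists d; exact: cderiv_near fg fd. Qed.

Lemma cdiff_cst c z : cdiff (fun=> c) z.
Proof. by exists 0; exact: cderiv_cst. Qed.
Lemma cdiff_id z : cdiff id z.
Proof. by exists 1; exact: cderiv_id. Qed.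
Lemma cdiffD f g z : cdiff f z -> cdiff g z -> cdiff (fun w => f w + g w) z.
Proof. by move=> [a fa] [b gb]; exists (a + b); exact: cderivD. Qed.
Lemma cdiffM f g z : cdiff f z -> cdiff g z -> cdiff (fun w => f w * g w) z.
Proof. by move=> [a fa] [b gb]; eexists; exact: cderivM fa gb. Qed.
Lemma cdiffV f z : cdiff f z -> f z != 0 -> cdiff (fun w => (f w)^-1) z.
Proof. by move=> [a fa] f0; eexists; exact: cderivV fa f0. Qed.
Lemma cdiffB f g z : cdiff f z -> cdiff g z -> cdiff (fun w => f w - g w) z.
Proof.
move=> fz gz; have := cdiffD fz (cdiffM (cdiff_cst (-1) z) gz).
by apply: (@cdiff_near _ _ _ 1) => // w _; rewrite mulN1r.
Qed.
Lemma cdiff_poly (p : {poly C}) z : cdiff (horner p) z.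
Proof.
elim/poly_ind: p => [|p c ih].
  by apply: cdiff_near (cdiff_cst 0 z) => [|w _]; [exact: ltr01|rewrite horner0].
apply: cdiff_near (cdiffD (cdiffM ih (cdiff_id z)) (cdiff_cst c z)) => [|w _].
  exact: ltr01.
by rewrite hornerMXaddC.
Qed.

Definition cont_on X f := forall x, X x -> forall e : R, 0 < e ->
  exists2 d : R, 0 < d & forall y, X y -> cm (y - x) < d -> cm (f y - f x) < e.

Lemma ccont_cont_on X f : (forall x, X x -> ccont f x) -> cont_on X f.
Proof. by move=> h x Xx e e0; have [d d0 hd] := h x Xx e e0; exists d => // y _; exact: hd. Qed.

(* Compactness, in the form of a principle turning local eventual statements
   into uniform ones. *)
Definition ccompact K := forall P : nat -> C -> Prop,
  (forall x, K x -> exists2 d : R, 0 < d & exists N, forall y, K y -> cm (y - x) < d ->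
     forall n, (N <= n)%N -> P n y) ->
  exists N, forall y, K y -> forall n, (N <= n)%N -> P n y.

Definition copen X := forall x, X x -> exists2 d : R, 0 < d & forall y, cm (y - x) < d -> X y.

Lemma archi_inv (d : R) : 0 < d -> exists N, forall n, (N <= n)%N -> n.+1%:R^-1 < d.
Proof.
move=> d0; exists (Num.truncn d^-1) => n Nn.
rewrite invf_plt ?posrE ?ltr0n//.
have := truncnS_gt d^-1; move=> /lt_le_trans; apply.
by rewrite ler_nat ltnS.
Qed.

Lemma archi_nat (a : R) : exists N, forall n, (N <= n)%N -> a < n%:R.
Proof.
exists (Num.truncn a).+1 => n Nn; apply: lt_le_trans (truncnS_gt a) _.
by rewrite ler_nat.
Qed.

Lemma ccompact_bounded_fun K f : ccompact K -> cont_on K f ->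
  exists B : R, 0 < B /\ forall x, K x -> cm (f x) <= B.
Proof.
move=> cK fc.
have [|N hN] := cK (fun n x => cm (f x) <= n%:R).
  move=> x Kx; have [d d0 hd] := fc x Kx 1 ltr01; exists d => //.
  have [N hN] := archi_nat (cm (f x) + 1); exists N => y Ky /(hd _ Ky) h n /hN /=.
  by have := cm_rev (f y) (f x); lra.
exists N.+1%:R; split=> [|x Kx]; first exact: ltr0n.
exact: (hN x Kx).
Qed.

Lemma ccompact_bounded K : ccompact K -> exists B : R, 0 < B /\ forall x, K x -> cm x <= B.
Proof.
by move=> /ccompact_bounded_fun; apply; apply: ccont_cont_on => x _; exact: ccont_id.
Qed.

Lemma ccompact_away K f : ccompact K -> cont_on K f -> (forall x, K x -> f x <> 0) ->
  exists2 d : R, 0 < d & forall x, K x -> d <= cm (f x).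
Proof.
move=> cK fc f0.
have [|N hN] := cK (fun n x => n.+1%:R^-1 <= cm (f x)).
  move=> x Kx; have a0 : 0 < cm (f x) by rewrite cm_gt0; apply/eqP/f0.
  have a2 : 0 < cm (f x) / 2 by lra.
  have [d d0 hd] := fc x Kx _ a2; exists d => //.
  have [N hN] := archi_inv a2; exists N => y Ky /(hd _ Ky) h n /hN /=.
  by have := cm_rev (f x) (f y); rewrite (cmC (f x)); set q := _^-1; lra.
exists N.+1%:R^-1; first by rewrite invr_gt0 ltr0n.
by move=> x Kx; exact: (hN x Kx).
Qed.

Lemma ccompact_dist K a : ccompact K -> ~ K a ->
  exists2 d : R, 0 < d & forall x, K x -> d <= cm (x - a).
Proof.
move=> cK Ka; apply: (@ccompact_away K (fun x => x - a)) => //.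
  apply: ccont_cont_on => x _; apply: ccontD; [exact: ccont_id|exact: ccont_cst].
by move=> x Kx /eqP; rewrite subr_eq0 => /eqP xa; apply: Ka; rewrite -xa.
Qed.

Lemma ccompact_closed K : ccompact K -> copen (fun x => ~ K x).
Proof.
move=> cK x Kx; have [d d0 h] := ccompact_dist cK Kx.
exists d => // y yd Ky; have := h _ Ky; lra.
Qed.

Lemma ccompact_closedI K X : ccompact K -> copen (fun x => ~ X x) ->
  ccompact (fun x => K x /\ X x).
Proof.
move=> cK oX P hP.
have [|N hN] := cK (fun n x => X x -> P n x).
  move=> x Kx; have [Xx|Xx] := pselect (X x).
    have [d d0 [N hN]] := hP x (conj Kx Xx); exists d => //; exists N => y Ky yx n Nn Xy.
    exact: hN.
  by have [d d0 hd] := oX _ Xx; exists d => //; exists 0 => y Ky /hd.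
by exists N => y [Ky Xy] n Nn; exact: hN.
Qed.

Lemma ccompactU K X : ccompact K -> ccompact X -> ccompact (fun x => K x \/ X x).
Proof.
move=> cK cX P hP.
have [|N hN] := cK P.
  move=> x Kx; have [|d d0 [N hN]] := hP x; first by left.
  by exists d => //; exists N => y Ky; apply: hN; left.
have [|N' hN'] := cX P.
  move=> x Kx; have [|d d0 [N' hN']] := hP x; first by right.
  by exists d => //; exists N' => y Ky; apply: hN'; right.
exists (maxn N N') => y [Ky|Xy] n; rewrite geq_max => /andP[a b]; [exact: hN|exact: hN'].
Qed.

Lemma ccompact0 : ccompact (fun=> False).
Proof. by move=> P _; exists 0. Qed.

Lemma ccompact_ext K X : (forall x, K x <-> X x) -> ccompact K -> ccompact X.
Proof.
move=> KX cK P hP; have [|N hN] := cK P.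
  move=> x /KX/hP[d d0 [N hN]]; exists d => //; exists N => y /KX; exact: hN.
by exists N => y /KX; exact: hN.
Qed.

Definition cimage f X w := exists2 z, X z & w = f z.

Lemma ccompact_image K f : ccompact K -> cont_on K f -> ccompact (cimage f K).
Proof.
move=> cK fc P hP.
have [|N hN] := cK (fun n x => P n (f x)).
  move=> x Kx; have [|d d0 [N hN]] := hP (f x); first by exists x.
  have [r r0 hr] := fc x Kx _ d0; exists r => //; exists N => y Ky yx n.
  by apply: hN => //; [exists y|exact: hr].
by exists N => _ [x Kx ->]; exact: hN.
Qed.

Lemma ccompact_ucont K f : ccompact K -> cont_on K f -> forall e : R, 0 < e ->
  exists2 d : R, 0 < d & forall x y, K x -> K y -> cm (y - x) < d -> cm (f y - f x) < e.
Proof.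
move=> cK fc e e0.
have [|N hN] := cK (fun n x => forall y, K y -> cm (y - x) < n.+1%:R^-1 -> cm (f y - f x) < e).
  move=> x Kx; have [d d0 hd] := fc x Kx (e / 2) (divr_gt0 e0 (ltr0n _ 2)).
  exists (d / 2); first by rewrite divr_gt0.
  have [N hN] := archi_inv (divr_gt0 d0 (ltr0n R 2)); exists N => y Ky yx n /hN + z Kz; set q := _^-1 => nd zy.
  have h1 : cm (f y - f x) < e / 2 by apply: hd => //; lra.
  have h2 : cm (f z - f x) < e / 2.
    by apply: hd => //; have := cm_tri y z x; lra.
  by have := cm_tri (f x) (f z) (f y); rewrite (cmC (f x)); lra.
exists N.+1%:R^-1; first by rewrite invr_gt0 ltr0n.
by move=> x y Kx Ky; exact: hN.
Qed.

Lemma ccompact_open_margin K X : ccompact K -> copen X -> (forall x, K x -> X x) ->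
  exists2 d : R, 0 < d & forall x y, K x -> cm (y - x) < d -> X y.
Proof.
move=> cK oX KX.
have [|N hN] := cK (fun n x => forall y, cm (y - x) < n.+1%:R^-1 -> X y).
  move=> x Kx; have [d d0 hd] := oX x (KX _ Kx).
  exists (d / 2); first by rewrite divr_gt0.
  have [N hN] := archi_inv (divr_gt0 d0 (ltr0n R 2)); exists N => y Ky yx n /hN + z; set q := _^-1 => nd zy.
  by apply: hd; have := cm_tri y z x; lra.
exists N.+1%:R^-1; first by rewrite invr_gt0 ltr0n.
by move=> x y Kx; exact: hN.
Qed.

End Calculus.

(** * Midpoint sums over squares *)

Section Squares.
Variable R : realType.
Local Notation C := R[i].
Local Notation Re := complex.Re.
Local Notation Im := complex.Im.
Implicit Types (x y z w c : C) (s : R) (F G : C -> C).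

Definition inSq c s z :=
  [/\ Re c <= Re z, Re z <= Re c + s, Im c <= Im z & Im z <= Im c + s].

Definition pt c (a b : R) : C := c + (a +i* b)%C.

Lemma Re_pt c a b : Re (pt c a b) = Re c + a. Proof. by case: c. Qed.
Lemma Im_pt c a b : Im (pt c a b) = Im c + b. Proof. by case: c. Qed.
Lemma ptpt c a b a' b' : pt (pt c a b) a' b' = pt c (a + a') (b + b').
Proof. by apply: complex_ext; rewrite !(Re_pt, Im_pt) addrA. Qed.
Lemma pt00 c : pt c 0 0 = c.
Proof. by apply: complex_ext; rewrite !(Re_pt, Im_pt) addr0. Qed.

Lemma half_small (s0 d : R) : 0 < d -> exists n, s0 / 2 ^+ n < d.
Proof.
move=> d0; have [N hN] := archi_nat (s0 / d); exists N.
have N2 : (0 : R) < 2 ^+ N by rewrite exprn_gt0.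
rewrite ltr_pdivrMr// mulrC -ltr_pdivrMr// (lt_le_trans (hN N (leqnn _)))//.
by rewrite -natrX ler_nat ltnW// ltn_expl.
Qed.

(** Cousin's lemma for squares: if [P] failed, repeated bisection would select nested squares on
    which it fails, shrinking to a point near which small squares satisfy [P]. It later yields
    boundedness, compactness of squares and completeness. *)
Lemma cousin (P : C -> R -> Prop) c0 s0 : 0 < s0 ->
  (forall c s, 0 < s -> P c (s / 2) -> P (pt c (s / 2) 0) (s / 2) ->
     P (pt c 0 (s / 2)) (s / 2) -> P (pt c (s / 2) (s / 2)) (s / 2) -> P c s) ->
  (forall x, inSq c0 s0 x -> exists2 d : R, 0 < d & forall c s, 0 < s -> s < d ->
     inSq c s x -> (forall z, inSq c s z -> inSq c0 s0 z) -> P c s) -> P c0 s0.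
Proof.
move=> s00 split loc; apply: contrapT => nP.
have next (q : C * R) : exists q' : C * R, 0 < q.2 -> ~ P q.1 q.2 ->
    [/\ ~ P q'.1 q'.2, q'.2 = q.2 / 2, Re q.1 <= Re q'.1 <= Re q.1 + q.2 / 2 &
        Im q.1 <= Im q'.1 <= Im q.1 + q.2 / 2].
  have [q20|q20] := pselect (0 < q.2); last by exists q.
  have [Pq|Pq] := pselect (P q.1 q.2); first by exists q.
  have q2 : 0 < q.2 / 2 by rewrite divr_gt0.
  have [P1|P1] := pselect (P q.1 (q.2 / 2)); last first.
    by exists (q.1, q.2 / 2) => _ _; split=> //=; lra.
  have [P2|P2] := pselect (P (pt q.1 (q.2 / 2) 0) (q.2 / 2)); last first.
    by exists (pt q.1 (q.2 / 2) 0, q.2 / 2) => _ _; split=> //=; rewrite ?Re_pt ?Im_pt; lra.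
  have [P3|P3] := pselect (P (pt q.1 0 (q.2 / 2)) (q.2 / 2)); last first.
    by exists (pt q.1 0 (q.2 / 2), q.2 / 2) => _ _; split=> //=; rewrite ?Re_pt ?Im_pt; lra.
  have [P4|P4] := pselect (P (pt q.1 (q.2 / 2) (q.2 / 2)) (q.2 / 2)); last first.
    by exists (pt q.1 (q.2 / 2) (q.2 / 2), q.2 / 2) => _ _; split=> //=; rewrite ?Re_pt ?Im_pt; lra.
  by exfalso; apply: Pq; exact: split.
have [step stepP] := choice next.
pose q n := iter n step (c0, s0).
have qP n : 0 < (q n).2 /\ ~ P (q n).1 (q n).2.
  elim: n => [//|n [ih1 ih2]]; have [h1 h2 _ _] := stepP _ ih1 ih2.
  by split=> //=; rewrite h2 divr_gt0.
have qS n : [/\ (q n.+1).2 = (q n).2 / 2, Re (q n).1 <= Re (q n.+1).1 <= Re (q n).1 + (q n).2 / 2 &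
        Im (q n).1 <= Im (q n.+1).1 <= Im (q n).1 + (q n).2 / 2].
  by have [h1 h2] := qP n; have [_ ? ? ?] := stepP _ h1 h2; split.
have q2 n : (q n).2 = s0 / 2 ^+ n.
  elim: n => [|n ih]; first by rewrite expr0 divr1.
  by have [-> _ _] := qS n; rewrite ih exprSr invfM mulrA.
have q0 : q 0 = (c0, s0) by [].
clearbody q.
have nested n k : [/\ Re (q n).1 <= Re (q (n + k)%N).1,
    Re (q (n + k)%N).1 + (q (n + k)%N).2 <= Re (q n).1 + (q n).2,
    Im (q n).1 <= Im (q (n + k)%N).1 &
    Im (q (n + k)%N).1 + (q (n + k)%N).2 <= Im (q n).1 + (q n).2].
  elim: k => [|k [i1 i2 i3 i4]]; first by rewrite addn0.
  rewrite addnS; have [e /andP[a b] /andP[a' b']] := qS (n + k)%N.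
  by split; rewrite ?e; lra.
(* Applied to [Re] and [Im]: left ends of nested intervals are bounded by every right end, so their
   supremum lies in all the intervals. *)
have lim (f : C -> R) : (forall n k, f (q n).1 <= f (q (n + k)%N).1 /\
    f (q (n + k)%N).1 + (q (n + k)%N).2 <= f (q n).1 + (q n).2) ->
    exists l : R, forall n, f (q n).1 <= l <= f (q n).1 + (q n).2.
  move=> h; pose E := [set f (q n).1 | n in setT]%classic.
  have ub n m : f (q m).1 <= f (q n).1 + (q n).2.
    have [nm|mn] := leqP n m.
      have [_] := h n (m - n)%N; rewrite subnKC// => le1; apply: le_trans le1.
      by rewrite lerDl ltW//; case: (qP m).
    have [+ _] := h m (n - m)%N; rewrite (subnKC (ltnW mn)) => le1; apply: (le_trans le1).
    by rewrite lerDl ltW//; case: (qP n).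
  have ubE n : ubound E (f (q n).1 + (q n).2) by move=> _ [m _ <-].
  have hE : has_sup E.
    by split; [exists (f (q 0).1), 0|exists (f (q 0).1 + (q 0).2)].
  exists (sup E) => n; apply/andP; split.
    by apply: sup_upper_bound => //; exists n.
  by apply: ge_sup => //; case: hE.
have [|lr hr] := lim (fun z => Re z); first by move=> n k; have [] := nested n k.
have [|li hi] := lim (fun z => Im z); first by move=> n k; have [] := nested n k.
have inx n : inSq (q n).1 (q n).2 (lr +i* li)%C.
  by have /andP[? ?] := hr n; have /andP[? ?] := hi n.
have := inx 0; rewrite q0 => inx0.
have [d d0 hd] := loc _ inx0.
have [n hn] := half_small s0 d0.
have [p1 p2] := qP n; apply: p2; apply: hd => //; first by rewrite q2.
move=> z [z1 z2 z3 z4]; have [] := nested 0 n; rewrite add0n q0 => n1 n2 n3 n4.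
by split; [exact: le_trans n1 z1|exact: le_trans z2 n2|exact: le_trans n3 z3|exact: le_trans z4 n4].
Qed.

Definition mid (a b : C) : C := (a + b) * ((2^-1)%:C)%C.

Lemma Re_mid a b : Re (mid a b) = (Re a + Re b) / 2.
Proof. by rewrite /mid cReM cReD /= mulr0 subr0. Qed.
Lemma Im_mid a b : Im (mid a b) = (Im a + Im b) / 2.
Proof. by rewrite /mid cImM cImD /= mulr0 add0r. Qed.

Lemma mid_sym a b : mid a b = mid b a. Proof. by rewrite /mid addrC. Qed.
Lemma mid_subl a b : mid a b - a = (b - a) * ((2^-1)%:C)%C.
Proof. by apply: complex_ext; rewrite !(Re_mid, Im_mid, cE) /= ?(Re_mid, Im_mid); lra. Qed.
Lemma mid_subr a b : b - mid a b = (b - a) * ((2^-1)%:C)%C.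
Proof. by apply: complex_ext; rewrite !(Re_mid, Im_mid, cE) /= ?(Re_mid, Im_mid); lra. Qed.

(* Contour integrals are replaced by midpoint sums over [2 ^ n] equal pieces:
   they are exact on affine functions, and refining commutes exactly with the
   bisection of squares, so that no integration theory is needed. *)
Fixpoint midsum F n (a b : C) : C :=
  if n is m.+1 then midsum F m a (mid a b) + midsum F m (mid a b) b else F (mid a b) * (b - a).

(** A [midsum] evaluates its integrand at iterated midpoints only, so this is all the convexity that
    its estimates require. *)
Definition midconvex (D : C -> Prop) := forall a b, D a -> D b -> D (mid a b).

Lemma midsum_anti F n a b : midsum F n b a = - midsum F n a b.
Proof.
elim: n a b => [|n ih] a b /=; first by rewrite (mid_sym b a) -mulrN opprB.
by rewrite (mid_sym b a) (ih a) (ih _ b) -opprD addrC.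
Qed.

Lemma midsum_ext (D : C -> Prop) F G n a b : midconvex D -> D a -> D b ->
  (forall z, D z -> F z = G z) -> midsum F n a b = midsum G n a b.
Proof.
move=> cD + + FG; elim: n a b => [|n ih] a b Da Db /=; first by rewrite FG//; exact: cD.
by rewrite ih ?(ih (mid a b))//; exact: cD.
Qed.

Lemma midsumZ k F n a b : midsum (fun z => k * F z) n a b = k * midsum F n a b.
Proof.
elim: n a b => [|n ih] a b /=; first by rewrite mulrA.
by rewrite !ih; ring.
Qed.

Lemma midsumB F G n a b : midsum (fun z => F z - G z) n a b = midsum F n a b - midsum G n a b.
Proof.
elim: n a b => [|n ih] a b /=; first by rewrite mulrBl.
by rewrite !ih; ring.
Qed.

Lemma midsum_lin k l n a b : midsum (fun z => k + l * z) n a b = (k + l * mid a b) * (b - a).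
Proof.
elim: n a b => [//|n ih] a b /=.
rewrite !ih; have eb : b = mid a b + mid a b - a.
  by apply: complex_ext; rewrite !(Re_mid, Im_mid, cE) /= ?(Re_mid, Im_mid); lra.
move: (mid a b) eb => m ->; rewrite /mid.
have -> : ((2^-1)%:C)%C = 2^-1 :> C by rewrite fmorphV rmorph_nat.
by field.
Qed.

Lemma midsum_bound (D : C -> Prop) F n a b (B : R) : midconvex D -> D a -> D b ->
  (forall z, D z -> cm (F z) <= B) -> cm (midsum F n a b) <= B * cm (b - a).
Proof.
move=> cD + + FB; elim: n a b => [|n ih] a b Da Db /=.
  by rewrite cmM ler_wpM2r ?cm_ge0// FB//; exact: cD.
apply: le_trans (cmD _ _) _.
have Dm := cD _ _ Da Db.
apply: le_trans (lerD (ih _ _ Da Dm) (ih _ _ Dm Db)) _.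
rewrite mid_subl mid_subr cmM cm_real ger0_norm ?invr_ge0 ?ler0n//; lra.
Qed.

(** Serves the lower bound on [kappa]: along one edge all increments are nonnegative multiples of
    the same [L], so a pointwise bound on [Im (F z * L)] survives summation. *)
Lemma midsum_Im_ge (D : C -> Prop) F n a b k (L : C) (l : R) : midconvex D -> D a -> D b ->
  b - a = L * l%:C%C -> 0 <= l ->
  (forall z, D z -> k <= Im (F z * L)) -> k * l <= Im (midsum F n a b).
Proof.
move=> cD + + + + FB; elim: n a b l => [|n ih] a b l Da Db ba l0 /=.
  rewrite ba mulrA cImM /= mulr0 add0r ler_wpM2r// FB//; exact: cD.
have Dm := cD _ _ Da Db.
have l20 : 0 <= l / 2 by lra.
have Ll : L * (l / 2)%:C%C = (b - a) * (2^-1)%:C%C.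
  by rewrite ba -mulrA -rmorphM.
have := lerD (ih _ _ (l / 2) Da Dm _ l20) (ih _ _ (l / 2) Dm Db _ l20).
rewrite cImD Ll mid_subl mid_subr => /(_ erefl erefl); lra.
Qed.

Lemma midconvex_inSq c s : midconvex (inSq c s).
Proof.
by move=> a b [? ? ? ?] [? ? ? ?]; split; rewrite ?Re_mid ?Im_mid; lra.
Qed.

Definition sqsum F n c s : C :=
  midsum F n c (pt c s 0) + midsum F n (pt c s 0) (pt c s s) +
  midsum F n (pt c s s) (pt c 0 s) + midsum F n (pt c 0 s) c.

(** The outer sides are cut at their midpoints by the definition of [midsum], and each inner side is
    traversed twice in opposite directions. *)
Lemma sqsum_split F n c s : sqsum F n.+1 c s =
  sqsum F n c (s / 2) + sqsum F n (pt c (s / 2) 0) (s / 2) +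
  sqsum F n (pt c 0 (s / 2)) (s / 2) + sqsum F n (pt c (s / 2) (s / 2)) (s / 2).
Proof.
rewrite /sqsum /= !ptpt !(add0r, addr0).
have -> : mid c (pt c s 0) = pt c (s / 2) 0.
  by apply: complex_ext; rewrite !(Re_mid, Im_mid, Re_pt, Im_pt); lra.
have -> : mid (pt c s 0) (pt c s s) = pt c s (s / 2).
  by apply: complex_ext; rewrite !(Re_mid, Im_mid, Re_pt, Im_pt); lra.
have -> : mid (pt c s s) (pt c 0 s) = pt c (s / 2) s.
  by apply: complex_ext; rewrite !(Re_mid, Im_mid, Re_pt, Im_pt); lra.
have -> : mid (pt c 0 s) c = pt c 0 (s / 2).
  by apply: complex_ext; rewrite !(Re_mid, Im_mid, Re_pt, Im_pt); lra.
have -> : s / 2 + s / 2 = s by lra.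
rewrite (midsum_anti F n (pt c (s / 2) 0) (pt c (s / 2) (s / 2))).
rewrite (midsum_anti F n (pt c 0 (s / 2)) (pt c (s / 2) (s / 2))).
rewrite (midsum_anti F n (pt c s (s / 2)) (pt c (s / 2) (s / 2))).
rewrite (midsum_anti F n c (pt c 0 (s / 2))) (midsum_anti F n (pt c (s / 2) s) (pt c (s / 2) (s / 2))).
by ring.
Qed.

Lemma inSq_corners c s : 0 <= s ->
  [/\ inSq c s c, inSq c s (pt c s 0), inSq c s (pt c s s) & inSq c s (pt c 0 s)].
Proof. by move=> s0; split; split; rewrite ?(Re_pt, Im_pt); lra. Qed.

Lemma cm_pt c (a b a' b' : R) : cm (pt c a b - pt c a' b') <= `|a - a'| + `|b - b'|.
Proof.
apply: le_trans (cm_le _) _; rewrite !(Re_pt, Im_pt, cE) lerD//.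
  by rewrite (_ : _ - _ = a - a')//; ring.
by rewrite (_ : _ - _ = b - b')//; ring.
Qed.

Definition bdSq c s z := inSq c s z /\
  [\/ Re z = Re c, Re z = Re c + s, Im z = Im c | Im z = Im c + s].

Lemma sqsum_bound F n c s (B : R) : 0 <= s -> (forall z, bdSq c s z -> cm (F z) <= B) ->
  cm (sqsum F n c s) <= 4 * s * B.
Proof.
move=> s0 FB; have [h1 h2 h3 h4] := inSq_corners c s0.
have e : (`|0 - s| = s) * (`|s - s| = 0) * (`|s - 0| = s) * (`|0 - 0 : R| = 0).
  by rewrite !subrr sub0r subr0 normrN normr0 ger0_norm.
have B0 : 0 <= B.
  apply: le_trans (cm_ge0 _) (FB c _); split=> //; by constructor 1.
have key a b D : midconvex D -> D a -> D b -> (forall z, D z -> bdSq c s z) ->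
    cm (b - a) <= s -> cm (midsum F n a b) <= s * B.
  move=> cD Da Db DB ba; apply: le_trans (midsum_bound _ cD Da Db (fun z Dz => FB z (DB z Dz))) _.
  by rewrite mulrC ler_wpM2r.
have mr r : midconvex (fun z => inSq c s z /\ Re z = r).
  by move=> a b [Da <-] [Db e']; split; [exact: midconvex_inSq|rewrite Re_mid e'; lra].
have mi r : midconvex (fun z => inSq c s z /\ Im z = r).
  by move=> a b [Da <-] [Db e']; split; [exact: midconvex_inSq|rewrite Im_mid e'; lra].
have -> : 4 * s * B = s * B + s * B + s * B + s * B by ring.
rewrite /sqsum (le_trans (cmD _ _))// lerD//; last first.
  apply: (key _ _ _ (mr (Re c))); rewrite ?Re_pt ?addr0//.
    by move=> z [? ?]; split=> //; constructor 1.
  by rewrite -{1}(pt00 c) (le_trans (cm_pt _ _ _ _ _))// !e add0r.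
rewrite (le_trans (cmD _ _))// lerD//; last first.
  apply: (key _ _ _ (mi (Im c + s))); rewrite ?Im_pt//.
    by move=> z [? ?]; split=> //; constructor 4.
  by rewrite (le_trans (cm_pt _ _ _ _ _))// !e addr0.
rewrite (le_trans (cmD _ _))// lerD//.
  apply: (key _ _ _ (mi (Im c))); rewrite ?Im_pt ?addr0//.
    by move=> z [? ?]; split=> //; constructor 3.
  by rewrite -{2}(pt00 c) (le_trans (cm_pt _ _ _ _ _))// !e addr0.
apply: (key _ _ _ (mr (Re c + s))); rewrite ?Re_pt//.
  by move=> z [? ?]; split=> //; constructor 2.
by rewrite (le_trans (cm_pt _ _ _ _ _))// !e add0r.
Qed.

Lemma sqsumB F G n c s : sqsum (fun z => F z - G z) n c s = sqsum F n c s - sqsum G n c s.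
Proof. by rewrite /sqsum !midsumB; ring. Qed.
Lemma sqsumZ k F n c s : sqsum (fun z => k * F z) n c s = k * sqsum F n c s.
Proof. by rewrite /sqsum !midsumZ; ring. Qed.

(** Being exactly zero, not just small, affine integrands let Goursat's lemma subtract the tangent
    at a point. *)
Lemma sqsum_lin k l n c s : sqsum (fun z => k + l * z) n c s = 0.
Proof.
rewrite /sqsum !midsum_lin.
by apply: complex_ext; rewrite !(Re_mid, Im_mid, Re_pt, Im_pt, cE) /=; field.
Qed.

End Squares.

(** * Goursat's lemma *)

Section Goursat.
Variable R : realType.
Local Notation C := R[i].
Local Notation Re := complex.Re.
Local Notation Im := complex.Im.
Implicit Types (x y z w c : C) (s : R) (F G f g : C -> C).

Definition tend0 (u : nat -> C) :=
  forall e : R, 0 < e -> exists N, forall n, (N <= n)%N -> cm (u n) <= e.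

Lemma tend0D u v : tend0 u -> tend0 v -> tend0 (fun n => u n + v n).
Proof.
move=> hu hv e e0; have e2 : 0 < e / 2 by lra.
have [N hN] := hu _ e2; have [N' hN'] := hv _ e2; exists (maxn N N') => n.
rewrite geq_max => /andP[/hN a /hN' b]; have := cmD (u n) (v n); lra.
Qed.

Lemma tend0_ext u v : (forall n, u n = v n) -> tend0 u -> tend0 v.
Proof. by move=> uv hu e /hu[N hN]; exists N => n; rewrite -uv; exact: hN. Qed.

Lemma tend0Ml (k : nat -> C) (B : R) u : (forall n, cm (k n) <= B) -> tend0 u ->
  tend0 (fun n => k n * u n).
Proof.
move=> kB hu e e0; have B0 : 0 <= B := le_trans (cm_ge0 _) (kB 0).
have B1 : 0 < B + 1 by lra.
have [N hN] := hu _ (divr_gt0 e0 B1); exists N => n /hN h; rewrite cmM.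
apply: (@le_trans _ _ ((B + 1) * (e / (B + 1)))); last by rewrite mulrC divfK// gt_eqF.
by rewrite ler_pM ?cm_ge0//; have := kB n; lra.
Qed.

Lemma tend0N u : tend0 u -> tend0 (fun n => - u n).
Proof. by move=> hu e /hu[N hN]; exists N => n; rewrite cmN; exact: hN. Qed.

Lemma tend0_shift u k : tend0 u -> tend0 (fun n => u (n + k)%N).
Proof. by move=> hu e /hu[N hN]; exists N => n Nn; apply: hN; rewrite (leq_trans Nn)// leq_addr. Qed.

Lemma tend0_cst0 : tend0 (fun=> 0).
Proof. by move=> e e0; exists 0 => n _; rewrite cm0 ltW. Qed.

Lemma tend0_sum (I : Type) (r : seq I) (P : pred I) (u : I -> nat -> C) :
  (forall i, P i -> tend0 (u i)) -> tend0 (fun n => \sum_(i <- r | P i) u i n).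
Proof.
move=> h; elim: r => [|i r ih].
  by apply: tend0_ext tend0_cst0 => n; rewrite big_nil.
have [Pi|Pi] := boolP (P i).
  by apply: tend0_ext (tend0D (h i Pi) ih) => n; rewrite big_cons Pi.
by apply: tend0_ext ih => n; rewrite big_cons (negbTE Pi).
Qed.

(** Heaviside's function with value 1/2 at 0. Thus [tau] counts an endpoint of the interval by one
    half, which is exactly additive under bisection; a product of two such weights is the normalized
    solid angle of a point in a square: 1 inside, 1/2 on a side, 1/4 at a corner. *)
Definition step0 (x : R) : R := ((0 <= x)%R%:R + (0 < x)%R%:R) / 2.
Definition tau (a s x : R) := step0 (x - a) - step0 (x - a - s).

Lemma tau_ge0 (a s x : R) : 0 < s -> 0 <= tau a s x.
Proof.
move=> s0; rewrite /tau /step0.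
by case: (ltgtP 0 (x - a)); case: (ltgtP 0 (x - a - s)) => /= h1 h2; lra.
Qed.

Lemma tau_in (a s x : R) : 0 < s -> a <= x -> x <= a + s -> 1 / 2 <= tau a s x.
Proof.
move=> s0; rewrite /tau /step0 => ax xa.
by case: (ltgtP 0 (x - a)); case: (ltgtP 0 (x - a - s)) => /= h1 h2; lra.
Qed.

Lemma tau_split (a s x : R) : tau a s x = tau a (s / 2) x + tau (a + s / 2) (s / 2) x.
Proof.
rewrite /tau; have -> : x - (a + s / 2) = x - a - s / 2 by lra.
have -> : x - a - s / 2 - s / 2 = x - a - s by lra.
by ring.
Qed.

Lemma inSq_cm c s z w : inSq c s z -> inSq c s w -> cm (z - w) <= 2 * s.
Proof.
move=> [? ? ? ?] [? ? ? ?]; apply: le_trans (cm_le _) _; rewrite !cE.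
have : `|Re z - Re w| <= s by rewrite ler_norml; lra.
have : `|Im z - Im w| <= s by rewrite ler_norml; lra.
lra.
Qed.

Lemma bdSq_in c s z : bdSq c s z -> inSq c s z. Proof. by case. Qed.

(* Goursat's lemma with finitely many bounded singularities: the weight of a
   square is its area plus the solid angles of the singular points in it, which
   is exactly additive under bisection. *)
Lemma goursat F c s (B : R) (X : seq C) : 0 < s ->
  (forall z, inSq c s z -> cm (F z) <= B) ->
  (forall z, inSq c s z -> z \notin X -> cdiff F z) -> tend0 (fun n => sqsum F n c s).
Proof.
move=> s0 FB Fd.
have B0 : 0 <= B.
  by have [h _ _ _] := inSq_corners c (ltW s0); exact: le_trans (cm_ge0 _) (FB _ h).
pose ang c s := \sum_(x <- X) tau (Re c) s (Re x) * tau (Im c) s (Im x).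
have ang0 c' s' : 0 < s' -> 0 <= ang c' s'.
  by move=> s'0; apply: sumr_ge0 => x _; rewrite mulr_ge0// tau_ge0.
suff key : forall e : R, 0 < e -> exists N, forall n, (N <= n)%N ->
    cm (sqsum F n c s) <= e * (s ^+ 2 + ang c s).
  move=> e e0; have W0 : 0 < s ^+ 2 + ang c s.
    by rewrite ltr_pwDl ?ang0// exprn_gt0.
  have [N hN] := key _ (divr_gt0 e0 W0); exists N => n /hN.
  by rewrite divfK// gt_eqF.
move=> e e0.
apply: (@cousin _ (fun c s => exists N, forall n, (N <= n)%N ->
    cm (sqsum F n c s) <= e * (s ^+ 2 + ang c s))) => //.
  move=> {s0 FB Fd} c' s' _ [N1 h1] [N2 h2] [N3 h3] [N4 h4].
  exists (maxn (maxn N1 N2) (maxn N3 N4)).+1 => -[//|n].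
  rewrite ltnS !geq_max => /andP[/andP[/h1 b1 /h2 b2] /andP[/h3 b3 /h4 b4]].
  have eA : ang c' s' = ang c' (s' / 2) + ang (pt c' (s' / 2) 0) (s' / 2) +
     ang (pt c' 0 (s' / 2)) (s' / 2) + ang (pt c' (s' / 2) (s' / 2)) (s' / 2).
    rewrite /ang -!big_split/=; apply: eq_bigr => x _.
    by rewrite !(Re_pt, Im_pt, addr0) (tau_split _ s') (tau_split _ s'); ring.
  have -> : s' ^+ 2 = (s' / 2) ^+ 2 + (s' / 2) ^+ 2 + (s' / 2) ^+ 2 + (s' / 2) ^+ 2 by field.
  rewrite sqsum_split eA.
  move: (cmD (sqsum F n c' (s' / 2) + sqsum F n (pt c' (s' / 2) 0) (s' / 2) +
     sqsum F n (pt c' 0 (s' / 2)) (s' / 2)) (sqsum F n (pt c' (s' / 2) (s' / 2)) (s' / 2))).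
  move: (cmD (sqsum F n c' (s' / 2) + sqsum F n (pt c' (s' / 2) 0) (s' / 2))
     (sqsum F n (pt c' 0 (s' / 2)) (s' / 2))).
  move: (cmD (sqsum F n c' (s' / 2)) (sqsum F n (pt c' (s' / 2) 0) (s' / 2))).
  move: b1 b2 b3 b4.
  set q := (s' / 2) ^+ 2; set a1 := ang _ _; set a2 := ang _ _; set a3 := ang _ _.
  set a4 := ang _ _; rewrite !mulrDr; lra.
move=> x xin; have [xX|xX] := boolP (x \in X).
  (* A singular point weighs at least 1/4, the value at a corner, so the crude bound [4 * s' * B]
     has to stay below [e / 4]. *)
  have B1 : 0 < 16 * (B + 1) by lra.
  exists (e / (16 * (B + 1))); first by rewrite divr_gt0.
  move=> c' s' s'0 s'd [x1 x2 x3 x4] sub; exists 0 => n _.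
  have ang4 : 1 / 4 <= ang c' s'.
    rewrite /ang (big_rem x)//= -[_ / _]addr0 lerD//; last first.
      by apply: sumr_ge0 => y _; rewrite mulr_ge0// tau_ge0.
    by have := ler_pM _ _ (tau_in s'0 x1 x2) (tau_in s'0 x3 x4); lra.
  have : cm (sqsum F n c' s') <= 4 * s' * B.
    by apply: sqsum_bound; [exact: ltW|move=> z /bdSq_in/sub; exact: FB].
  move=> h; apply: (le_trans h).
  move: s'd; rewrite ltr_pdivlMr// => s'd.
  have : 4 * s' * B <= e * (1 / 4).
    have : 0 <= s' * (16 * (B + 1)) - 16 * (s' * B) by rewrite (_ : _ - _ = 16 * s'); [lra|ring].
    rewrite -mulrA; lra.
  move=> h2; apply: (le_trans h2); rewrite ler_pM2l//.
  by have := sqr_ge0 s'; lra.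
have [d Fx] := Fd x xin xX.
(* The tangent error [e / 8 * (2 * s')] over a perimeter [4 * s'] gives exactly [e * s' ^+ 2], the
   area part of the weight. *)
have [r r0 hr] := Fx (e / 8) (divr_gt0 e0 (ltr0n R 8)).
exists (r / 2); first by rewrite divr_gt0.
move=> c' s' s'0 s'r xin' sub; exists 0 => n _.
have -> : sqsum F n c' s' = sqsum (fun z => F z - ((F x - d * x) + d * z)) n c' s'.
  by rewrite (sqsumB F) sqsum_lin subr0.
apply: (@le_trans _ _ (4 * s' * (e / 8 * (2 * s')))); last first.
  rewrite (_ : _ * (_ * _) = e * s' ^+ 2); last by field.
  by rewrite ler_pM2l// lerDl ang0.
apply: sqsum_bound; first exact: ltW.
move=> z /bdSq_in zin; have zx := inSq_cm zin xin'.
have := hr (z - x); rewrite subrKC => /(_ _)/le_trans; have -> : F z - F x - d * (z - x) = F z - (F x - d * x + d * z) by ring.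
apply; first lra.
by rewrite ler_wpM2l//; lra.
Qed.

Definition inSqS c s z :=
  [/\ Re c < Re z, Re z < Re c + s, Im c < Im z & Im z < Im c + s].

Lemma inSqSW c s z : inSqS c s z -> inSq c s z.
Proof. by case=> ? ? ? ?; split; exact: ltW. Qed.

(* The discrete counterpart of [2 pi i]; only its bounds and the invariance of
   the winding sums ([sqsum_winding]) matter. *)
Definition kappa n : C := sqsum (fun z => z^-1) n ((- (1 / 2)) +i* (- (1 / 2)))%C 1.

Lemma Sq_locbounded F c s : 0 < s -> (forall w, inSq c s w -> exists2 r : R, 0 < r &
    exists B : R, forall v, cm (v - w) < r -> cm (F v) <= B) ->
  exists B : R, 0 < B /\ forall w, inSq c s w -> cm (F w) <= B.
Proof.
move=> s0 hF; apply: (@cousin _ (fun c s => exists B : R, 0 < B /\ forall w, inSq c s w -> cm (F w) <= B)) => //.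
  move=> c' s' s'0 [B1 [p1 h1]] [B2 [p2 h2]] [B3 [p3 h3]] [B4 [p4 h4]].
  exists (B1 + B2 + B3 + B4); split; first lra.
  move=> w [a1 a2 a3 a4].
  have [u|u] := leP (Re w) (Re c' + s' / 2); have [v|v] := leP (Im w) (Im c' + s' / 2).
  - by apply: (@le_trans _ _ B1); [apply: h1; split; rewrite ?(Re_pt, Im_pt)|]; lra.
  - by apply: (@le_trans _ _ B3); [apply: h3; split; rewrite ?(Re_pt, Im_pt)|]; lra.
  - by apply: (@le_trans _ _ B2); [apply: h2; split; rewrite ?(Re_pt, Im_pt)|]; lra.
  - by apply: (@le_trans _ _ B4); [apply: h4; split; rewrite ?(Re_pt, Im_pt)|]; lra.
move=> x /hF [r r0 [B h]]; exists (r / 2); first by rewrite divr_gt0.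
move=> c' s' s'0 s'r xin _; exists (`|B| + 1); split; first by have := normr_ge0 B; lra.
move=> w win; apply: (@le_trans _ _ B); last by have := ler_norm B; lra.
by apply: h; have := inSq_cm win xin; lra.
Qed.

Lemma Sq_bounded F c s : 0 < s -> (forall w, inSq c s w -> ccont F w) ->
  exists B : R, 0 < B /\ forall w, inSq c s w -> cm (F w) <= B.
Proof.
move=> s0 hF; apply: Sq_locbounded => // w /hF/ccont_bounded[r r0 h].
by exists r => //; exists (cm (F w) + 1).
Qed.

Section Winding.
Variables (z z' : C).
Let g w := (w - z)^-1 - (w - z')^-1.

Let g_diff w : w != z -> w != z' -> cdiff g w.
Proof.
move=> wz wz'; apply: cdiffB; apply: cdiffV.
- by apply: cdiffB; [exact: cdiff_id|exact: cdiff_cst].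
- by rewrite subr_eq0.
- by apply: cdiffB; [exact: cdiff_id|exact: cdiff_cst].
- by rewrite subr_eq0.
Qed.

Let goursat_g c s : 0 < s -> ~ inSq c s z -> ~ inSq c s z' -> tend0 (fun n => sqsum g n c s).
Proof.
move=> s0 hz hz'.
have gd w : inSq c s w -> cdiff g w.
  by move=> win; apply: g_diff; apply/eqP => e; [apply: hz|apply: hz']; rewrite -e.
have [B [_ hB]] := Sq_bounded s0 (fun w win => cdiff_cont (gd w win)).
by apply: (@goursat g c s B [::]) => // w /gd.
Qed.

(** Two bisections of the square of side [4 * s] isolate the given one. The six other pieces, three
    of side [2 * s] and three of side [s], miss both points, so Goursat's lemma disposes of them. *)
Let double c s : 0 < s -> inSqS c s z -> inSqS c s z' ->
  tend0 (fun n => sqsum g n c s - sqsum g n.+2 (pt c (- (2 * s)) (- (2 * s))) (4 * s)).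
Proof.
move=> s0 [a1 a2 a3 a4] [b1 b2 b3 b4].
have s20 : 0 < 2 * s by lra.
have e1 : 2 * s / 2 = s by lra.
have e2 : 4 * s / 2 = 2 * s by lra.
have e0 n : sqsum g n.+2 (pt c (- (2 * s)) (- (2 * s))) (4 * s) = sqsum g n c s +
   (sqsum g n (pt c s 0) s + sqsum g n (pt c 0 s) s + sqsum g n (pt c s s) s) +
   (sqsum g n.+1 (pt c (- (2 * s)) (- (2 * s))) (2 * s) +
    sqsum g n.+1 (pt c 0 (- (2 * s))) (2 * s) + sqsum g n.+1 (pt c (- (2 * s)) 0) (2 * s)).
  rewrite sqsum_split !ptpt e2 !(addr0, addNr) pt00 [sqsum g n.+1 c _]sqsum_split e1.
  by ring.
have t c' s' : 0 < s' -> ~ inSq c' s' z -> ~ inSq c' s' z' -> tend0 (fun n => - sqsum g n c' s').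
  by move=> *; apply: tend0N; exact: goursat_g.
have T1 : tend0 (fun n => - sqsum g n (pt c s 0) s).
  by apply: t => //; case; rewrite !(Re_pt, Im_pt); lra.
have T2 : tend0 (fun n => - sqsum g n (pt c 0 s) s).
  by apply: t => //; case; rewrite !(Re_pt, Im_pt); lra.
have T3 : tend0 (fun n => - sqsum g n (pt c s s) s).
  by apply: t => //; case; rewrite !(Re_pt, Im_pt); lra.
have T4 : tend0 (fun n => - sqsum g n (pt c (- (2 * s)) (- (2 * s))) (2 * s)).
  by apply: t => //; case; rewrite !(Re_pt, Im_pt); lra.
have T5 : tend0 (fun n => - sqsum g n (pt c 0 (- (2 * s))) (2 * s)).
  by apply: t => //; case; rewrite !(Re_pt, Im_pt); lra.
have T6 : tend0 (fun n => - sqsum g n (pt c (- (2 * s)) 0) (2 * s)).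
  by apply: t => //; case; rewrite !(Re_pt, Im_pt); lra.
apply: tend0_ext (tend0D (tend0D T1 (tend0D T2 T3))
  (tend0D (tend0_shift 1 T4) (tend0D (tend0_shift 1 T5) (tend0_shift 1 T6)))) => n.
by rewrite e0 addn1; ring.
Qed.

Let iterated c s k : 0 < s -> inSqS c s z -> inSqS c s z' -> exists c',
  [/\ inSqS c' (4 ^+ k.+1 * s) z, inSqS c' (4 ^+ k.+1 * s) z',
    tend0 (fun n => sqsum g n c s - sqsum g (n + 2 * k.+1)%N c' (4 ^+ k.+1 * s)) &
    forall w, bdSq c' (4 ^+ k.+1 * s) w ->
      4 ^+ k * s <= cm (w - z) /\ 4 ^+ k * s <= cm (w - z')].
Proof.
move=> s0 zin z'in.
have step t c1 : 0 < t -> inSqS c1 t z -> inSqS c1 t z' ->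
   let c2 := pt c1 (- (2 * t)) (- (2 * t)) in
   [/\ inSqS c2 (4 * t) z, inSqS c2 (4 * t) z' & forall w, bdSq c2 (4 * t) w ->
      t <= cm (w - z) /\ t <= cm (w - z')].
  move=> t0 [a1 a2 a3 a4] [b1 b2 b3 b4] c2; split.
  - by split; rewrite !(Re_pt, Im_pt); lra.
  - by split; rewrite !(Re_pt, Im_pt); lra.
  move=> w [_]; rewrite !(Re_pt, Im_pt) => bd.
  have key u : Re c1 < Re u -> Re u < Re c1 + t -> Im c1 < Im u -> Im u < Im c1 + t -> t <= cm (w - u).
    move=> u1 u2 u3 u4; case: bd => bd.
    - apply: le_trans (cm_Re _); rewrite !cE; rewrite ler_normr; apply/orP; right; lra.
    - apply: le_trans (cm_Re _); rewrite !cE; rewrite ler_normr; apply/orP; left; lra.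
    - apply: le_trans (cm_Im _); rewrite !cE; rewrite ler_normr; apply/orP; right; lra.
    - apply: le_trans (cm_Im _); rewrite !cE; rewrite ler_normr; apply/orP; left; lra.
  by split; apply: key.
elim: k => [|k [c' [i1 i2 i3 _]]].
  rewrite expr1 expr0 mul1r muln1; have [j1 j2 j3] := step s c s0 zin z'in.
  exists (pt c (- (2 * s)) (- (2 * s))); split=> //.
  by apply: tend0_ext (double s0 zin z'in) => n; rewrite addn2.
have t0 : 0 < 4 ^+ k.+1 * s by rewrite mulr_gt0// exprn_gt0.
have [j1 j2 j3] := step _ c' t0 i1 i2.
have -> : 4 ^+ k.+2 * s = 4 * (4 ^+ k.+1 * s) by rewrite (exprS _ k.+1) mulrA.
have dbl := double t0 i1 i2.
exists (pt c' (- (2 * (4 ^+ k.+1 * s))) (- (2 * (4 ^+ k.+1 * s)))); split=> //.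
apply: tend0_ext (tend0D i3 (tend0_shift (2 * k.+1) dbl)) => n /=.
by rewrite addrA subrK; congr (_ - sqsum g _ _ _); lia.
Qed.

(** The square can be enlarged without changing the limit, while [g] decays quadratically: on a
    square of side [4 * T] the sum is at most [16 * cm (z - z') / T]. *)
Lemma sqsum_winding_indep c s : 0 < s -> inSqS c s z -> inSqS c s z' ->
  tend0 (fun n => sqsum g n c s).
Proof.
move=> s0 zin z'in e e0.
have [k hk] := half_small (16 * cm (z - z') / s) (divr_gt0 e0 (ltr0n R 2)).
have [c' [_ _ h bd]] := iterated k s0 zin z'in.
have [N hN] := h _ (divr_gt0 e0 (ltr0n R 2)); exists N => n /hN {hN} h1.
set T := 4 ^+ k * s in bd.
have T0 : 0 < T by rewrite mulr_gt0// exprn_gt0.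
have eT : 4 ^+ k.+1 * s = 4 * T by rewrite exprS mulrA.
rewrite eT in h1 bd.
have h2 : cm (sqsum g (n + 2 * k.+1) c' (4 * T)) <= 4 * (4 * T) * (cm (z - z') / T / T).
  apply: sqsum_bound; first by rewrite mulr_ge0// ltW.
  move=> w /bd[wz wz'].
  have w0 : w - z != 0 by rewrite -cm_gt0; lra.
  have w0' : w - z' != 0 by rewrite -cm_gt0; lra.
  have -> : g w = (z - z') / (w - z) / (w - z') by rewrite /g; field; rewrite w0 w0'.
  rewrite !cmf ler_pM ?invr_ge0 ?cm_ge0 ?divr_ge0 ?cm_ge0//.
    by rewrite ler_wpM2l ?cm_ge0// lef_pV2 ?posrE ?cm_gt0.
  by rewrite lef_pV2 ?posrE ?cm_gt0.
have h3 : 4 * (4 * T) * (cm (z - z') / T / T) <= e / 2.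
  apply: le_trans (ltW hk).
  have -> : 4 * (4 * T) * (cm (z - z') / T / T) = 16 * cm (z - z') / T.
    by field; rewrite gt_eqF.
  rewrite -!mulrA ler_pM2l// ler_wpM2l ?cm_ge0//.
  rewrite -invfM lef_pV2 ?posrE ?mulr_gt0 ?exprn_gt0// /T mulrC ler_pM2r//.
  by apply: lerXn2r; rewrite ?nnegrE//; lra.
have := cm_tri (sqsum g n c s) (sqsum g (n + 2 * k.+1) c' (4 * T)) 0.
have := cmD (sqsum g n c s - sqsum g (n + 2 * k.+1) c' (4 * T)) (sqsum g (n + 2 * k.+1) c' (4 * T)).
rewrite subrK; lra.
Qed.

End Winding.

Lemma midsum_affine_inv (l z : C) n a b : l != 0 ->
  midsum (fun w => (w - z)^-1) n (l * a + z) (l * b + z) = midsum (fun w => w^-1) n a b.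
Proof.
move=> l0; have em a' b' : mid (l * a' + z) (l * b' + z) = l * mid a' b' + z.
  rewrite /mid; have -> : ((2^-1)%:C)%C = 2^-1 :> C by rewrite fmorphV rmorph_nat.
  by field.
elim: n a b => [|n ih] a b /=; last by rewrite em !ih.
rewrite em addrK invfM; have -> : l * b + z - (l * a + z) = l * (b - a) by ring.
by rewrite mulrACA mulVf// mul1r.
Qed.

(** For the centre of the square, scaling and translation reproduce [kappa n] exactly;
    [sqsum_winding_indep] then moves the centre to [z]. *)
Lemma sqsum_winding c s z : 0 < s -> inSqS c s z ->
  tend0 (fun n => sqsum (fun w => (w - z)^-1) n c s - kappa n).
Proof.
move=> s0 zin; pose z0 := pt c (s / 2) (s / 2).
have z0in : inSqS c s z0 by split; rewrite ?(Re_pt, Im_pt); lra.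
apply: tend0_ext (sqsum_winding_indep s0 zin z0in) => n; rewrite sqsumB; congr (_ - _).
have l0 : s%:C%C != 0 :> C by rewrite -cm_gt0 cm_real gtr0_norm.
rewrite /kappa /sqsum -!(midsum_affine_inv z0 _ _ _ l0).
do 4 (congr (_ + _) || idtac).
all: congr (midsum _ _ _ _); apply: complex_ext; rewrite !(cE, Re_pt, Im_pt) /=; lra.
Qed.

Lemma kappa_le n : cm (kappa n) <= 8.
Proof.
have -> : (8 : R) = 4 * 1 * 2 by ring.
apply: sqsum_bound => // z [_] bd; rewrite cmV -[leRHS]invrK lef_pV2 ?posrE ?invr_gt0//; last first.
  rewrite cm_gt0; apply/eqP => z0; move: bd; rewrite z0 /=; case; lra.
by case: bd => /= bd; [apply: le_trans (cm_Re _)|apply: le_trans (cm_Re _)|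
  apply: le_trans (cm_Im _)|apply: le_trans (cm_Im _)]; rewrite bd ler_normr; apply/orP;
  [right|left|right|left]; lra.
Qed.

(** Each of the four sides contributes at least 1 to the imaginary part: there the tangential
    component of the kernel is [1 / 2 / (x ^+ 2 + 1 / 4)], with [x] between -1/2 and 1/2. *)
Lemma kappa_ge n : 4 <= cm (kappa n).
Proof.
suff : 4 <= Im (kappa n).
  by move=> h; apply: le_trans (cm_Im _); apply: le_trans h (ler_norm _).
rewrite /kappa /sqsum; set c := ((_ : R) +i* _)%C.
have e1 : pt c 1 0 = ((1 / 2) +i* (- (1 / 2)))%C by apply: complex_ext; rewrite !(Re_pt, Im_pt) /=; lra.
have e2 : pt c 1 1 = ((1 / 2) +i* ((1 / 2)))%C by apply: complex_ext; rewrite !(Re_pt, Im_pt) /=; lra.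
have e3 : pt c 0 1 = ((- (1 / 2)) +i* ((1 / 2)))%C by apply: complex_ext; rewrite !(Re_pt, Im_pt) /=; lra.
rewrite e1 e2 e3 /c !cImD {e1 e2 e3}.
have D1 r : midconvex (fun w => - (1 / 2) <= Re w <= 1 / 2 /\ Im w = r).
  by move=> a b [/andP[? ?] ?] [/andP[? ?] ?]; rewrite Re_mid Im_mid; split; [apply/andP; split|]; lra.
have D2 r : midconvex (fun w => - (1 / 2) <= Im w <= 1 / 2 /\ Re w = r).
  by move=> a b [/andP[? ?] ?] [/andP[? ?] ?]; rewrite Re_mid Im_mid; split; [apply/andP; split|]; lra.
have q (x : R) : - (1 / 2) <= x -> x <= 1 / 2 -> 0 < x ^+ 2 + (1 / 2) ^+ 2 <= 1 / 2.
  move=> h1 h2; have x2 := sqr_ge0 x.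
  have : 0 <= (x + 1 / 2) * (1 / 2 - x) by rewrite mulr_ge0; lra.
  by move=> h3; apply/andP; split; lra.
have q' (x y : R) : - (1 / 2) <= x -> x <= 1 / 2 -> y ^+ 2 = (1 / 2) ^+ 2 ->
    1 <= 1 / 2 / (x ^+ 2 + y ^+ 2).
  by move=> h1 h2 ->; have /andP[p1 p2] := q x h1 h2; rewrite ler_pdivlMr//; lra.
have edge (D : C -> Prop) (L a b : C) : midconvex D -> D a -> D b -> b - a = L ->
    (forall z, D z -> 1 <= Im (z^-1 * L)) -> 1 <= Im (midsum (fun z => z^-1) n a b).
  move=> cD Da Db ba h; rewrite -[leLHS]mulr1.
  by apply: (@midsum_Im_ge _ D _ n a b 1 L 1) => //; rewrite ba mulr1.
have hh : - (1 / 2) <= 1 / 2 :> R by lra.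
have hh' : 1 / 2 - - (1 / 2) = 1 :> R by lra.
have k1 : 1 <= Im (midsum (fun z => z^-1) n ((- (1 / 2)) +i* (- (1 / 2)))%C ((1 / 2) +i* (- (1 / 2)))%C).
  apply: (edge _ 1 _ _ (D1 (- (1 / 2)))) => /=.
  - by rewrite hh lexx.
  - by rewrite hh lexx.
  - by apply: complex_ext => /=; clear; lra.
  move=> [x y] /= [/andP[x1 x2] ->]; rewrite mulr1 /=.
  have := q' x (- (1 / 2)) x1 x2; rewrite sqrrN => /(_ erefl); rewrite mulNr; clear; lra.
have k2 : 1 <= Im (midsum (fun z => z^-1) n ((1 / 2) +i* (- (1 / 2)))%C ((1 / 2) +i* ((1 / 2)))%C).
  apply: (edge _ 'i%C _ _ (D2 (1 / 2))) => /=.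
  - by rewrite hh lexx.
  - by rewrite hh lexx.
  - by apply: complex_ext => /=; clear; lra.
  move=> [x y] /= [/andP[x1 x2] ->].
  have := q' y (1 / 2) x1 x2 erefl; rewrite [_ + (1/2) ^+2]addrC; clear; lra.
have k3 : 1 <= Im (midsum (fun z => z^-1) n ((1 / 2) +i* ((1 / 2)))%C ((- (1 / 2)) +i* ((1 / 2)))%C).
  apply: (edge _ (-1) _ _ (D1 (1 / 2))) => /=.
  - by rewrite hh lexx.
  - by rewrite hh lexx.
  - by apply: complex_ext => /=; clear; lra.
  move=> [x y] /= [/andP[x1 x2] ->].
  have := q' x (1 / 2) x1 x2 erefl; clear; lra.
have k4 : 1 <= Im (midsum (fun z => z^-1) n ((- (1 / 2)) +i* ((1 / 2)))%C ((- (1 / 2)) +i* (- (1 / 2)))%C).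
  apply: (edge _ (- 'i%C) _ _ (D2 (- (1 / 2)))) => /=.
  - by rewrite hh lexx.
  - by rewrite hh lexx.
  - by apply: complex_ext => /=; clear; lra.
  move=> [x y] /= [/andP[x1 x2] ->].
  have := q' y (- (1 / 2)) x1 x2; rewrite sqrrN [_ + (1/2) ^+2]addrC => /(_ erefl); rewrite mulNr; clear; lra.
by move: k1 k2 k3 k4; clear; lra.
Qed.

End Goursat.

(** * Cauchy's formula *)

Section Local.
Variable R : realType.
Local Notation C := R[i].
Local Notation Re := complex.Re.
Local Notation Im := complex.Im.
Implicit Types (x y z w c : C) (s d : R) (F G f g : C -> C).

(** Without a limit, every point would have small squares around it that the sequence eventually
    leaves; by Cousin's lemma it would leave the whole square around [u N]. *)
Lemma ccauchy_cvg (u : nat -> C) :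
  (forall e : R, 0 < e -> exists N, forall n m, (N <= n)%N -> (N <= m)%N -> cm (u n - u m) <= e) ->
  exists l, ccvg u l.
Proof.
move=> hu; apply: contrapT => nl.
have [N hN] := hu 1 ltr01.
pose c0 := pt (u N) (-1) (-1).
suff [n hn] : exists N', forall n, (N' <= n)%N -> ~ inSq c0 2 (u n).
  apply: (hn (maxn n N)); first exact: leq_maxl.
  have h := hN (maxn n N) N (leq_maxr _ _) (leqnn _).
  have := cm_Re (u (maxn n N) - u N); have := cm_Im (u (maxn n N) - u N).
  rewrite !ler_norml !cE => /andP[h1 h2] /andP[h3 h4].
  by split; rewrite !(Re_pt, Im_pt); lra.
apply: (@cousin _ (fun c s => exists N', forall n, (N' <= n)%N -> ~ inSq c s (u n))) => //.
  move=> c s s0 [N1 h1] [N2 h2] [N3 h3] [N4 h4].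
  exists (maxn (maxn N1 N2) (maxn N3 N4)) => n.
  rewrite !geq_max => /andP[/andP[/h1 b1 /h2 b2] /andP[/h3 b3 /h4 b4]] [a1 a2 a3 a4].
  have [p|p] := leP (Re (u n)) (Re c + s / 2); have [q|q] := leP (Im (u n)) (Im c + s / 2).
  - by apply: b1; split => //; lra.
  - by apply: b3; split; rewrite !(Re_pt, Im_pt); lra.
  - by apply: b2; split; rewrite !(Re_pt, Im_pt); lra.
  - by apply: b4; split; rewrite !(Re_pt, Im_pt); lra.
move=> x _; have /existsNP[e /not_implyP[e0 ex]] : ~ ccvg u x by move=> h; apply: nl; exists x.
have [N' hN'] := hu (e / 2) (divr_gt0 e0 (ltr0n R 2)).
exists (e / 4); first by rewrite divr_gt0.
move=> c s s0 se xin _; exists N' => n Nn uin.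
apply: ex; exists N' => m Nm.
have := inSq_cm uin xin; have := cm_tri (u n) (u m) x; have := hN' m n Nm Nn; lra.
Qed.

(** Cauchy's formula with [kappa] in the place of [2 pi i]. As a property of [f] it passes to
    uniform limits ([CFon_lim]) and implies differentiability ([CFon_cdiff]). *)
Definition CFon f c s := forall z, inSqS c s z ->
  tend0 (fun n => sqsum (fun w => f w / (w - z)) n c s - f z * kappa R n).

(** What Cauchy's formula requires at the point itself. It is available for the quotient [Bop w f]
    at [w] before differentiability there is known. *)
Definition loclip f z := exists2 r : R, 0 < r & exists L : R,
  forall w, cm (w - z) < r -> cm (f w - f z) <= L * cm (w - z).

Lemma cdiff_loclip f z : cdiff f z -> loclip f z.
Proof.
move=> [d fd]; have [r r0 hr] := fd 1 ltr01; exists r => //; exists (1 + cm d) => w wr.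
have := hr _ wr; rewrite subrKC => h.
have -> : f w - f z = (f w - f z - d * (w - z)) + d * (w - z) by rewrite subrK.
by rewrite (le_trans (cmD _ _))// cmM mulrDl lerD2r.
Qed.

Lemma loclip_ccont f z : loclip f z -> ccont f z.
Proof.
move=> [r r0 [L hL]] e e0.
have L1 : 0 < `|L| + 1 by rewrite ltr_wpDl.
exists (Num.min r (e / (`|L| + 1))); first by rewrite lt_min r0 divr_gt0.
move=> w; rewrite lt_min => /andP[/hL h]; rewrite ltr_pdivlMr// => h2.
have : L * cm (w - z) <= cm (w - z) * (`|L| + 1).
  by rewrite mulrC ler_wpM2l ?cm_ge0//; have := ler_norm L; lra.
lra.
Qed.

(** The Lipschitz condition bounds [(f w - f z) / (w - z)], so Goursat's lemma applies with [z]
    added to the singular points; the remaining term is a winding sum. *)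
Lemma cauchy_formula f c s (X : seq C) z : 0 < s -> inSqS c s z ->
  (forall w, inSq c s w -> ccont f w) ->
  (forall w, inSq c s w -> w \notin X -> cdiff f w) -> loclip f z ->
  tend0 (fun n => sqsum (fun w => f w / (w - z)) n c s - f z * kappa R n).
Proof.
move=> s0 zin fc fd [r r0 [L hL]].
have [B [B0 hB]] := Sq_bounded s0 fc.
pose F w := f w / (w - z) - f z * (w - z)^-1.
have Fz w : F w = (f w - f z) / (w - z) by rewrite /F mulrBl.
have FB w : inSq c s w -> cm (F w) <= `|L| + 2 * B / r.
  move=> win; rewrite Fz cmf; have [wr|wr] := ltP (cm (w - z)) r.
    rewrite -[leLHS]addr0 lerD//; last by rewrite divr_ge0 ?ltW//; lra.
    have [->|wz] := eqVneq w z; first by rewrite !subrr cm0 mul0r.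
    rewrite ler_pdivrMr ?cm_gt0 ?subr_eq0//; apply: le_trans (hL _ wr) _.
    by rewrite ler_wpM2r ?cm_ge0// ler_norm.
  rewrite -[leLHS]add0r lerD//.
  have h2 := hB _ (inSqSW zin); have h1 := hB _ win.
  apply: ler_pM; rewrite ?invr_ge0 ?cm_ge0//.
    by rewrite (le_trans (cmB _ _))//; lra.
  by rewrite lef_pV2 ?posrE//; lra.
have T1 : tend0 (fun n => sqsum F n c s).
  apply: (@goursat _ F c s (`|L| + 2 * B / r) (z :: X)) => // w win.
  rewrite inE negb_or => /andP[wz wX]; apply: cdiffB.
    apply: cdiffM; first exact: fd.
    by apply: cdiffV; [apply: cdiffB; [exact: cdiff_id|exact: cdiff_cst]|rewrite subr_eq0].
  apply: cdiffM; first exact: cdiff_cst.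
  by apply: cdiffV; [apply: cdiffB; [exact: cdiff_id|exact: cdiff_cst]|rewrite subr_eq0].
have T2 := tend0Ml (fun=> lexx (cm (f z))) (sqsum_winding s0 zin).
apply: tend0_ext (tend0D T1 T2) => n.
by rewrite /F sqsumB sqsumZ; ring.
Qed.

Lemma hol_CFon f c s : 0 < s -> (forall w, inSq c s w -> cdiff f w) -> CFon f c s.
Proof.
move=> s0 fd z zin; apply: (@cauchy_formula _ _ _ [::]) => //.
- by move=> w /fd/cdiff_cont.
- by move=> w /fd.
- by apply: cdiff_loclip; apply: fd; exact: inSqSW.
Qed.

Lemma CFon_lim (fk : nat -> C -> C) f c s : 0 < s -> (forall k, CFon (fk k) c s) ->
  (forall e : R, 0 < e -> exists k, forall w, inSq c s w -> cm (fk k w - f w) <= e) ->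
  CFon f c s.
Proof.
move=> s0 hk lim z zin e e0.
have [d d0 hd] : exists2 d : R, 0 < d & forall w, bdSq c s w -> d <= cm (w - z).
  case: zin => a1 a2 a3 a4.
  exists (Num.min (Num.min (Re z - Re c) (Re c + s - Re z)) (Num.min (Im z - Im c) (Im c + s - Im z))).
    by rewrite !lt_min; apply/andP; split; apply/andP; split; lra.
  move=> w [_ [] bd]; rewrite !ge_min.
  - by apply/orP; left; apply/orP; left; apply: le_trans (cm_Re _); rewrite !cE ler_normr; apply/orP; right; lra.
  - by apply/orP; left; apply/orP; right; apply: le_trans (cm_Re _); rewrite !cE ler_normr; apply/orP; left; lra.
  - by apply/orP; right; apply/orP; left; apply: le_trans (cm_Im _); rewrite !cE ler_normr; apply/orP; right; lra.
  - by apply/orP; right; apply/orP; right; apply: le_trans (cm_Im _); rewrite !cE ler_normr; apply/orP; left; lra.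
(* Chosen against [cm (kappa R n) <= 8] and against the boundary sum [4 * s * (e1 / d)], so that
   each of these errors is at most [e / 3]. *)
pose e1 := Num.min (e / 24) (e * d / (12 * s)).
have e10 : 0 < e1 by rewrite lt_min !divr_gt0// !mulr_gt0.
have [k hk'] := lim e1 e10.
have [N hN] := hk k z zin (e / 3) (divr_gt0 e0 (ltr0n R 3)); exists N => n /hN h.
have -> : sqsum (fun w => f w / (w - z)) n c s - f z * kappa R n =
   (sqsum (fun w => fk k w / (w - z)) n c s - fk k z * kappa R n) +
   (fk k z - f z) * kappa R n - sqsum (fun w => (fk k w - f w) / (w - z)) n c s.
  have -> : sqsum (fun w => (fk k w - f w) / (w - z)) n c s =
     sqsum (fun w => fk k w / (w - z)) n c s - sqsum (fun w => f w / (w - z)) n c s.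
    rewrite -sqsumB /sqsum; congr (_ + _ + _ + _); apply: (@midsum_ext _ (fun=> True)) => // w _; exact: mulrBl.
  by ring.
have h2 : cm ((fk k z - f z) * kappa R n) <= e / 3.
  apply: le_trans (@ler_cmM _ _ _ (e / 24) 8 _ (kappa_le R n)) _; last lra.
  by apply: le_trans (hk' z (inSqSW zin)) _; rewrite ge_min lexx.
have h3 : cm (sqsum (fun w => (fk k w - f w) / (w - z)) n c s) <= e / 3.
  apply: (@le_trans _ _ (4 * s * (e * d / (12 * s) / d))).
    apply: sqsum_bound; first exact: ltW.
    move=> w bw; rewrite cmf ler_pM ?invr_ge0 ?cm_ge0//.
      by apply: le_trans (hk' w (bdSq_in bw)) _; rewrite ge_min lexx orbT.
    by have := hd _ bw; move=> h'; rewrite lef_pV2 ?posrE//; lra.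
  rewrite le_eqVlt; apply/orP; left; apply/eqP; field.
  by rewrite !gt_eqF.
apply: le_trans (cmB _ _) _; have := cmD (sqsum (fun w => fk k w / (w - z)) n c s - fk k z * kappa R n) ((fk k z - f z) * kappa R n); lra.
Qed.

Definition marg c s d z := forall w, bdSq c s w -> d <= cm (w - z).

(** The perimeter [4 * s] is set against [4 <= cm (kappa R n)], which leaves the factor [s]. *)
Lemma CF_bound f c s (B d : R) z : 0 < s -> CFon f c s -> (forall w, bdSq c s w -> cm (f w) <= B) ->
  0 < d -> inSqS c s z -> marg c s d z -> cm (f z) <= s * B / d.
Proof.
move=> s0 cf fB d0 zin zd.
apply/ler_addgt0Pl => e e0.
have [N hN] := cf z zin e e0.
have h1 := hN N (leqnn _).
have h2 : cm (sqsum (fun w => f w / (w - z)) N c s) <= 4 * s * (B / d).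
  apply: sqsum_bound; first exact: ltW.
  move=> w bw; rewrite cmf ler_pM ?invr_ge0 ?cm_ge0//; first exact: fB.
  by have := zd _ bw; move=> h'; rewrite lef_pV2 ?posrE//; lra.
have h3 : 4 * cm (f z) <= cm (f z * kappa R N).
  by rewrite cmM mulrC ler_wpM2l ?cm_ge0// kappa_ge.
have := cm_rev (f z * kappa R N) (sqsum (fun w => f w / (w - z)) N c s).
rewrite cmC; move: h1 h2 h3; rewrite (_ : 4 * s * (B / d) = 4 * (s * B / d)); last by ring.
lra.
Qed.

(** Up to the factor [kappa R n], Cauchy's expression for the derivative at [z0]. *)
Let G f c s z0 n := sqsum (fun w => f w / (w - z0) ^+ 2) n c s.

(** The kernel [1 / (w - z) - 1 / (w - z0) - (z - z0) / (w - z0) ^+ 2] equals [(z - z0) ^+ 2 / ((w -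
    z) * (w - z0) ^+ 2)], which is at most [cm (z - z0) ^+ 2 / d ^+ 3] on the boundary. *)
Let quad_n f c s (B d : R) z z0 : 0 < s -> CFon f c s ->
  (forall w, bdSq c s w -> cm (f w) <= B) ->
  0 < d -> inSqS c s z -> marg c s d z -> inSqS c s z0 -> marg c s d z0 ->
  forall e : R, 0 < e -> exists N, forall n, (N <= n)%N ->
   cm (kappa R n * (f z - f z0) - (z - z0) * G f c s z0 n) <=
     4 * (s * B / d ^+ 3 * cm (z - z0) ^+ 2) + e.
Proof.
move=> s0 cf fB d0 zin zd z0in z0d e e0.
have e2 : 0 < e / 2 by lra.
have [N hN] := cf z zin _ e2; have [N' hN'] := cf z0 z0in _ e2.
exists (maxn N N') => n; rewrite geq_max => /andP[/hN h1 /hN' h2].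
pose F w := f w / (w - z) - f w / (w - z0) - (z - z0) * (f w / (w - z0) ^+ 2).
have eF : kappa R n * (f z - f z0) - (z - z0) * G f c s z0 n = sqsum F n c s -
  (sqsum (fun w => f w / (w - z)) n c s - f z * kappa R n) + (sqsum (fun w => f w / (w - z0)) n c s - f z0 * kappa R n).
  by rewrite /G /F sqsumB sqsumB sqsumZ; ring.
have h3 : cm (sqsum F n c s) <= 4 * s * (B / d ^+ 3 * cm (z - z0) ^+ 2).
  apply: sqsum_bound; first exact: ltW.
  move=> w bw.
  have a1 := zd _ bw; have a2 := z0d _ bw.
  have w0 : w - z != 0 by rewrite -cm_gt0; lra.
  have w1 : w - z0 != 0 by rewrite -cm_gt0; lra.
  have -> : F w = f w * ((w - z)^-1 * (w - z0)^-1 ^+ 2) * (z - z0) ^+ 2.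
    by rewrite /F; field; rewrite w0 w1.
  rewrite [cm (_ * _ ^+ 2)]cmM [cm (f w * _)]cmM [cm (_^-1 * _)]cmM !cmX !cmV.
  rewrite ler_wpM2r ?exprn_ge0 ?cm_ge0// ler_pM ?fB ?mulr_ge0 ?exprn_ge0 ?invr_ge0 ?cm_ge0//.
  have -> : (d ^+ 3)^-1 = d^-1 * d^-1 ^+ 2 by rewrite -exprS exprVn.
  rewrite ler_pM ?exprn_ge0 ?invr_ge0 ?cm_ge0//.
    by rewrite lef_pV2 ?posrE//; lra.
  apply: lerXn2r; rewrite ?nnegrE ?invr_ge0 ?cm_ge0 ?(ltW d0)//.
  by rewrite lef_pV2 ?posrE//; lra.
rewrite eF; apply: le_trans (cmD _ _) _.
have := cmB (sqsum F n c s) (sqsum (fun w => f w / (w - z)) n c s - f z * kappa R n).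
have -> : 4 * (s * B / d ^+ 3 * cm (z - z0) ^+ 2) = 4 * s * (B / d ^+ 3 * cm (z - z0) ^+ 2) by ring.
lra.
Qed.

Lemma inSqS_marg c s z : inSqS c s z -> exists2 d : R, 0 < d & forall z', cm (z' - z) < d ->
  inSqS c s z' /\ marg c s d z'.
Proof.
case=> a1 a2 a3 a4.
pose m := Num.min (Num.min (Re z - Re c) (Re c + s - Re z)) (Num.min (Im z - Im c) (Im c + s - Im z)).
have m0 : 0 < m by rewrite !lt_min; apply/andP; split; apply/andP; split; lra.
exists (m / 2); first by rewrite divr_gt0.
move=> z' zz.
have [m1 m2 m3 m4] : [/\ m <= Re z - Re c, m <= Re c + s - Re z, m <= Im z - Im c & m <= Im c + s - Im z].
  by split; rewrite !ge_min lexx ?orbT.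
have := le_lt_trans (cm_Re _) zz; have := le_lt_trans (cm_Im _) zz.
rewrite !ltr_norml !cE => /andP[p1 p2] /andP[p3 p4].
split; first by split; lra.
move=> w [_ [] bd].
- by apply: le_trans (cm_Re _); rewrite !cE ler_normr; apply/orP; right; lra.
- by apply: le_trans (cm_Re _); rewrite !cE ler_normr; apply/orP; left; lra.
- by apply: le_trans (cm_Im _); rewrite !cE ler_normr; apply/orP; right; lra.
- by apply: le_trans (cm_Im _); rewrite !cE ler_normr; apply/orP; left; lra.
Qed.

Lemma kappa_neq0 n : kappa R n != 0.
Proof. by rewrite -cm_gt0; apply: lt_le_trans (kappa_ge R n). Qed.

Let quad_n' f c s (B d : R) z z0 : 0 < s -> CFon f c s ->
  (forall w, bdSq c s w -> cm (f w) <= B) ->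
  0 < d -> inSqS c s z -> marg c s d z -> inSqS c s z0 -> marg c s d z0 ->
  forall e : R, 0 < e -> exists N, forall n, (N <= n)%N ->
   cm (f z - f z0 - (z - z0) * (G f c s z0 n / kappa R n)) <=
     s * B / d ^+ 3 * cm (z - z0) ^+ 2 + e.
Proof.
move=> s0 cf fB d0 zin zd z0in z0d e e0.
have e4 : 0 < 4 * e by lra.
have [N hN] := quad_n s0 cf fB d0 zin zd z0in z0d e4; exists N => n /hN h.
have k0 : 0 < cm (kappa R n) by apply: lt_le_trans (kappa_ge R n).
have -> : f z - f z0 - (z - z0) * (G f c s z0 n / kappa R n) =
   (kappa R n * (f z - f z0) - (z - z0) * G f c s z0 n) / kappa R n.
  by field; exact: kappa_neq0.
rewrite cmf ler_pdivrMr//; apply: (le_trans h).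
rewrite -mulrDr mulrC; apply: ler_wpM2l; last exact: kappa_ge.
apply: addr_ge0; last exact: ltW.
rewrite mulr_ge0 ?exprn_ge0 ?cm_ge0//.
have B0 : 0 <= B.
  apply: le_trans (cm_ge0 (f c)) (fB c _); have [q _ _ _] := inSq_corners c (ltW s0).
  by split=> //; constructor 1.
apply: divr_ge0; first by rewrite mulr_ge0 ?(ltW s0).
by rewrite exprn_ge0 ?(ltW d0).
Qed.

(** The discrete slopes [u n] converge to [g], as one small real increment [h] shows; then [quad_n']
    passes to the limit. The constant depends on [z0] only through the margin [d]. *)
Lemma quadratic_estimate f c s (B d : R) z0 (g : C) : 0 < s -> CFon f c s ->
  (forall w, bdSq c s w -> cm (f w) <= B) ->
  0 < d -> inSqS c s z0 -> marg c s d z0 -> cderiv f z0 g ->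
  forall z, inSqS c s z -> marg c s d z ->
    cm (f z - f z0 - g * (z - z0)) <= s * B / d ^+ 3 * cm (z - z0) ^+ 2.
Proof.
move=> s0 cf fB d0 z0in z0d fg z zin zd.
set K := s * B / d ^+ 3.
pose u n := G f c s z0 n / kappa R n.
have ug : ccvg u g.
  move=> e e0; have [r1 r10 hr1] := fg (e / 4) (divr_gt0 e0 (ltr0n R 4)).
  have [r2 r20 hr2] := inSqS_marg z0in.
  have [d' d'0 hd'] : exists2 d' : R, 0 < d' & d' <= d /\ d' <= r2.
    by exists (Num.min d r2); rewrite ?lt_min ?d0//; split; rewrite ge_min lexx ?orbT.
  pose K' := `|s * B / d' ^+ 3| + 1.
  have K'0 : 0 < K' by rewrite ltr_wpDl.
  pose h := Num.min (Num.min r1 r2) (e / (4 * K')) / 2.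
  have m0 : 0 < Num.min (Num.min r1 r2) (e / (4 * K')).
    by rewrite !lt_min r10 r20 divr_gt0// mulr_gt0.
  have h0 : 0 < h by rewrite /h divr_gt0.
  have hlt : h < Num.min (Num.min r1 r2) (e / (4 * K')) by rewrite /h; lra.
  move: hlt; rewrite !lt_min => /andP[/andP[hr1' hr2']]; rewrite ltr_pdivlMr ?mulr_gt0// => hK.
  have ch : cm (h%:C)%C = h by rewrite cm_real gtr0_norm.
  have [|zhin zhd] := hr2 (z0 + (h%:C)%C); first by rewrite addrC addKr ch.
  have z0d' : marg c s d' z0 by move=> w /z0d; apply: le_trans; case: hd'.
  have zhd' : marg c s d' (z0 + (h%:C)%C).
    by move=> w /zhd; apply: le_trans; case: hd'.
  have eh : 0 < h * e / 4 by rewrite divr_gt0// mulr_gt0.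
  have [N hN] := quad_n' s0 cf fB d'0 zhin zhd' z0in z0d' eh.
  exists N => n /hN; rewrite -/(u n); have := hr1 (h%:C)%C; rewrite ch => /(_ hr1').
  set a := f (z0 + _); rewrite (addrC z0) addrK ch => h1 h2.
  have h3 : cm ((u n - g) * (h%:C)%C) <= e * h.
    have -> : (u n - g) * (h%:C)%C = (a - f z0 - g * (h%:C)%C) - (a - f z0 - (h%:C)%C * u n) by ring.
    apply: le_trans (cmB _ _) _.
    have h4 : s * B / d' ^+ 3 * h ^+ 2 <= e * h / 4.
      have : s * B / d' ^+ 3 * h ^+ 2 <= K' * h ^+ 2.
        by rewrite ler_wpM2r ?sqr_ge0// /K'; have := ler_norm (s * B / d' ^+ 3); lra.
      have : h * (h * (4 * K')) <= h * e by rewrite ler_pM2l// ltW.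
      rewrite (_ : h * (h * (4 * K')) = 4 * (K' * h ^+ 2)); last by ring.
      lra.
    lra.
  by move: h3; rewrite cmM ch ler_pM2r.
apply/ler_addgt0Pl => e e0.
have e2 : 0 < e / 2 by lra.
have [N hN] := quad_n' s0 cf fB d0 zin zd z0in z0d e2.
have c1 : 0 < cm (z - z0) + 1 by have := cm_ge0 (z - z0); lra.
have [N' hN'] := ug _ (divr_gt0 e2 c1).
have h1 := hN _ (leq_maxl N N'); have h2 := hN' _ (leq_maxr N N').
set n := maxn N N' in h1 h2; rewrite -/(u n) in h1.
have -> : f z - f z0 - g * (z - z0) = (f z - f z0 - (z - z0) * u n) + (u n - g) * (z - z0) by ring.
apply: le_trans (cmD _ _) _.
have : cm ((u n - g) * (z - z0)) <= e / 2.
  rewrite cmM; apply: (@le_trans _ _ (e / 2 / (cm (z - z0) + 1) * (cm (z - z0) + 1))).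
    by rewrite ler_pM ?cm_ge0// lerDl.
  by rewrite divfK// gt_eqF.
rewrite -/K in h1; lra.
Qed.

(** For a fixed small [h] all late slopes [u n] are close to the same difference quotient. They
    therefore form a Cauchy sequence, and its limit is the derivative. *)
Lemma CFon_cdiff f c s (B : R) z0 : 0 < s -> CFon f c s ->
  (forall w, bdSq c s w -> cm (f w) <= B) -> inSqS c s z0 -> cdiff f z0.
Proof.
move=> s0 cf fB z0in.
have [d d0 hd] := inSqS_marg z0in.
have [|_ z0d] := hd z0; first by rewrite subrr cm0.
pose K := `|s * B / d ^+ 3| + 1.
have K0 : 0 < K by rewrite ltr_wpDl.
pose u n := G f c s z0 n / kappa R n.
have key (h : C) (e : R) : 0 < e -> cm h < d -> exists N, forall n, (N <= n)%N ->
    cm (f (z0 + h) - f z0 - h * u n) <= K * cm h ^+ 2 + e.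
  move=> e0 hh; have [|zin zd] := hd (z0 + h); first by rewrite addrC addKr.
  have [N hN] := quad_n' s0 cf fB d0 zin zd z0in z0d e0; exists N => n /hN.
  rewrite -/(u n) (addrC z0) addrK => h1; apply: (le_trans h1).
  rewrite lerD2r ler_wpM2r ?exprn_ge0 ?cm_ge0// /K; have := ler_norm (s * B / d ^+ 3); lra.
have [g ug] : exists g : C, ccvg u g.
  apply: ccauchy_cvg => e e0.
  pose h := Num.min d (e / (4 * K)) / 2.
  have m0 : 0 < Num.min d (e / (4 * K)) by rewrite lt_min d0 divr_gt0// mulr_gt0.
  have h0 : 0 < h by rewrite /h divr_gt0.
  have : h < Num.min d (e / (4 * K)) by rewrite /h; lra.
  rewrite lt_min => /andP[hd1]; rewrite ltr_pdivlMr ?mulr_gt0// => hK.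
  have ch : cm (h%:C)%C = h by rewrite cm_real gtr0_norm.
  have hd2 : cm (h%:C)%C < d by rewrite ch.
  have e4 : 0 < h * e / 4 by rewrite divr_gt0// mulr_gt0.
  have [N hN] := key (h%:C)%C _ e4 hd2.
  exists N => n m Nn Nm; move: (hN m Nm) (hN n Nn); rewrite ch.
  set a := f _ - f _ => h1 h2.
  have : cm ((u n - u m) * (h%:C)%C) <= e * h.
    have -> : (u n - u m) * (h%:C)%C = (a - (h%:C)%C * u m) - (a - (h%:C)%C * u n) by ring.
    apply: le_trans (cmB _ _) _.
    have : h * (h * (4 * K)) <= h * e by rewrite ler_pM2l// ltW.
    by rewrite (_ : h * (h * (4 * K)) = 4 * (K * h ^+ 2)); [lra|ring].
  by rewrite cmM ch ler_pM2r.
exists g => e e0.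
exists (Num.min d (e / (2 * K))); first by rewrite lt_min d0 divr_gt0// mulr_gt0.
move=> h; rewrite lt_min ltr_pdivlMr ?mulr_gt0// => /andP[hd1 hK].
have [->|hn0] := eqVneq h 0; first by rewrite addr0 mulr0 !subrr cm0 mulr0.
have ch0 : 0 < cm h by rewrite cm_gt0.
have e4 : 0 < e / 4 by lra.
have [N hN] := key h (cm h * (e / 4)) (mulr_gt0 ch0 e4) hd1.
have [N' hN'] := ug _ e4.
have h1 := hN _ (leq_maxl N N'); have h2 := hN' _ (leq_maxr N N').
set n := maxn N N' in h1 h2.
have -> : f (z0 + h) - f z0 - g * h = (f (z0 + h) - f z0 - h * u n) + (u n - g) * h by ring.
apply: le_trans (cmD _ _) _; rewrite cmM.
have : cm (u n - g) * cm h <= e / 4 * cm h by rewrite ler_pM2r.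
have : cm h * (cm h * (2 * K)) <= cm h * e by rewrite ler_pM2l// ltW.
rewrite (_ : cm h * (cm h * (2 * K)) = 2 * (K * cm h ^+ 2)); last by ring.
lra.
Qed.

End Local.

(** * Holomorphic functions *)

Section Holomorphic.
Variable R : realType.
Local Notation C := R[i].
Local Notation Re := complex.Re.
Local Notation Im := complex.Im.
Implicit Types (x y z w c : C) (U : C -> Prop) (F G f g : C -> C).

Definition hol_on U f := forall z, U z -> cdiff f z.

Lemma csq_center x (r : R) : 0 < r -> inSqS (pt x (- r) (- r)) (2 * r) x.
Proof. by move=> r0; split; rewrite !(Re_pt, Im_pt); lra. Qed.

Lemma csq_cm x (r : R) z : 0 < r -> inSq (pt x (- r) (- r)) (2 * r) z -> cm (z - x) <= 4 * r.
Proof.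
move=> r0 zin; have := inSq_cm zin (inSqSW (csq_center x r0)); lra.
Qed.

Lemma csq_marg x (r : R) w : 0 < r -> bdSq (pt x (- r) (- r)) (2 * r) w -> r <= cm (w - x).
Proof.
move=> r0 [_]; rewrite !(Re_pt, Im_pt); case=> bd.
- by apply: le_trans (cm_Re _); rewrite !cE ler_normr; apply/orP; right; lra.
- by apply: le_trans (cm_Re _); rewrite !cE ler_normr; apply/orP; left; lra.
- by apply: le_trans (cm_Im _); rewrite !cE ler_normr; apply/orP; right; lra.
- by apply: le_trans (cm_Im _); rewrite !cE ler_normr; apply/orP; left; lra.
Qed.

Lemma csq_strict x (r : R) z : 0 < r -> cm (z - x) < r -> inSqS (pt x (- r) (- r)) (2 * r) z.
Proof.
move=> r0 zr; have := le_lt_trans (cm_Re _) zr; have := le_lt_trans (cm_Im _) zr.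
rewrite !ltr_norml !cE => /andP[? ?] /andP[? ?].
by split; rewrite !(Re_pt, Im_pt); lra.
Qed.

(** Weierstrass's theorem: on a small square Cauchy's formula survives the uniform limit, and it
    gives differentiability back. *)
Lemma hol_lim U (fk : nat -> C -> C) f : copen U -> (forall k, hol_on U (fk k)) ->
  (forall x, U x -> exists2 d : R, 0 < d & forall e : R, 0 < e -> exists k, forall y,
     cm (y - x) < d -> cm (fk k y - f y) <= e) -> hol_on U f.
Proof.
move=> oU hk lim x Ux; have [r r0 hr] := oU x Ux; have [d d0 hd] := lim x Ux.
pose t := Num.min r d / 8.
have m0 : 0 < Num.min r d by rewrite lt_min r0.
have t0 : 0 < t by rewrite /t; lra.
have m1 : Num.min r d <= r by rewrite ge_min lexx.
have m2 : Num.min r d <= d by rewrite ge_min lexx orbT.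
have sq z : inSq (pt x (- t) (- t)) (2 * t) z -> cm (z - x) < r /\ cm (z - x) < d.
  by move=> /(csq_cm t0); rewrite /t; split; lra.
have t20 : 0 < 2 * t by lra.
have cf : CFon f (pt x (- t) (- t)) (2 * t).
  apply: (@CFon_lim _ fk) => //.
    by move=> k; apply: hol_CFon => // w /sq[/hr Uw _]; exact: hk.
  by move=> e /hd[k hke]; exists k => w /sq[_]; exact: hke.
have [k hke] := hd 1 ltr01.
have [B [B0 hB]] := Sq_bounded t20 (fun w win => cdiff_cont (hk k w (hr w (sq w win).1))).
apply: (@CFon_cdiff _ f (pt x (- t) (- t)) (2 * t) (B + 1)) => //; last exact: csq_center.
move=> w /bdSq_in win; have h1 := hB w win; have h2 := hke w (sq w win).2.
have := cm_rev (f w) (fk k w); rewrite cmC; lra.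
Qed.

Definition dv f z : C := xget 0 [set d | cderiv f z d]%classic.

Lemma dvP f z : cdiff f z -> cderiv f z (dv f z).
Proof. exact: (@xgetPex _ _ [set d | cderiv f z d]%classic). Qed.

Lemma dvE f z d : cderiv f z d -> dv f z = d.
Proof. by move=> fd; apply: (@cderiv_unique _ f z) => //; apply: dvP; exists d. Qed.

(** The remainder has one constant [K] for all base points [y] near [x]; in this form the regularity
    of [f] is used for derivatives, difference quotients and Runge's kernel. *)
Lemma local_quad U f x : copen U -> hol_on U f -> U x ->
  exists2 r : R, 0 < r & exists2 K : R, 0 < K & forall y z, cm (y - x) < r -> cm (z - x) < r ->
    U y /\ cm (f z - f y - dv f y * (z - y)) <= K * cm (z - y) ^+ 2.
Proof.
move=> oU hf Ux; have [d d0 hd] := oU x Ux.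
pose t := d / 8; have t0 : 0 < t by rewrite /t; lra.
have t20 : 0 < 2 * t by lra.
have sq z : inSq (pt x (- t) (- t)) (2 * t) z -> U z.
  by move=> /(csq_cm t0) h; apply: hd; rewrite /t in h; lra.
have cf : CFon f (pt x (- t) (- t)) (2 * t) by apply: hol_CFon => // w /sq; exact: hf.
have [B [B0 hB]] := Sq_bounded t20 (fun w win => cdiff_cont (hf w (sq w win))).
have [r r0 hr] := inSqS_marg (csq_center x t0).
exists r => //; exists (2 * t * B / r ^+ 3); first by apply: divr_gt0; [exact: mulr_gt0|exact: exprn_gt0].
move=> y z yr zr; have [yin yd] := hr y yr; have [zin zd] := hr z zr.
have Uy : U y by apply: sq; exact: inSqSW.
split=> //; apply: quadratic_estimate zd => //; last by apply: dvP; exact: hf.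
by move=> w /bdSq_in; exact: hB.
Qed.

Lemma cdiff_shift f z h : cdiff f (z + h) -> cdiff (fun w => f (w + h)) z.
Proof.
move=> [d fd]; exists d => e /fd[r r0 hr]; exists r => // k /hr.
by rewrite (addrAC z h k).
Qed.

(** By the uniform bound of [local_quad], difference quotients with increments [h k] converge
    locally uniformly, and [hol_lim] applies. *)
Lemma dv_hol U f : copen U -> hol_on U f -> hol_on U (dv f).
Proof.
move=> oU hf x Ux.
have [r r0 [K K0 hK]] := local_quad oU hf Ux.
pose t := r / 2; have t0 : 0 < t by rewrite /t; lra.
pose h (k : nat) : C := ((t / k.+1%:R)%:C)%C.
have ch k : cm (h k) = t / k.+1%:R.
  by rewrite /h cm_real gtr0_norm// divr_gt0.
have cht k : cm (h k) <= t.
  by rewrite ch ler_pdivrMr// ler_peMr ?(ltW t0)// ler1n.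
have h0 k : h k != 0 by rewrite -cm_gt0 ch divr_gt0.
apply: (@hol_lim (fun z => cm (z - x) < t) (fun k z => (f (z + h k) - f z) / h k)).
- move=> z zt; exists (t - cm (z - x)); first by lra.
  by move=> y yz; have := cm_tri z y x; lra.
- move=> k z zt; apply: cdiffM; last exact: cdiff_cst.
  have zr : cm (z - x) < r by rewrite /t in zt; lra.
  apply: cdiffB.
    apply: cdiff_shift; apply: hf; suff /(hK _ x) : cm (z + h k - x) < r.
      by case; rewrite ?subrr ?cm0.
    by rewrite addrAC (le_lt_trans (cmD _ _))//; have := cht k; rewrite /t in zt *; lra.
  by apply: hf; have [] := hK z z zr zr.
- move=> y yt; exists (t - cm (y - x)); first by lra.
  move=> e e0; have [N hN] := archi_nat (K * t / e); exists N => z zy.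
  have zt : cm (z - x) < t by have := cm_tri y z x; lra.
  have [||_ q] := hK z (z + h N).
  + by rewrite /t in zt; lra.
  + by rewrite addrAC (le_lt_trans (cmD _ _))//; have := cht N; rewrite /t in zt *; lra.
  move: q; rewrite (addrC z) addrK (addrC _ z) => q.
  have -> : (f (z + h N) - f z) / h N - dv f z = (f (z + h N) - f z - dv f z * h N) / h N.
    by rewrite [RHS]mulrBl mulfK// h0.
  rewrite cmf ler_pdivrMr ?cm_gt0//; apply: (le_trans q).
  rewrite expr2 mulrA ler_wpM2r ?cm_ge0// ch mulrA ler_pdivrMr// ?(mulrC e).
  have /ltW := hN _ (leqnSn N); by rewrite ler_pdivrMr// (mulrC e) (mulrC K).
- by rewrite /= subrr cm0.
Qed.

(** If the derivative vanished on a disc, [f] would satisfy a quadratic bound on increments; each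
    halving of the segment gains a factor 2 in it, so [f] would be constant there. Having such
    points near every [x] is enough for Runge's theorem. *)
Lemma injective_dv_neq0 U f x (d : R) : copen U -> hol_on U f ->
  (forall y z, U y -> U z -> f y = f z -> y = z) -> U x -> 0 < d ->
  exists y, [/\ U y, cm (y - x) < d & dv f y <> 0].
Proof.
move=> oU hf inj Ux d0; apply: contrapT => no.
have [r r0 [K K0 hK]] := local_quad oU hf Ux.
pose t := Num.min r d; have t0 : 0 < t by rewrite lt_min r0.
have tr : t <= r by rewrite ge_min lexx.
have td : t <= d by rewrite ge_min lexx orbT.
clearbody t.
have key k a b : cm (a - x) < t -> cm (b - x) < t -> cm (f a - f b) <= K * cm (a - b) ^+ 2 / 2 ^+ k.
  elim: k a b => [|k ih] a b at' bt.
    rewrite expr0 divr1; have [||Ub] := hK b a; [lra|lra|].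
    suff -> : dv f b = 0 by rewrite mul0r subr0.
    apply: contrapT => db; apply: no; exists b; split=> //; lra.
  have mt : cm (mid a b - x) < t.
    have -> : mid a b - x = ((a - x) + (b - x)) * (2^-1)%:C%C.
      by apply: complex_ext; rewrite !(Re_mid, Im_mid, cE) /=; lra.
    rewrite cmM cm_real ger0_norm ?invr_ge0//; have := cmD (a - x) (b - x); lra.
  have e1 : cm (a - mid a b) = cm (a - b) / 2.
    by rewrite cmC mid_subl cmM cm_real ger0_norm ?invr_ge0// cmC.
  have e2 : cm (mid a b - b) = cm (a - b) / 2.
    by rewrite cmC mid_subr cmM cm_real ger0_norm ?invr_ge0// cmC.
  have := ih a (mid a b) at' mt; have := ih (mid a b) b mt bt; rewrite e1 e2 => h1 h2.
  apply: le_trans (cm_tri (f (mid a b)) _ _) _; apply: le_trans (lerD h2 h1) _.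
  rewrite (exprS _ k) invfM; set q := (2 ^+ k)^-1; set u := cm (a - b).
  by rewrite le_eqVlt; apply/orP; left; apply/eqP; field.
pose y := x + ((t / 2)%:C)%C.
have ct : cm (((t / 2)%:C)%C : C) = t / 2 by rewrite cm_real gtr0_norm// divr_gt0.
have yt : cm (y - x) < t by rewrite /y addrC addKr ct; lra.
have xt : cm (x - x) < t by rewrite subrr cm0.
have Uy : U y by have [||//] := hK y y; lra.
suff : y = x by move/eqP; rewrite -subr_eq0 -cm_eq0 /y addrC addKr ct gt_eqF//; lra.
apply: inj => //; apply/eqP; rewrite -subr_eq0; apply/eqP/eq_cm0 => e e0.
have [k hk] := half_small (K * cm (y - x) ^+ 2) e0.
by apply: le_trans (key k y x yt xt) _; exact: ltW.
Qed.

(** The backward shift on Taylor series at [w]: it drops the constant term and divides by [z - w],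
    so that iterates evaluated at [w] are Taylor coefficients. *)
Definition Bop w f z : C := if z == w then dv f w else (f z - f w) / (z - w).

Lemma BopE w f z : f z = f w + (z - w) * Bop w f z.
Proof.
rewrite /Bop; have [->|zw] := eqVneq z w; first by rewrite subrr mul0r addr0.
by rewrite mulrC divfK ?subr_eq0// subrKC.
Qed.

(** A removable singularity: the quotient is Lipschitz at [w] by [local_quad], which suffices for
    Cauchy's formula with [w] as exceptional point, and the formula yields the derivative at [w]. *)
Lemma Bop_hol U f w : copen U -> hol_on U f -> U w -> hol_on U (Bop w f).
Proof.
move=> oU hf Uw z Uz.
have off y : U y -> y != w -> cdiff (Bop w f) y.
  move=> Uy yw; have c0 : 0 < cm (y - w) by rewrite cm_gt0 subr_eq0.
  apply: (@cdiff_near _ (fun z => (f z - f w) / (z - w)) _ _ (cm (y - w))) => //.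
    move=> v vy; rewrite /Bop; case: eqP => // vw.
    by move: vy; rewrite vw cmC ltxx.
  apply: cdiffM; first by apply: cdiffB; [exact: hf|exact: cdiff_cst].
  by apply: cdiffV; [apply: cdiffB; [exact: cdiff_id|exact: cdiff_cst]|rewrite subr_eq0].
have [->{z Uz}|zw] := eqVneq z w; last exact: off.
have [r r0 [K K0 hK]] := local_quad oU hf Uw.
have lw : loclip (Bop w f) w.
  exists r => //; exists K => y yr; rewrite /Bop eqxx.
  have [->|yw] := eqVneq y w; first by rewrite !subrr cm0 mulr0.
  have ww : cm (w - w) < r by rewrite subrr cm0.
  have [_] := hK w y ww yr.
  have -> : (f y - f w) / (y - w) - dv f w = (f y - f w - dv f w * (y - w)) / (y - w).
    by field; rewrite subr_eq0.
  rewrite cmf ler_pdivrMr ?cm_gt0 ?subr_eq0// => h; apply: (le_trans h).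
  by rewrite expr2 mulrA.
have [d d0 hd] := oU w Uw.
pose t := d / 8; have t0 : 0 < t by rewrite /t; lra.
have t20 : 0 < 2 * t by lra.
have sq z : inSq (pt w (- t) (- t)) (2 * t) z -> U z.
  by move=> /(csq_cm t0) h; apply: hd; rewrite /t in h; lra.
have ll y : U y -> loclip (Bop w f) y.
  by move=> Uy; have [->//|yw] := eqVneq y w; apply: cdiff_loclip; exact: off.
have cont y : inSq (pt w (- t) (- t)) (2 * t) y -> ccont (Bop w f) y.
  by move=> /sq/ll; exact: loclip_ccont.
have cf : CFon (Bop w f) (pt w (- t) (- t)) (2 * t).
  move=> z zin; apply: (@cauchy_formula _ _ _ _ [:: w]) => //.
    by move=> y /sq Uy; rewrite inE; exact: off.
  by apply: ll; apply: sq; exact: inSqSW.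
have [B [B0 hB]] := Sq_bounded t20 cont.
apply: (@CFon_cdiff _ (Bop w f) _ _ B _ t20 cf); last exact: csq_center.
by move=> y /bdSq_in; exact: hB.
Qed.

Definition iterB w f i := iter i (Bop w) f.
Definition tcoef w f i := iterB w f i w.

Lemma iterB_hol U f w i : copen U -> hol_on U f -> U w -> hol_on U (iterB w f i).
Proof. by move=> oU hf Uw; elim: i => //= i ih; exact: Bop_hol. Qed.

(** Each shift costs a factor [3 / r] on the boundary: the value at [w] is at most twice the
    boundary bound, by [CF_bound] with side [2 * r] and margin [r], and the denominator is at least
    [r]. *)
Lemma iterB_bound U f w (r B : R) i : copen U -> hol_on U f -> U w -> 0 < r ->
  (forall z, inSq (pt w (- r) (- r)) (2 * r) z -> U z) ->
  (forall z, bdSq (pt w (- r) (- r)) (2 * r) z -> cm (f z) <= B) ->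
  (forall z, bdSq (pt w (- r) (- r)) (2 * r) z -> cm (iterB w f i z) <= B * (3 / r) ^+ i) /\
  (forall z (d : R), 0 < d -> cm (z - w) <= r - d -> cm (iterB w f i z) <= 2 * r * (B * (3 / r) ^+ i) / d).
Proof.
move=> oU hf Uw r0 sq fB.
have r20 : 0 < 2 * r by lra.
have loc g (M : R) : hol_on U g -> (forall z, bdSq (pt w (- r) (- r)) (2 * r) z -> cm (g z) <= M) ->
    forall z (d : R), 0 < d -> cm (z - w) <= r - d -> cm (g z) <= 2 * r * M / d.
  move=> hg gM z d d0 zd.
  apply: (CF_bound r20 _ gM d0).
  - by apply: hol_CFon => // y /sq; exact: hg.
  - by apply: csq_strict => //; lra.
  - by move=> y /(csq_marg r0) h; have := cm_tri z y w; lra.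
elim: i => [|i [ih1 ih2]].
  by rewrite expr0 mulr1; split=> //; exact: loc.
have hi := iterB_hol i oU hf Uw.
suff h1 : forall z, bdSq (pt w (- r) (- r)) (2 * r) z -> cm (iterB w f i.+1 z) <= B * (3 / r) ^+ i.+1.
  by split=> //; apply: loc => //; exact: iterB_hol.
move=> z bz; have zr := csq_marg r0 bz.
have zw : z != w by rewrite -subr_eq0 -cm_gt0; lra.
rewrite /iterB /= -/(iterB w f i) /Bop (negbTE zw) cmf.
have := ih2 w r r0; rewrite !subrr cm0 => /(_ (lexx _)) h2.
rewrite (_ : 2 * r * (B * (3 / r) ^+ i) / r = 2 * (B * (3 / r) ^+ i)) in h2; last first.
  by field; rewrite gt_eqF.
have h1 := ih1 z bz; have h3 := cmB (iterB w f i z) (iterB w f i w).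
set M := B * (3 / r) ^+ i in h1 h2 *.
have -> : B * (3 / r) ^+ i.+1 = M * 3 / r by rewrite exprSr /M; ring.
rewrite ler_pM ?cm_ge0 ?invr_ge0 ?cm_ge0//; first by lra.
by rewrite lef_pV2 ?posrE//; lra.
Qed.

Lemma tcoef_expand f w i z : (forall j, tcoef w f j = 0) -> f z = (z - w) ^+ i * iterB w f i z.
Proof.
move=> h; elim: i => [|i ih]; first by rewrite expr0 mul1r.
rewrite ih (BopE w (iterB w f i) z) -/(tcoef w f i) h add0r exprSr -mulrA//.
Qed.

(** The radius [r / 6] beats the growth [3 / r] of the shifts: [r / 6 * (3 / r)] is 1/2, so [f z] is
    bounded by [4 * B / 2 ^+ i] for every [i]. *)
Lemma tcoef_eq0 U f w (r : R) : copen U -> hol_on U f -> U w -> 0 < r ->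
  (forall z, inSq (pt w (- r) (- r)) (2 * r) z -> U z) ->
  (forall j, tcoef w f j = 0) -> forall z, cm (z - w) < r / 6 -> f z = 0.
Proof.
move=> oU hf Uw r0 sq tc z zr.
have r20 : 0 < 2 * r by lra.
have [B [B0 hB]] := Sq_bounded r20 (fun w win => cdiff_cont (hf w (sq w win))).
apply: eq_cm0 => e e0.
have [i hi] := half_small (4 * B) e0.
apply: le_trans (ltW hi).
have [_ /(_ z (r / 2))] := iterB_bound i oU hf Uw r0 sq (fun z bz => hB z (bdSq_in bz)).
move=> /(_ _ _)/le_trans h.
rewrite (tcoef_expand i z tc) cmM cmX.
apply: (@le_trans _ _ ((r / 6) ^+ i * (2 * r * (B * (3 / r) ^+ i) / (r / 2)))).
  rewrite ler_pM ?exprn_ge0 ?cm_ge0//.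
    by apply: lerXn2r; rewrite ?nnegrE ?cm_ge0 ?ltW// divr_gt0.
  by apply: h; lra.
have -> : 2 * r * (B * (3 / r) ^+ i) / (r / 2) = 4 * B * (3 / r) ^+ i.
  by field; rewrite gt_eqF.
rewrite mulrCA -exprMn (_ : r / 6 * (3 / r) = 2^-1); last by field; rewrite gt_eqF.
by rewrite exprVn.
Qed.

Definition cconnected U := forall A : C -> Prop, (forall z, A z -> U z) -> (exists z, A z) ->
  copen A -> copen (fun z => U z /\ ~ A z) -> forall z, U z -> A z.

(** The points around which [f] vanishes form an open set. It is relatively closed because vanishing
    near [w'] kills all coefficients at [w'], hence [f] on a disc whose radius depends only on the
    room inside [U]. *)
Lemma identity_theorem U f w : copen U -> cconnected U -> hol_on U f -> U w ->
  (forall j, tcoef w f j = 0) -> forall z, U z -> f z = 0.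
Proof.
move=> oU cU hf Uw tc.
pose A z := U z /\ exists2 d : R, 0 < d & forall y, cm (y - z) < d -> f y = 0.
(* A square of half-side [d / 16] around [w'] stays in the disc, and [tcoef_eq0] gives vanishing
   within [d / 96] of [w']; this exceeds [d / 200 + d / 200]. *)
have near x (d : R) w' : 0 < d -> (forall y, cm (y - x) < d -> U y) -> cm (w' - x) < d / 200 ->
    (forall j, tcoef w' f j = 0) -> A x.
  move=> d0 hd wx tc'; split; first by apply: hd; rewrite subrr cm0.
  exists (d / 200); first by rewrite divr_gt0.
  move=> y yx; apply: (@tcoef_eq0 U f w' (d / 16)) => //.
  - by apply: hd; lra.
  - by rewrite divr_gt0.
  - by move=> z /csq_cm h; apply: hd; have := cm_tri w' z x; have := h (divr_gt0 d0 (ltr0n R 16)); lra.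
  - by have := cm_tri x y w'; rewrite (cmC x w'); lra.
suff key z : U z -> A z by move=> z /key[_ [d d0]]; apply; rewrite subrr cm0.
apply: cU => {z}.
- by move=> z [].
- exists w; have [d d0 hd] := oU w Uw; apply: (near w d w) => //.
  by rewrite subrr cm0 divr_gt0.
- move=> z [Uz [d d0 hd]]; have [d' d'0 hd'] := oU z Uz.
  exists (Num.min d d' / 2); first by rewrite divr_gt0// lt_min d0.
  have m1 : Num.min d d' <= d by rewrite ge_min lexx.
  have m2 : Num.min d d' <= d' by rewrite ge_min lexx orbT.
  move=> y yz; split; first by apply: hd'; lra.
  exists (d / 2); first by rewrite divr_gt0.
  by move=> v vy; apply: hd; have := cm_tri y v z; lra.
- move=> x [Ux nA]; have [d d0 hd] := oU x Ux.
  exists (d / 200); first by rewrite divr_gt0.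
  move=> w' wx; split; first by apply: hd; lra.
  move=> [Uw' [d' d'0 hd']]; apply: nA; apply: (near x d w') => // j.
  suff : forall y, cm (y - w') < d' -> iterB w' f j y = 0 by apply; rewrite subrr cm0.
  elim: j => [//|j ih] y yw; rewrite /iterB /= -/(iterB w' f j) /Bop.
  have w0 : iterB w' f j w' = 0 by apply: ih; rewrite subrr cm0.
  case: eqP => _; last by rewrite (ih y yw) w0 subrr mul0r.
  apply: dvE; apply: (@cderiv_near _ (fun=> 0) _ _ _ d') => //; last exact: cderiv_cst.
  by move=> v /ih.
Qed.

Lemma tcoef_lin U a f g h w i : copen U -> U w -> hol_on U f -> hol_on U g -> hol_on U h ->
  (forall z, U z -> h z = a * f z + g z) ->
  tcoef w h i = a * tcoef w f i + tcoef w g i.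
Proof.
move=> oU Uw hf hg hh hE; rewrite /tcoef.
suff H z : U z -> iterB w h i z = a * iterB w f i z + iterB w g i z by exact: H.
elim: i z => [|i ih] z Uz; first exact: hE.
rewrite /iterB /= -/(iterB w h i) -/(iterB w f i) -/(iterB w g i).
have Hf := iterB_hol i oU hf Uw; have Hg := iterB_hol i oU hg Uw.
rewrite /Bop; case: eqP => [_|/eqP zw]; last first.
  by rewrite !ih//; field; rewrite subr_eq0.
have [d d0 hd] := oU w Uw.
apply: dvE; apply: (@cderiv_near _ (fun z => a * iterB w f i z + iterB w g i z) _ _ _ d) => //.
  by move=> v /hd/ih.
have := cderivD (cderivM (cderiv_cst a w) (dvP (Hf w Uw))) (dvP (Hg w Uw)).
by rewrite mul0r add0r.
Qed.

Lemma tcoef_monomial U w f n i : copen U -> U w -> (forall z, U z -> f z = (z - w) ^+ n) ->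
  tcoef w f i = (i == n)%:R.
Proof.
move=> oU Uw; elim: n i f => [|n ih] i f fE.
  case: i => [|i]; first by rewrite /tcoef /iterB /= fE// subrr expr0.
  suff H z : U z -> iterB w f i.+1 z = 0 by exact: H.
  have base v : U v -> Bop w f v = 0.
    move=> Uv; rewrite /Bop; case: eqP => _; last by rewrite !fE// subrr mul0r.
    have [d d0 hd] := oU w Uw.
    by apply: dvE; apply: (cderiv_near d0 _ (cderiv_cst 1 w)) => y /hd/fE ->.
  elim: i z => [|i ih] z Uz; first exact: base.
  rewrite -[LHS]/(Bop w (iterB w f i.+1) z) /Bop; case: eqP => _; last first.
    by rewrite !ih// subrr mul0r.
  have [d d0 hd] := oU w Uw.
  by apply: dvE; apply: (cderiv_near d0 _ (cderiv_cst 0 w)) => v /hd/ih ->.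
have E z : U z -> Bop w f z = (z - w) ^+ n.
  move=> Uz; rewrite /Bop; case: eqP => [->|/eqP zw]; last first.
    by rewrite !fE// subrr expr0n subr0 exprSr mulfK// subr_eq0.
  have [d d0 hd] := oU w Uw.
  apply: dvE; apply: (@cderiv_near _ (fun z => (z - w) ^+ n.+1) _ _ _ d) => //.
    by move=> v /hd/fE.
  apply/caratheodory; exists (fun h => h ^+ n); split.
  - by rewrite subrr.
  - elim: n {ih fE} => [|n ihn]; first exact: ccont_cst.
    by apply: (ccont_near ltr01 _ (ccontM (ccont_id 0) ihn)) => v _; rewrite exprS.
  - by move=> h; rewrite subrr expr0n add0r addrC addKr exprS.
case: i => [|i]; first by rewrite /tcoef /iterB /= fE// subrr expr0n.
rewrite -(ih i (Bop w f)) // /tcoef /iterB iterSr//.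
Qed.

End Holomorphic.

(** * Compact sets without holes *)

Section Boundary.

Lemma summation_by_parts (A : comNzRingType) (e h : nat -> A) N :
  \sum_(j < N.+1) e j * (h j - h j.+1) =
  e 0 * h 0 - e N * h N.+1 + \sum_(j < N) (e j.+1 - e j) * h j.+1.
Proof.
elim: N => [|N ih]; first by rewrite big_ord_recr !big_ord0 /= add0r addr0 mulrBr.
by rewrite big_ord_recr/= ih [in RHS]big_ord_recr/=; ring.
Qed.

(** A discrete Green formula: [e] weights the squares of a grid, [h] and [v] its horizontal and
    vertical edges, and only edges between squares of different weight remain. Over [F_2] it drives
    the parity count for square roots, over [R[i]] it produces the contour of Runge's theorem. *)
Lemma boundary_sum (A : comNzRingType) (e h v : nat -> nat -> A) N :
  (forall i, e i 0 = 0) -> (forall i, e i N = 0) -> (forall j, e 0 j = 0) -> (forall j, e N j = 0) ->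
  \sum_(i < N.+1) \sum_(j < N.+1) e i j * (h i j + v i.+1 j - h i j.+1 - v i j) =
  \sum_(i < N.+1) \sum_(j < N) (e i j.+1 - e i j) * h i j.+1 -
  \sum_(j < N.+1) \sum_(i < N) (e i.+1 j - e i j) * v i.+1 j.
Proof.
move=> e1 e2 e3 e4.
have -> : \sum_(i < N.+1) \sum_(j < N.+1) e i j * (h i j + v i.+1 j - h i j.+1 - v i j) =
    \sum_(i < N.+1) \sum_(j < N.+1) e i j * (h i j - h i j.+1) -
    \sum_(j < N.+1) \sum_(i < N.+1) e i j * (v i j - v i.+1 j).
  rewrite [X in _ - X]exchange_big/= -sumrB; apply: eq_bigr => i _.
  by rewrite -sumrB; apply: eq_bigr => j _; ring.
congr (_ - _); apply: eq_bigr => i _.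
  by rewrite summation_by_parts e1 e2 !mul0r subrr add0r.
rewrite (summation_by_parts (fun k => e k i) (fun k => v k i)) e3 e4.
by rewrite !mul0r subrr add0r.
Qed.

End Boundary.

(** * The unbounded component of a complement, and continuous square roots *)

Section Fullness.
Variable R : realType.
Local Notation C := R[i].
Local Notation Re := complex.Re.
Local Notation Im := complex.Im.
Implicit Types (x y z w a b c : C) (X Y K L : C -> Prop).

(* For compact X, the unbounded component of the complement: its points are
   reached from far away by a chain of balls avoiding X. *)
Inductive Out X : C -> Prop :=
| Out_far a : (forall z, X z -> cm z < cm a) -> Out X a
| Out_step a b (r : R) : 0 < r -> Out X a -> (forall z, X z -> r <= cm (z - a)) ->
    cm (b - a) < r -> Out X b.

Definition full X := forall a, ~ X a -> Out X a.

Lemma Out_notin X a : Out X a -> ~ X a.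
Proof.
elim => [{}a h /h|{}a b r r0 _ _ h ba /h]; first by rewrite ltxx.
by rewrite leNgt ba.
Qed.

Lemma Out_mono X Y a : (forall z, X z -> Y z) -> Out Y a -> Out X a.
Proof.
move=> XY; elim=> [{}a h|{}a b r r0 _ ih h ba]; first by apply: Out_far => z /XY/h.
by apply: (Out_step r0 ih) => // z /XY/h.
Qed.

(** A step can be reversed when the free ball around [a] has twice the radius, since the ball of
    radius [r] around [b] is then free as well. *)
Lemma Out_sym X a b (r : R) : 0 < r -> (forall z, X z -> 2 * r <= cm (z - a)) ->
  cm (b - a) < r -> Out X b -> Out X a.
Proof.
move=> r0 h ba Ob; apply: (Out_step r0 Ob); last by rewrite cmC.
by move=> z /h; have := cm_tri b z a; lra.
Qed.

(** For compact [X]: the set with the bounded components of its complement filled in. *)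
Definition hull X z := ~ Out X z.

Lemma sub_hull X z : X z -> hull X z.
Proof. by move=> Xz /Out_notin. Qed.

(** A chain for [X] is also one for its hull, because every point of a ball used in a step is itself
    reached by that step. *)
Lemma hull_full X : full (hull X).
Proof.
move=> a /contrapT; elim=> [{}a h|{}a b r r0 Oa ih h ba].
  apply: Out_far => z nO; rewrite ltNge; apply/negP => az; apply: nO.
  by apply: Out_far => x /h/lt_le_trans; apply.
apply: (Out_step r0 ih) => // z nO; rewrite leNgt; apply/negP => za; apply: nO.
exact: (Out_step r0 Oa).
Qed.

Lemma hull_sub X Y : (forall z, X z -> Y z) -> full Y -> forall z, hull X z -> Y z.
Proof. by move=> XY fY z nO; apply: contrapT => /fY /(Out_mono XY). Qed.

Lemma hull_mono X Y : (forall z, X z -> Y z) -> forall z, hull X z -> hull Y z.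
Proof. by move=> XY z nO /(Out_mono XY). Qed.

Lemma Out_open X : ccompact X -> copen (Out X).
Proof.
move=> cX a Oa; have [d d0 hd] := ccompact_dist cX (Out_notin Oa).
by exists d => // y ya; exact: (Out_step d0 Oa).
Qed.

Lemma bounded_component_open X : ccompact X -> copen (fun z => hull X z /\ ~ X z).
Proof.
move=> cX a [nO Xa]; have [d d0 hd] := ccompact_dist cX Xa.
exists (d / 2); first by rewrite divr_gt0.
move=> y ya; split.
  move=> Oy; apply: nO; apply: (@Out_sym _ a y (d / 2)) => //; first by rewrite divr_gt0.
  by move=> z /hd; lra.
by move=> /hd; have := ya; lra.
Qed.

Lemma far_point X : ccompact X -> exists a, forall z, X z -> cm z < cm a.
Proof.
move=> /ccompact_bounded[B [B0 hB]]; exists ((B + 1)%:C)%C => z /hB h.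
by rewrite cm_real gtr0_norm; lra.
Qed.

Lemma connected_full X : ccompact X -> cconnected (fun z => ~ X z) -> full X.
Proof.
move=> cX conn; apply: conn.
- exact: Out_notin.
- by have [a ha] := far_point cX; exists a; exact: Out_far.
- exact: Out_open.
- move=> z [Xz nO]; have [d d0 hd] := bounded_component_open cX (conj nO Xz).
  by exists d => // y /hd[? ?].
Qed.

Definition has_sqrt X (g : C -> C) := exists2 s : C -> C, cont_on X s & forall z, X z -> s z ^+ 2 = g z.

Lemma cont_onD X f g : cont_on X f -> cont_on X g -> cont_on X (fun w => f w + g w).
Proof.
move=> fc gc x Xx e e0; have e2 : 0 < e / 2 by lra.
have [d d0 hd] := fc x Xx _ e2; have [d' d0' hd'] := gc x Xx _ e2.
exists (Num.min d d'); rewrite ?lt_min ?d0// => y Xy; rewrite lt_min => /andP[yd yd'].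
by have := hd y Xy yd; have := hd' y Xy yd'; rewrite opprD addrACA;
  have := cmD (f y - f x) (g y - g x); lra.
Qed.

Lemma cont_onM X f g : cont_on X f -> cont_on X g -> cont_on X (fun w => f w * g w).
Proof.
move=> fc gc x Xx e e0.
have [r r0 hr] := fc x Xx 1 ltr01.
have A0 := cm_ge0 (f x); have B0 := cm_ge0 (g x).
set A := cm (f x) + 1; set B := cm (g x) + 1.
have A1 : 0 < A by rewrite /A; lra.
have B1 : 0 < B by rewrite /B; lra.
have e2 : 0 < e / 2 by lra.
have [d d0 hd] := fc x Xx _ (divr_gt0 e2 B1); have [d' d0' hd'] := gc x Xx _ (divr_gt0 e2 A1).
exists (Num.min r (Num.min d d')); rewrite ?lt_min ?r0 ?d0// => w Xw.
rewrite !lt_min => /and3P[/(hr _ Xw) a /(hd _ Xw) b /(hd' _ Xw) c].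
have -> : f w * g w - f x * g x = f w * (g w - g x) + (f w - f x) * g x by ring.
rewrite (le_lt_trans (cmD _ _))// !cmM.
have h1 : cm (f w) * cm (g w - g x) <= A * cm (g w - g x).
  by rewrite ler_wpM2r// ?cm_ge0//; have := cm_rev (f w) (f x); rewrite /A; lra.
have h2 : A * cm (g w - g x) < e / 2 by rewrite mulrC -ltr_pdivlMr.
have h3 : cm (f w - f x) * cm (g x) <= cm (f w - f x) * B.
  by rewrite ler_wpM2l ?cm_ge0//; rewrite /B; lra.
have h4 : cm (f w - f x) * B < e / 2 by rewrite -ltr_pdivlMr.
lra.
Qed.

Lemma cont_on_cst X c : cont_on X (fun=> c).
Proof. by apply: ccont_cont_on => x _; exact: ccont_cst. Qed.
Lemma cont_on_id X : cont_on X id.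
Proof. by apply: ccont_cont_on => x _; exact: ccont_id. Qed.
Lemma cont_on_ext X f g : (forall z, X z -> f z = g z) -> cont_on X f -> cont_on X g.
Proof.
move=> fg fc x Xx e e0; have [d d0 hd] := fc x Xx e e0; exists d => // y Xy yx.
by rewrite -!fg//; exact: hd.
Qed.
Lemma cont_onN X f : cont_on X f -> cont_on X (fun w => - f w).
Proof.
move=> fc; apply: (@cont_on_ext _ (fun w => -1 * f w)) => [z _|]; first by rewrite mulN1r.
by apply: cont_onM => //; exact: cont_on_cst.
Qed.
Lemma cont_onB X f g : cont_on X f -> cont_on X g -> cont_on X (fun w => f w - g w).
Proof. by move=> fc gc; apply: cont_onD => //; exact: cont_onN. Qed.
Lemma has_sqrtM X f g : has_sqrt X f -> has_sqrt X g -> has_sqrt X (fun z => f z * g z).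
Proof.
move=> [s sc sE] [t tc tE]; exists (fun z => s z * t z); first exact: cont_onM.
by move=> z Xz; rewrite exprMn sE// tE.
Qed.

Lemma has_sqrt_cst X c : has_sqrt X (fun=> c).
Proof.
exists (fun=> sqrtc c); first exact: cont_on_cst.
by move=> z _; rewrite sqr_sqrtc.
Qed.

Lemma has_sqrt_ext X f g : (forall z, X z -> f z = g z) -> has_sqrt X f -> has_sqrt X g.
Proof. by move=> fg [s sc sE]; exists s => // z Xz; rewrite sE// fg. Qed.

Lemma has_sqrt_near1 X g : cont_on X g -> (forall z, X z -> cm (g z - 1) < 1) -> has_sqrt X g.
Proof.
move=> gc g1.
pose s z := if 0 <= Re (sqrtc (g z)) then sqrtc (g z) else - sqrtc (g z).
have sE z : s z ^+ 2 = g z by rewrite /s; case: ifP; rewrite ?sqrrN sqr_sqrtc.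
have s0 z : 0 <= Re (s z).
  by rewrite /s; case: ifPn => //; rewrite -ltNge cReN; lra.
exists s => // x Xx e e0.
(* A purely imaginary root would make [g x] a nonpositive real, at distance at least 1 from 1.
   Positivity then bounds [cm (s y + s x)] from below in the difference of squares. *)
have sx : 0 < Re (s x).
  rewrite lt_neqAle s0 andbT; apply/eqP => sx.
  have := le_lt_trans (cm_Re _) (g1 x Xx); rewrite -sE expr2 !cE -sx mul0r add0r /= ltr_norml.
  by have := sqr_ge0 (Im (s x)); rewrite expr2 => ? /andP[]; lra.
have [d d0 hd] := gc x Xx (e * Re (s x)) (mulr_gt0 e0 sx); exists d => // y Xy yx.
have := hd y Xy yx; rewrite -!sE subr_sqr cmM => h.
have h2 : Re (s x) <= cm (s y + s x).
  by apply: le_trans (cm_Re _); rewrite cReD ger0_norm ?addr_ge0//; have := s0 y; lra.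
have h3 : cm (s y - s x) * Re (s x) <= cm (s y - s x) * cm (s y + s x).
  by rewrite ler_wpM2l// cm_ge0.
by have := le_lt_trans h3 h; rewrite ltr_pM2r.
Qed.

(** Induction along the chain: far away [z - a] is [- a * (1 - z / a)], and a step multiplies by
    [1 - (b - a) / (z - a)]; both new factors stay within distance 1 of 1, where a branch of the
    root exists. *)
Lemma Out_sqrt X a : Out X a -> has_sqrt X (fun z => z - a).
Proof.
have key b c : (forall z, X z -> cm c < cm (z - b) ) -> has_sqrt X (fun z => 1 - c / (z - b)).
  move=> h; apply: has_sqrt_near1.
    apply: ccont_cont_on => x /h xb.
    have xb0 : x - b != 0 by rewrite -cm_gt0; apply: le_lt_trans xb; exact: cm_ge0.
    apply: ccontD; first exact: ccont_cst.
    apply: ccontN; apply: ccontM; first exact: ccont_cst.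
    by apply: ccontV => //; apply: ccontD; [exact: ccont_id|exact: ccont_cst].
  move=> z /h zb; rewrite addrC addKr cmN cmf.
  have zb0 : 0 < cm (z - b) by apply: le_lt_trans zb; exact: cm_ge0.
  by rewrite ltr_pdivrMr// mul1r.
elim=> [{}a h|{}a b r r0 _ ih h ba].
  have [s0 s0c s0E] := has_sqrt_cst X (- a).
  apply: (@has_sqrt_ext _ (fun z => - a * (1 - z / a))).
    move=> z /h za; have a0 : a != 0 by rewrite -cm_gt0; apply: le_lt_trans za; exact: cm_ge0.
    by field.
  apply: has_sqrtM; first exact: has_sqrt_cst.
  apply: has_sqrt_near1.
    apply: cont_onB; first exact: cont_on_cst.
    by apply: cont_onM; [exact: cont_on_id|exact: cont_on_cst].
  move=> z /h za; rewrite addrC addKr cmN cmf.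
  have a0 : 0 < cm a by apply: le_lt_trans za; exact: cm_ge0.
  by rewrite ltr_pdivrMr// mul1r.
apply: (@has_sqrt_ext _ (fun z => (z - a) * (1 - (b - a) / (z - a)))).
  move=> z /h za; have a0 : z - a != 0 by rewrite -cm_gt0; exact: lt_le_trans za.
  by field.
apply: has_sqrtM => //; apply: key => z /h; exact: lt_le_trans.
Qed.

End Fullness.

(** * Signs of inner products in the plane *)

Section Signs.
Variable R : realType.
Implicit Types x y : R.

(** The hypotheses say that the squares of [x + iy] and [x' + iy'] have positive real part: the real
    parts dominate and decide the sign of the inner product. *)
Lemma sign_dominant x y x' y' : y ^+ 2 < x ^+ 2 -> y' ^+ 2 < x' ^+ 2 ->
  (x * x' + y * y' < 0) = (x < 0) (+) (x' < 0).
Proof.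
move=> h h'.
have pos (u v u' v' : R) : v ^+ 2 < u ^+ 2 -> v' ^+ 2 < u' ^+ 2 -> 0 <= u -> 0 <= u' ->
    `|v * v'| < u * u'.
  move=> h1 h2 u0 u0'; rewrite normrM ltr_pM//.
  - by rewrite -(@ltr_pXn2r _ 2)// ?nnegrE// real_normK ?num_real.
  - by rewrite -(@ltr_pXn2r _ 2)// ?nnegrE// real_normK ?num_real.
have [x0|x0] := ltP x 0; have [x0'|x0'] := ltP x' 0 => /=.
- have := pos (- x) y (- x') y'; rewrite !sqrrN => /(_ h h'); rewrite mulrNN ltr_norml => p.
  by apply/negbTE; rewrite -leNgt; move: p => /(_ ltac:(lra) ltac:(lra)) /andP[? ?]; lra.
- have := pos (- x) y x' y'; rewrite !sqrrN => /(_ h h'); rewrite mulNr ltr_norml => p.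
  by apply/idP; move: p => /(_ ltac:(lra) ltac:(lra)) /andP[? ?]; lra.
- have := pos x y (- x') y'; rewrite !sqrrN => /(_ h h'); rewrite mulrN ltr_norml => p.
  by apply/idP; move: p => /(_ ltac:(lra) ltac:(lra)) /andP[? ?]; lra.
- have := pos x y x' y' h h'; rewrite ltr_norml => p.
  by apply/negbTE; rewrite -leNgt; move: p => /(_ ltac:(lra) ltac:(lra)) /andP[? ?]; lra.
Qed.

Lemma sign_quadrant x y x' y' : 0 < (x * y) * (x' * y') ->
  (x * x' + y * y' < 0) = (x < 0) (+) (x' < 0).
Proof.
move=> h.
have h2 : 0 < (x * x') * (y * y') by rewrite mulrACA.
have x0 : x != 0 by apply: contraTneq h => ->; rewrite !mul0r ltxx.
have x0' : x' != 0 by apply: contraTneq h => ->; rewrite mul0r mulr0 ltxx.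
have -> : (x < 0) (+) (x' < 0) = (x * x' < 0).
  rewrite (@mulr_lt0 _ x x') x0 x0' /=.
  by case: (ltP x 0); case: (ltP x' 0).
have [p|p] := ltP (x * x') 0.
  have : y * y' < 0 by move: h2; rewrite nmulr_rgt0.
  by lra.
have p' : 0 < x * x' by rewrite lt_neqAle p andbT eq_sym mulf_neq0.
have : 0 < y * y' by move: h2; rewrite pmulr_rgt0.
by move=> ?; apply/negbTE; rewrite -leNgt; lra.
Qed.

End Signs.

(** * Square roots detect the unbounded component *)

Section SqrtOut.
Variable R : realType.
Local Notation C := R[i].
Local Notation Re := complex.Re.
Local Notation Im := complex.Im.
Implicit Types (x y z w a b c v s : C) (X : C -> Prop).

(* A change of branch between the square roots s and w at the ends of an edge. *)
Let turn s w : bool := Re s * Re w + Im s * Im w < 0.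

Let Re_sqr s : Re (s ^+ 2) = Re s ^+ 2 - Im s ^+ 2.
Proof. by rewrite expr2 cReM !expr2. Qed.
Let Im_sqr s : Im (s ^+ 2) = 2 * (Re s * Im s).
Proof. by rewrite expr2 cImM; ring. Qed.

Let turn_Re_gt0 s w : 0 < Re (s ^+ 2) -> 0 < Re (w ^+ 2) -> turn s w = (Re s < 0) (+) (Re w < 0).
Proof. by rewrite !Re_sqr !subr_gt0; exact: sign_dominant. Qed.
Let turn_Re_lt0 s w : Re (s ^+ 2) < 0 -> Re (w ^+ 2) < 0 -> turn s w = (Im s < 0) (+) (Im w < 0).
Proof. by rewrite !Re_sqr !subr_lt0 /turn addrC; exact: sign_dominant. Qed.
Let turn_Im s w : 0 < Im (s ^+ 2) * Im (w ^+ 2) -> turn s w = (Re s < 0) (+) (Re w < 0).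
Proof. by rewrite !Im_sqr => h; apply: sign_quadrant; lra. Qed.

Let F2 (b : bool) : 'F_2 := b%:R.

Let turn_total s1 s2 s3 s4 : 'F_2 :=
  F2 (turn s1 s2) + F2 (turn s2 s3) - F2 (turn s4 s3) - F2 (turn s1 s4).

(** If the four squares share one of these half-planes, every [turn] is the sum of the signs of a
    single coordinate at its two ends, and each sign occurs twice around the square. *)
Let total_eq0 s1 s2 s3 s4 :
  [\/ [/\ 0 < Re (s1 ^+ 2), 0 < Re (s2 ^+ 2), 0 < Re (s3 ^+ 2) & 0 < Re (s4 ^+ 2)],
      [/\ Re (s1 ^+ 2) < 0, Re (s2 ^+ 2) < 0, Re (s3 ^+ 2) < 0 & Re (s4 ^+ 2) < 0],
      [/\ 0 < Im (s1 ^+ 2), 0 < Im (s2 ^+ 2), 0 < Im (s3 ^+ 2) & 0 < Im (s4 ^+ 2)] |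
      [/\ Im (s1 ^+ 2) < 0, Im (s2 ^+ 2) < 0, Im (s3 ^+ 2) < 0 & Im (s4 ^+ 2) < 0]] ->
  turn_total s1 s2 s3 s4 = 0.
Proof.
rewrite /turn_total; case=> -[h1 h2 h3 h4].
- rewrite !turn_Re_gt0//.
  by case: (Re s1 < 0); case: (Re s2 < 0); case: (Re s3 < 0); case: (Re s4 < 0); exact/val_inj.
- rewrite !turn_Re_lt0//.
  by case: (Im s1 < 0); case: (Im s2 < 0); case: (Im s3 < 0); case: (Im s4 < 0); exact/val_inj.
- rewrite !turn_Im ?mulr_gt0//.
  by case: (Re s1 < 0); case: (Re s2 < 0); case: (Re s3 < 0); case: (Re s4 < 0); exact/val_inj.
- rewrite !turn_Im ?nmulr_rgt0//.
  by case: (Re s1 < 0); case: (Re s2 < 0); case: (Re s3 < 0); case: (Re s4 < 0); exact/val_inj.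
Qed.

(** The squares occupy the four quadrants. Three edges are read off from the signs of real parts,
    the edge from [s1] to [s4] from imaginary parts; these signs differ at [s1] and agree at [s4],
    which leaves one unit. *)
Let total_eq1 s1 s2 s3 s4 :
  Im (s1 ^+ 2) < 0 -> Im (s2 ^+ 2) < 0 -> 0 < Re (s2 ^+ 2) -> 0 < Re (s3 ^+ 2) ->
  0 < Im (s3 ^+ 2) -> 0 < Im (s4 ^+ 2) -> Re (s4 ^+ 2) < 0 -> Re (s1 ^+ 2) < 0 ->
  turn_total s1 s2 s3 s4 = 1.
Proof.
move=> h1 h2 h3 h4 h5 h6 h7 h8; rewrite /turn_total.
have n12 : 0 < Im (s1 ^+ 2) * Im (s2 ^+ 2) by rewrite nmulr_rgt0.
rewrite (turn_Re_gt0 h3 h4) (turn_Re_lt0 h8 h7) (turn_Im n12) (turn_Im (mulr_gt0 h6 h5)).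
have -> : (Im s1 < 0) = ~~ (Re s1 < 0).
  move: h1; rewrite Im_sqr pmulr_rlt0// mulr_lt0 => /and3P[? ? /eqP].
  by case: (Re s1 < 0); case: (Im s1 < 0).
have -> : (Im s4 < 0) = (Re s4 < 0).
  move: h6; rewrite Im_sqr pmulr_rgt0// => h.
  have [p|p] := ltP (Re s4) 0; first by apply/idP; move: h; rewrite nmulr_rgt0.
  apply/negbTE; rewrite -leNgt.
  have p' : 0 < Re s4 by rewrite lt_neqAle p andbT; apply: contraTneq h => <-; rewrite mul0r ltxx.
  by move: h; rewrite pmulr_rgt0// => /ltW.
by case: (Re s1 < 0); case: (Re s2 < 0); case: (Re s3 < 0); case: (Re s4 < 0); exact/val_inj.
Qed.

(* Otherwise cover the bounded component of [a] by small grid squares and choose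
   a root of [v - a] at every vertex [v], close to the continuous root when [v]
   is near [X]. Modulo 2, the number of branch changes around a square is 1 for
   the square centred at [a] and 0 for the others, so their sum is 1; but the
   sum only involves boundary edges, which lie near [X] and carry no change. *)
Lemma sqrt_Out X a : ccompact X -> ~ X a -> has_sqrt X (fun z => z - a) -> Out X a.
Proof.
move=> cX Xa [s sc sE]; apply: contrapT => nO.
pose Bd z := ~ X z /\ ~ Out X z.
have [B [B0 hB]] := ccompact_bounded cX.
have BdB z : Bd z -> cm z <= B.
  move=> [_ nOz]; rewrite leNgt; apply/negP => Bz; apply: nOz; apply: Out_far => x /hB; lra.
have [d0 d00 hd0] := ccompact_dist cX Xa.
(* Roots on [X] have modulus at least [8 * e], while the chosen roots at the ends of a boundary edge
   will differ by at most [3 * e]; such numbers cannot have a negative inner product. *)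
pose e := Num.sqrt d0 / 8.
have e0 : 0 < e by rewrite divr_gt0// sqrtr_gt0.
have ee : 64 * e ^+ 2 = d0 by rewrite /e expr_div_n sqr_sqrtr ?ltW//; field.
have [eta eta0 heta] := ccompact_ucont cX sc e0.
(* A vertex within [9 * h] of [X] gets a root within [e] of [s], and the points of [X] attached to
   two corners of a square are at distance below [9 * h + 2 * h + 9 * h], hence below [eta]. *)
pose h := Num.min (e ^+ 2) eta / 20.
have m0 : 0 < Num.min (e ^+ 2) eta by rewrite lt_min eta0 exprn_gt0.
have h0 : 0 < h by rewrite /h; lra.
have h1 : 20 * h <= e ^+ 2.
  by rewrite /h mulrC divfK ?ge_min ?lexx// gt_eqF.
have h2 : 20 * h <= eta.
  by rewrite /h mulrC divfK ?ge_min ?lexx ?orbT// gt_eqF.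
clearbody h.
have [m hm] := archi_nat ((B + cm a + 2 * h) / h).
have {}hm : B + cm a + 2 * h < m%:R * h by have := hm m (leqnn m); rewrite ltr_pdivrMr.
pose N := (2 * m)%N.
(* The offset 1/2 puts [a] at the centre of the square [(m, m)] and keeps the real and imaginary
   parts of [V i j - a] away from 0. *)
pose q (i : nat) : R := (i%:R - m%:R - 1 / 2) * h.
pose V i j : C := pt a (q i) (q j).
have qS i : q i.+1 = q i + h by rewrite /q -natr1; ring.
have inV i j : [/\ inSq (V i j) h (V i j), inSq (V i j) h (V i.+1 j),
    inSq (V i j) h (V i.+1 j.+1) & inSq (V i j) h (V i j.+1)].
  by split; split; rewrite !(Re_pt, Im_pt) ?qS; lra.
pose E i j := `[< exists2 z, inSq (V i j) h z & Bd z >].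
have qbig : B + cm a < (m%:R - 1 / 2) * h by lra.
have ra := ler_norm (Re a); have ra' := ler_norm (- Re a); rewrite normrN in ra'.
have ia := ler_norm (Im a); have ia' := ler_norm (- Im a); rewrite normrN in ia'.
have ca := cm_Re a; have ca' := cm_Im a.
have q0 : q 0 + h = - ((m%:R - 1 / 2) * h) by rewrite /q; field.
have qN : q N = (m%:R - 1 / 2) * h by rewrite /q /N natrM; ring.
have E1 i : E i 0 = false.
  apply/asboolPn => -[z [_ _ _ z4] /BdB zB]; rewrite Im_pt in z4.
  by have := cm_Im z; rewrite ler_norml => /andP[]; lra.
have E2 i : E i N = false.
  apply/asboolPn => -[z [_ _ z4 _] /BdB zB]; rewrite Im_pt in z4.
  by have := cm_Im z; rewrite ler_norml => /andP[]; lra.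
have E3 i : E 0 i = false.
  apply/asboolPn => -[z [_ z4 _ _] /BdB zB]; rewrite Re_pt in z4.
  by have := cm_Re z; rewrite ler_norml => /andP[]; lra.
have E4 i : E N i = false.
  apply/asboolPn => -[z [z4 _ _ _] /BdB zB]; rewrite Re_pt in z4.
  by have := cm_Re z; rewrite ler_norml => /andP[]; lra.
have Em : E m m.
  by apply/asboolP; exists a => //; split; rewrite !(Re_pt, Im_pt) /q; lra.
have root v : exists t : C, t ^+ 2 = v - a /\ ((exists2 x, X x & cm (x - v) < 9 * h) ->
    exists x, [/\ X x, cm (x - v) < 9 * h & cm (t - s x) <= e]).
  have [[x Xx xv]|nx] := pselect (exists2 x, X x & cm (x - v) < 9 * h); last first.
    by exists (sqrtc (v - a)); split; [exact: sqr_sqrtc|move=> /nx].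
  pose r := sqrtc (v - a).
  (* The root nearer to [s x]: the product of [cm (t - s x)] and [cm (t + s x)] is [cm (v - x)],
     below [e ^+ 2], so the smaller factor is at most [e]. *)
  pose t := if cm (r - s x) <= cm (r + s x) then r else - r.
  have tE : t ^+ 2 = v - a by rewrite /t; case: ifP => _; rewrite ?sqrrN sqr_sqrtc.
  exists t; split=> // _; exists x; split=> //.
  have le1 : cm (t - s x) <= cm (t + s x).
    rewrite /t; case: ifPn => //; rewrite -ltNge => /ltW.
    by rewrite -(cmN (- r - s x)) opprD !opprK -(cmN (- r + s x)) opprD !opprK.
  have : cm (t - s x) * cm (t + s x) < 9 * h.
    rewrite -cmM -subr_sqr tE sE//.
    have -> : v - a - (x - a) = v - x by ring. by rewrite cmC.
  move=> le2.
  have : cm (t - s x) ^+ 2 <= e ^+ 2.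
    have : cm (t - s x) * cm (t - s x) <= cm (t - s x) * cm (t + s x) by rewrite ler_wpM2l// cm_ge0.
    rewrite expr2; lra.
  by rewrite ler_pXn2r// ?nnegrE ?cm_ge0// ltW.
have [S hS] := choice root.
have SE v : S v ^+ 2 = v - a by case: (hS v).
(* A point outside the bounded components, in a square that meets them, is close to [X]: otherwise
   it would lie in [Out X] with a free ball large enough to reach [b]. *)
have near Q b v : inSq Q h b -> Bd b -> inSq Q h v -> ~ Bd v ->
    exists x, [/\ X x, cm (x - v) < 9 * h & cm (S v - s x) <= e].
  move=> bQ [Xb nOb] vQ nB; case: (hS v) => _; apply; apply: contrapT => nx.
  have free z : X z -> 9 * h <= cm (z - v).
    by move=> Xz; rewrite leNgt; apply/negP => zv; apply: nx; exists z.
  have Xv : ~ X v by move=> /free; rewrite subrr cm0; lra.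
  have Ov : Out X v by apply: contrapT => nOv; exact: nB.
  apply: nOb; apply: (@Out_step _ X v b (9 * h)) => //; first by lra.
  by have := inSq_cm bQ vQ; lra.
have noturn Q v w : inSq Q h v -> inSq Q h w ->
    (exists x, [/\ X x, cm (x - v) < 9 * h & cm (S v - s x) <= e]) ->
    (exists x, [/\ X x, cm (x - w) < 9 * h & cm (S w - s x) <= e]) -> turn (S v) (S w) = false.
  move=> vQ wQ [x [Xx xv sx]] [y [Xy yw sy]].
  have vw := inSq_cm vQ wQ.
  have yx : cm (y - x) < eta.
    have := cm_tri w y x; have := cm_tri v w x; rewrite (cmC w v) (cmC v x); lra.
  have sxy := heta x y Xx Xy yx.
  have d1 : cm (S v - S w) <= 3 * e.
    have := cm_tri (s x) (S v) (S w); have := cm_tri (s y) (s x) (S w).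
    by rewrite (cmC (s x) (s y)) (cmC (s y) (S w)); lra.
  have big u z : X z -> cm (z - u) < 9 * h -> 63 * e ^+ 2 <= cm (S u) ^+ 2.
    move=> Xz zu; rewrite -cmX SE; have := hd0 z Xz; have := cm_tri u z a; lra.
  have b1 := big v x Xx xv; have b2 := big w y Xy yw.
  have d2 : cm (S v - S w) ^+ 2 <= 9 * e ^+ 2.
    have -> : 9 * e ^+ 2 = (3 * e) ^+ 2 by ring.
    by apply: lerXn2r; rewrite ?nnegrE ?cm_ge0//; lra.
  apply/negbTE; rewrite -leNgt.
  move: b1 b2 d2; rewrite !sqr_cm !cE.
  have -> : (Re (S v) - Re (S w)) ^+ 2 + (Im (S v) - Im (S w)) ^+ 2 =
     (Re (S v) ^+ 2 + Im (S v) ^+ 2) + (Re (S w) ^+ 2 + Im (S w) ^+ 2)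
     - 2 * (Re (S v) * Re (S w) + Im (S v) * Im (S w)) by ring.
  have := sqr_ge0 e; lra.
have edge Q1 Q2 v w : inSq Q1 h v -> inSq Q1 h w -> inSq Q2 h v -> inSq Q2 h w ->
    `[< exists2 z, inSq Q1 h z & Bd z >] != `[< exists2 z, inSq Q2 h z & Bd z >] ->
    turn (S v) (S w) = false.
  move=> v1 w1 v2 w2; case: asboolP => [[b b1 Bb]|n1]; case: asboolP => [[b' b1' Bb']|n2] //= _.
    apply: (noturn Q1) => //; apply: (near Q1 b) => // nB; apply: n2.
      by exists v.
    by exists w.
  apply: (noturn Q2) => //; apply: (near Q2 b') => // nB; apply: n1.
    by exists v.
  by exists w.
pose H i j := F2 (turn (S (V i j)) (S (V i.+1 j))).
pose W i j := F2 (turn (S (V i j)) (S (V i j.+1))).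
have := @boundary_sum 'F_2 (fun i j => F2 (E i j)) H W N (fun i => congr1 F2 (E1 i))
  (fun i => congr1 F2 (E2 i)) (fun i => congr1 F2 (E3 i)) (fun i => congr1 F2 (E4 i)).
rewrite [RHS](_ : _ = 0); last first.
  rewrite !big1 ?subrr// => i _; rewrite big1// => j _.
    have [->|ne] := eqVneq (E j.+1 i) (E j i); first by rewrite subrr mul0r.
    have [_ a1 a2 _] := inV j i; have [b1 _ _ b2] := inV j.+1 i.
    by rewrite /W (edge _ _ _ _ b1 b2 a1 a2 ne) mulr0.
  have [->|ne] := eqVneq (E i j.+1) (E i j); first by rewrite subrr mul0r.
  have [_ _ a1 a2] := inV i j; have [b1 b2 _ _] := inV i j.+1.
  by rewrite /H (edge _ _ _ _ b1 b2 a2 a1 ne) mulr0.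
have term i j : F2 (E i j) * (H i j + W i.+1 j - H i j.+1 - W i j) = F2 ((i == m) && (j == m)).
  have -> : H i j + W i.+1 j - H i j.+1 - W i j =
    turn_total (S (V i j)) (S (V i.+1 j)) (S (V i.+1 j.+1)) (S (V i j.+1)) by [].
  have rV k l : Re (V k l - a) = q k by rewrite cReD cReN Re_pt; ring.
  have iV k l : Im (V k l - a) = q l by rewrite cImD cImN Im_pt; ring.
  have qpos k : (m < k)%N -> 0 < q k.
    move=> mk; rewrite /q mulr_gt0//.
    have : m.+1%:R <= k%:R :> R by rewrite ler_nat.
    by rewrite -natr1; lra.
  have qneg k : (k <= m)%N -> q k < 0.
    move=> mk; rewrite /q nmulr_rlt0//.
    have : k%:R <= m%:R :> R by rewrite ler_nat.
    by lra.
  have [->|im] := eqVneq i m; last first.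
    rewrite total_eq0 ?mulr0// !SE !rV.
    move: im; rewrite neq_ltn => /orP[im|im].
      by constructor 2; split; apply: qneg; rewrite ?(ltnW im).
    by constructor 1; split; apply: qpos; rewrite ?(leqW im).
  have [->|jm] := eqVneq j m; last first.
    rewrite total_eq0 ?mulr0// !SE !iV.
    move: jm; rewrite neq_ltn => /orP[jm|jm].
      by constructor 4; split; apply: qneg; rewrite ?(ltnW jm).
    by constructor 3; split; apply: qpos; rewrite ?(leqW jm).
  rewrite Em total_eq1 ?mulr1// !SE ?rV ?iV; by [apply: qneg|apply: qpos].
have mN : (m < N.+1)%N by rewrite /N ltnS leq_pmull.
under eq_bigr do under eq_bigr do rewrite term.
rewrite (bigD1 (Ordinal mN))//= (bigD1 (Ordinal mN))//= !eqxx big1 ?addr0; last first.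
  by move=> i im; rewrite (negbTE (_ : (i : nat) != m)).
rewrite big1 ?addr0; last first.
  by move=> i im; rewrite big1// => j _; rewrite (negbTE (_ : (i : nat) != m)).
by move/eqP.
Qed.

End SqrtOut.

(** * Unions and images of sets without holes; polynomial approximation *)

Section Approximation.
Variable R : realType.
Local Notation C := R[i].
Local Notation Re := complex.Re.
Local Notation Im := complex.Im.
Implicit Types (x y z w a b c v s : C) (X Y K : C -> Prop) (f g psi u : C -> C) (p q : {poly C}).

(** With the remainder of [Y] compact, it has positive distance from [X]; a root on [X] and a root
    on [Y] then combine into a continuous root on the union, whatever their signs. *)
Lemma full_union X Y : ccompact X -> ccompact Y -> full X -> full Y ->
  ccompact (fun z => Y z /\ ~ X z) -> full (fun z => X z \/ Y z).
Proof.
move=> cX cY fX fY cYX a /not_orP[Xa Ya].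
have [s sc sE] := Out_sqrt (fX a Xa); have [t tc tE] := Out_sqrt (fY a Ya).
apply: sqrt_Out; [exact: ccompactU|by case|].
pose u z := if `[< X z >] then s z else t z.
have u1 z : X z -> u z = s z by move=> Xz; rewrite /u asboolT.
have u2 z : ~ X z -> u z = t z by move=> Xz; rewrite /u asboolF.
exists u; last first.
  by move=> z h; have [Xz|Xz] := pselect (X z); [rewrite u1// sE|case: h => // Yz; rewrite u2// tE].
move=> x h e e0; have [Xx|Xx] := pselect (X x).
  have [d d0 hd] := ccompact_dist cYX (fun h : Y x /\ ~ X x => h.2 Xx).
  have [d' d'0 hd'] := sc x Xx e e0.
  exists (Num.min d d'); first by rewrite lt_min d0.
  move=> y Ky; rewrite lt_min => /andP[yd yd']; have [Xy|Xy] := pselect (X y).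
    by rewrite !u1//; exact: hd'.
  by case: Ky => // Yy; have := hd y (conj Yy Xy); lra.
have Yx : Y x by case: h.
have [d d0 hd] := ccompact_dist cX Xx.
have [d' d'0 hd'] := tc x Yx e e0.
exists (Num.min d d'); first by rewrite lt_min d0.
move=> y Ky; rewrite lt_min => /andP[yd yd']; have [Xy|Xy] := pselect (X y).
  by have := hd y Xy; lra.
by rewrite !u2//; apply: hd' => //; case: Ky.
Qed.

(** Polynomials in [psi]: with [psi] one of the given self-maps, an approximant of [f] is a
    polynomial prescribing values on the image of [X] without inverting the map. *)
Definition pap X psi f := forall e : R, 0 < e -> exists p, forall z, X z -> cm (p.[psi z] - f z) <= e.

Lemma pap_ext X psi f g : (forall z, X z -> f z = g z) -> pap X psi f -> pap X psi g.
Proof. by move=> fg pf e /pf[p hp]; exists p => z Xz; rewrite -fg//; exact: hp. Qed.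

Lemma pap_poly X psi p : pap X psi (fun z => p.[psi z]).
Proof. by move=> e e0; exists p => z _; rewrite subrr cm0 ltW. Qed.

Lemma pap_cst X psi c : pap X psi (fun=> c).
Proof. by move=> e e0; exists c%:P => z _; rewrite hornerC subrr cm0 ltW. Qed.

Lemma papD X psi f g : pap X psi f -> pap X psi g -> pap X psi (fun z => f z + g z).
Proof.
move=> pf pg e e0; have e2 : 0 < e / 2 by lra.
have [p hp] := pf _ e2; have [q hq] := pg _ e2; exists (p + q) => z Xz.
rewrite hornerD opprD addrACA (le_trans (cmD _ _))//.
have := hp z Xz; have := hq z Xz; lra.
Qed.

Lemma papM X psi f g (A B : R) : (forall z, X z -> cm (f z) <= A) -> (forall z, X z -> cm (g z) <= B) ->
  pap X psi f -> pap X psi g -> pap X psi (fun z => f z * g z).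
Proof.
move=> fA gB pf pg e e0.
have [e1 e10 [h1 h2]] : exists2 e1 : R, 0 < e1 & e1 <= 1 /\ e1 * (`|A| + `|B| + 1) <= e.
  have s0 : 0 < `|A| + `|B| + 1 by have := normr_ge0 A; have := normr_ge0 B; lra.
  exists (Num.min 1 (e / (`|A| + `|B| + 1))); first by rewrite lt_min ltr01 divr_gt0.
  by split; rewrite -?ler_pdivlMr// ge_min lexx ?orbT.
have [p hp] := pf _ e10; have [q hq] := pg _ e10; exists (p * q) => z Xz.
have := hp z Xz; have := hq z Xz; rewrite hornerM.
set P := p.[_]; set Q := q.[_] => h3 h4.
have -> : P * Q - f z * g z = (P - f z) * (Q - g z) + (P - f z) * g z + f z * (Q - g z) by ring.
apply: le_trans (cmD _ _) _; apply: le_trans (lerD (cmD _ _) (lexx _)) _; rewrite !cmM.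
have a1 : cm (P - f z) * cm (Q - g z) <= e1 * 1 by rewrite ler_pM ?cm_ge0//; lra.
have a2 : cm (P - f z) * cm (g z) <= e1 * `|B|.
  by rewrite ler_pM ?cm_ge0//; exact: le_trans (gB z Xz) (ler_norm _).
have a3 : cm (f z) * cm (Q - g z) <= `|A| * e1.
  by rewrite ler_pM ?cm_ge0//; exact: le_trans (fA z Xz) (ler_norm _).
lra.
Qed.

Lemma papZ X psi c f : pap X psi f -> pap X psi (fun z => c * f z).
Proof.
move=> pf e e0; have c0 : 0 < cm c + 1 by have := cm_ge0 c; lra.
have [p hp] := pf _ (divr_gt0 e0 c0); exists (c *: p) => z Xz.
rewrite hornerZ -mulrBr cmM; apply: (@le_trans _ _ ((cm c + 1) * (e / (cm c + 1)))).
  by rewrite ler_pM ?cm_ge0//; [lra|exact: hp].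
by rewrite mulrC divfK// gt_eqF.
Qed.

Lemma pap_lim X psi f : (forall e : R, 0 < e -> exists2 g, pap X psi g & forall z, X z -> cm (g z - f z) <= e) ->
  pap X psi f.
Proof.
move=> h e e0; have e2 : 0 < e / 2 by lra.
have [g pg gf] := h _ e2; have [p hp] := pg _ e2; exists p => z Xz.
have := cm_tri (g z) p.[psi z] (f z); have := hp z Xz; have := gf z Xz; lra.
Qed.

Lemma pap_sum X psi (I : Type) (r : seq I) (F : I -> C -> C) :
  (forall i, pap X psi (F i)) -> pap X psi (fun z => \sum_(i <- r) F i z).
Proof.
move=> h; elim: r => [|i r ih].
  by apply: pap_ext (pap_cst X psi 0) => z _; rewrite big_nil.
by apply: pap_ext (papD (h i) ih) => z _; rewrite big_cons.
Qed.

Lemma pap_geom X psi u (th : R) : 0 <= th -> th < 1 -> (forall z, X z -> cm (u z) <= th) ->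
  pap X psi u -> pap X psi (fun z => (1 - u z)^-1).
Proof.
move=> th0 th1 uth pu.
have pw n : pap X psi (fun z => u z ^+ n).
  elim: n => [|n ih]; first exact: pap_cst.
  apply: (@pap_ext _ _ (fun z => u z * u z ^+ n)) => [z _|]; first by rewrite exprS.
  apply: (papM uth _ pu ih) => z Xz; rewrite cmX; apply: lerXn2r (uth z Xz) => //.
  by rewrite nnegrE cm_ge0.
apply: pap_lim => e e0.
have [N hN] : exists N, th ^+ N <= e * (1 - th).
  have e1 : 0 < e * (1 - th) by rewrite mulr_gt0//; lra.
  have [th00|thn0] := eqVneq th 0; first by exists 1; rewrite expr1 {1}th00 ltW.
  have thp : 0 < th by rewrite lt_neqAle eq_sym thn0.
  have q0 : 0 < th^-1 - 1 by rewrite subr_gt0 invf_gt1.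
  have [N hN] := archi_nat ((e * (1 - th))^-1 / (th^-1 - 1)); exists N.
  have bern n : 1 + n%:R * (th^-1 - 1) <= th^-1 ^+ n.
    elim: n => [|n ih]; first by rewrite mul0r addr0 expr0.
    rewrite exprS -natr1; apply: (@le_trans _ _ (th^-1 * (1 + n%:R * (th^-1 - 1)))); last first.
      by rewrite ler_pM2l// invr_gt0.
    have : 0 <= n%:R * ((th^-1 - 1) * (th^-1 - 1)) :> R by rewrite mulr_ge0// mulr_ge0 ?(ltW q0).
    lra.
  rewrite -[leLHS]invrK -exprVn -[leRHS]invrK lef_pV2 ?posrE ?invr_gt0 ?exprn_gt0 ?invr_gt0//.
  apply: le_trans (bern N).
  have := hN N (leqnn N); rewrite ltr_pdivrMr//; lra.
exists (fun z => \sum_(i < N) u z ^+ i).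
  by apply: pap_ext (pap_sum (index_enum 'I_N) (fun i : 'I_N => pw i)) => z _.
move=> z Xz; have uz := uth z Xz.
have u1 : 1 - th <= cm (1 - u z) by have := cm_rev 1 (u z); rewrite cm1; lra.
have u0 : 1 - u z != 0 by rewrite -cm_gt0; lra.
have -> : \sum_(i < N) u z ^+ i - (1 - u z)^-1 = - (u z ^+ N / (1 - u z)).
  have := subrX1 (u z) N; set T := \sum_(_ < _) _ => hT.
  have -> : T = (1 - u z ^+ N) / (1 - u z).
    by apply: (mulIf u0); rewrite divfK// -opprB -[in RHS](opprB _ 1) hT; ring.
  by rewrite mulrBl mul1r addrAC subrr sub0r.
rewrite cmN cmf ler_pdivrMr ?cm_gt0// cmX.
apply: (@le_trans _ _ (th ^+ N)); first by apply: lerXn2r uz; rewrite nnegrE ?cm_ge0.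
apply: (le_trans hN); rewrite ler_wpM2l ?(ltW e0)//; lra.
Qed.

(** Runge's pole pushing along the chain: [1 / (z - b)] is [1 / (z - a)] times a geometric series in
    [(b - a) / (z - a)], and a pole far away is expanded in powers of [z / a]. *)
Lemma Out_pap X a : ccompact X -> Out X a -> pap X id (fun z => (z - a)^-1).
Proof.
move=> cX; elim=> [{}a h|{}a b r r0 Oa ih h ba].
  (* Compactness turns the strict inequality into a uniform margin, hence the ratio of the series
     into a constant below 1. *)
  have [N hN] : exists N, forall y, X y -> forall n, (N <= n)%N -> cm y <= cm a - n.+1%:R^-1.
    apply: cX => x Xx; have := h x Xx; rewrite -subr_gt0 => d0.
    exists ((cm a - cm x) / 2); first by rewrite divr_gt0.
    have [N hN] := archi_inv (divr_gt0 d0 (ltr0n R 2)); exists N => y Xy yx n /hN.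
    by have := cm_rev y x; set t := _^-1; lra.
  have [[x Xx]|nX] := pselect (exists x, X x); last first.
    by move=> e e0; exists 0 => z Xz; exfalso; apply: nX; exists z.
  have a0 : 0 < cm a by apply: le_lt_trans (h x Xx); exact: cm_ge0.
  pose d : R := N.+1%:R^-1; have d0 : 0 < d by rewrite invr_gt0 ltr0n.
  have hd y : X y -> cm y <= cm a - d by move=> Xy; exact: (hN y Xy N (leqnn N)).
  have an0 : a != 0 by rewrite -cm_gt0.
  apply: (@pap_ext _ _ (fun z => - a^-1 * (1 - z * a^-1)^-1)).
    move=> z /h za; have z0 : z - a != 0.
      by rewrite subr_eq0; apply: contraTneq za => ->; rewrite ltxx.
    by field; rewrite z0 an0 -(opprB z) oppr_eq0 z0.
  apply: papZ; apply: (@pap_geom _ _ _ ((cm a - d) / cm a)).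
  - by rewrite divr_ge0 ?(ltW a0)//; apply: le_trans (hd x Xx); exact: cm_ge0.
  - by rewrite ltr_pdivrMr// mul1r; lra.
  - by move=> z /hd zd; rewrite cmf ler_pM2r ?invr_gt0.
  - apply: (@pap_ext _ _ (fun z => a^-1 * z)) => [z _|]; first by rewrite mulrC.
    apply: papZ; apply: pap_ext (pap_poly X id 'X) => z _; exact: hornerX.
have h0 z : X z -> z - a != 0 by move=> /h za; rewrite -cm_gt0; exact: lt_le_trans za.
have ub z : X z -> cm ((b - a) * (z - a)^-1) <= cm (b - a) / r.
  move=> Xz; rewrite cmf ler_wpM2l ?cm_ge0// lef_pV2 ?posrE ?cm_gt0 ?h0//; exact: h.
have th1 : cm (b - a) / r < 1 by rewrite ltr_pdivrMr// mul1r.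
apply: (@pap_ext _ _ (fun z => (z - a)^-1 * (1 - (b - a) * (z - a)^-1)^-1)).
  move=> z Xz; have z0 := h0 z Xz.
  by rewrite -invfM; congr (_^-1); field; rewrite z0.
apply: (@papM _ _ _ _ r^-1 (1 - cm (b - a) / r)^-1) => //.
- by move=> z Xz; rewrite cmV lef_pV2 ?posrE ?cm_gt0 ?h0//; exact: h.
- move=> z Xz; have := ub z Xz; have := cm_rev 1 ((b - a) * (z - a)^-1); rewrite cm1 => h1 h2.
  have h3 : 1 - cm (b - a) / r <= cm (1 - (b - a) * (z - a)^-1) by lra.
  by rewrite cmV lef_pV2 ?posrE//; lra.
- apply: (pap_geom _ th1 ub); first by rewrite divr_ge0 ?cm_ge0 ?(ltW r0).
  exact: papZ.
Qed.

Lemma pap_image K psi g : pap (cimage psi K) id g -> pap K psi (fun z => g (psi z)).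
Proof. by move=> h e /h[p hp]; exists p => z Kz; apply: hp; exists z. Qed.

Lemma cont_onV X f : cont_on X f -> (forall x, X x -> f x != 0) -> cont_on X (fun z => (f z)^-1).
Proof.
move=> fc f0 x Xx e e0; have a0 : 0 < cm (f x) by rewrite cm_gt0 f0.
set a := cm (f x) in a0.
have [d d0 hd] := fc x Xx _ (divr_gt0 a0 (ltr0n R 2)).
have e1 : 0 < e * a * a / 2 by rewrite divr_gt0// !mulr_gt0.
have [d' d0' hd'] := fc x Xx _ e1.
exists (Num.min d d'); rewrite ?lt_min ?d0// => w Xw.
rewrite !lt_min => /andP[/(hd _ Xw) b /(hd' _ Xw) c].
have fw : a / 2 < cm (f w).
  by have := cm_rev (f x) (f w); rewrite (cmC (f x)); rewrite -/a; lra.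
have -> : (f w)^-1 - (f x)^-1 = (f x - f w) / (f w * f x).
  by field; rewrite !f0.
rewrite cmf cmM cmC -/a ltr_pdivrMr ?mulr_gt0//; last lra.
apply: (lt_trans c).
rewrite -mulrA -mulrA ltr_pM2l// (_ : a * (a / 2) = (a / 2) * a); last by ring.
by rewrite ltr_pM2r.
Qed.

(** Since [R[i]] is algebraically closed, the polynomial splits into linear factors; its zeros lie
    outside the full set [K], so [Out_sqrt] treats each factor. *)
Lemma poly_has_sqrt K p : full K -> (forall z, K z -> p.[z] != 0) -> has_sqrt K (horner p).
Proof.
move=> fK p0; have [r pr] := closed_field_poly_normal p.
have rK b : b \in r -> ~ K b.
  move=> br Kb; have := p0 b Kb; rewrite pr hornerZ horner_prod.
  by rewrite (big_rem b)//= hornerXsubC subrr mul0r mulr0 eqxx.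
apply: (@has_sqrt_ext _ _ (fun z => lead_coef p * \prod_(b <- r) (z - b))).
  move=> z _; rewrite [in RHS]pr hornerZ horner_prod; congr (_ * _).
  by apply: eq_bigr => b _; rewrite hornerXsubC.
apply: has_sqrtM; first exact: has_sqrt_cst.
elim: r rK {pr} => [|b r ih] rK.
  by apply: has_sqrt_ext (has_sqrt_cst K 1) => z _; rewrite big_nil.
apply: (@has_sqrt_ext _ _ (fun z => (z - b) * \prod_(b <- r) (z - b))).
  by move=> z _; rewrite big_cons.
apply: has_sqrtM; first by apply: Out_sqrt; apply: fK; apply: rK; rewrite mem_head.
by apply: ih => c cr; apply: rK; rewrite inE cr orbT.
Qed.

Lemma inverse_cont K psi x : ccompact K -> cont_on K psi ->
  (forall y z, K y -> K z -> psi y = psi z -> y = z) -> K x -> forall e : R, 0 < e ->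
  exists2 d : R, 0 < d & forall y, K y -> cm (psi y - psi x) < d -> cm (y - x) < e.
Proof.
move=> cK pc inj Kx e e0.
have [|N hN] := cK (fun n y => cm (psi y - psi x) < n.+1%:R^-1 -> cm (y - x) < e).
  move=> y Ky; have [->|yx] := eqVneq y x.
    by exists e => //; exists 0 => z _ zx n _ _.
  have d0 : 0 < cm (psi y - psi x).
    by rewrite cm_gt0 subr_eq0; apply: contra_neq yx; exact: inj.
  have d2 := divr_gt0 d0 (ltr0n R 2).
  have [d dp hd] := pc y Ky _ d2; exists d => //.
  have [N hN] := archi_inv d2; exists N => z Kz /(hd _ Kz) zy n /hN.
  by set t := _^-1 => h1 h2; have := cm_tri (psi z) (psi y) (psi x); rewrite (cmC (psi y) (psi z)); lra.
by exists N.+1%:R^-1; [rewrite invr_gt0 ltr0n|move=> y Ky; exact: hN].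
Qed.

(** A polynomial close to [psi - w] has no zero on [K], hence a square root there; the quotient of
    the two is within 1 of 1 and has one too. The continuous inverse of [psi] carries the resulting
    root to the image, where [sqrt_Out] applies. *)
Lemma full_image K psi : ccompact K -> full K -> cont_on K psi ->
  (forall y z, K y -> K z -> psi y = psi z -> y = z) -> pap K id psi -> full (cimage psi K).
Proof.
move=> cK fK pc inj pp w Iw.
have nz x : K x -> psi x - w != 0.
  by move=> Kx; rewrite subr_eq0; apply/eqP => e; apply: Iw; exists x.
have [d d0 hd] : exists2 d : R, 0 < d & forall x, K x -> d <= cm (psi x - w).
  apply: (@ccompact_away _ _ (fun x => psi x - w)) => //.
    by apply: cont_onB => //; exact: cont_on_cst.
  by move=> x /nz/eqP.
have [p0 hp0] := pp _ (divr_gt0 d0 (ltr0n R 3)).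
pose p := p0 - w%:P.
have hp x : K x -> cm (p.[x] - (psi x - w)) <= d / 3.
  by move=> /hp0; rewrite /p hornerD hornerN hornerC opprB addrA subrK.
have pb x : K x -> 2 * (d / 3) <= cm p.[x].
  move=> Kx; have := hp x Kx; have := hd x Kx; have := cm_rev (psi x - w) p.[x].
  by rewrite (cmC _ p.[x]); lra.
have pn0 x : K x -> p.[x] != 0 by move=> /pb h; rewrite -cm_gt0; lra.
have [s sc sE] : has_sqrt K (fun x => psi x - w).
  apply: (@has_sqrt_ext _ _ (fun x => p.[x] * ((psi x - w) / p.[x]))).
    by move=> x Kx; rewrite mulrC divfK// pn0.
  apply: has_sqrtM; first exact: poly_has_sqrt.
  apply: has_sqrt_near1.
    apply: cont_onM; first by apply: cont_onB => //; exact: cont_on_cst.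
    apply: cont_onV => //; apply: ccont_cont_on => x _; apply: cdiff_cont; exact: cdiff_poly.
  move=> x Kx; have -> : (psi x - w) / p.[x] - 1 = (psi x - w - p.[x]) / p.[x].
    by rewrite [RHS]mulrBl mulfV// pn0.
  rewrite cmf ltr_pdivrMr ?cm_gt0 ?pn0// mul1r.
  by have := hp x Kx; have := pb x Kx; rewrite cmC; lra.
apply: sqrt_Out => //; first exact: ccompact_image.
pose inv v := xget 0 [set x | K x /\ psi x = v]%classic.
have invP x : K x -> inv (psi x) = x.
  move=> Kx; have [|h1 h2] := @xgetPex _ 0 [set y | K y /\ psi y = psi x]%classic.
    by exists x.
  by apply: inj.
exists (fun v => s (inv v)).
  move=> _ [x Kx ->] e e0; rewrite invP//.
  have [d1 d10 hd1] := sc x Kx e e0.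
  have [d2 d20 hd2] := inverse_cont cK pc inj Kx d10.
  by exists d2 => // _ [y Ky ->] yx; rewrite invP//; apply: hd1 => //; exact: hd2.
by move=> _ [x Kx ->]; rewrite invP// sE.
Qed.

End Approximation.

(** * Runge's theorem *)

Section Runge.
Variable R : realType.
Local Notation C := R[i].
Local Notation Re := complex.Re.
Local Notation Im := complex.Im.
Implicit Types (x y z w a b c v : C) (U X Y K D : C -> Prop) (F f g psi t : C -> C) (p q : {poly C}).

Lemma inSq_ccompact c (s : R) : 0 < s -> ccompact (inSq c s).
Proof.
move=> s0 P hP.
apply: (@cousin _ (fun c s => exists N, forall y, inSq c s y -> forall n, (N <= n)%N -> P n y)) => //.
  move=> c' s' s'0 [N1 h1] [N2 h2] [N3 h3] [N4 h4].
  exists (maxn (maxn N1 N2) (maxn N3 N4)) => w [a1 a2 a3 a4] n.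
  rewrite !geq_max => /andP[/andP[n1 n2] /andP[n3 n4]].
  have [u|u] := leP (Re w) (Re c' + s' / 2); have [v|v] := leP (Im w) (Im c' + s' / 2).
  - by apply: h1 => //; split; lra.
  - by apply: h3 => //; split; rewrite ?(Re_pt, Im_pt); lra.
  - by apply: h2 => //; split; rewrite ?(Re_pt, Im_pt); lra.
  - by apply: h4 => //; split; rewrite ?(Re_pt, Im_pt); lra.
move=> x /hP [r r0 [N hN]]; exists (r / 2); first by rewrite divr_gt0.
move=> c' s' s'0 s'r xin sub; exists N => y yin; apply: hN; first exact: sub.
by have := inSq_cm yin xin; lra.
Qed.

Lemma sqsum_grid F n m c (h : R) : sqsum F (n + m) c (2 ^+ m * h) =
  \sum_(i < 2 ^ m) \sum_(j < 2 ^ m) sqsum F n (pt c (i%:R * h) (j%:R * h)) h.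
Proof.
elim: m c => [|m ih] c.
  by rewrite expr0 mul1r addn0 !big_ord1 !mul0r pt00.
rewrite addnS sqsum_split.
have -> : 2 ^+ m.+1 * h / 2 = 2 ^+ m * h by rewrite exprS; field.
have e (k : nat) : (2 ^ m + k)%:R * h = 2 ^+ m * h + k%:R * h by rewrite natrD natrX mulrDl.
have col (r : R) : \sum_(j < 2 ^ m + 2 ^ m) sqsum F n (pt c r (j%:R * h)) h =
    \sum_(j < 2 ^ m) sqsum F n (pt c r (j%:R * h)) h +
    \sum_(j < 2 ^ m) sqsum F n (pt c r (2 ^+ m * h + j%:R * h)) h.
  by rewrite big_split_ord/=; congr (_ + _); apply: eq_bigr => j _; rewrite e.
rewrite !ih expnS mul2n -addnn big_split_ord/=.
have re (x1 x2 x3 x4 : C) : x1 + x2 + x3 + x4 = (x1 + x3) + (x2 + x4) by ring.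
rewrite re; congr (_ + _); rewrite -big_split/=; apply: eq_bigr => i _; rewrite col.
  by congr (_ + _); apply: eq_bigr => j _; rewrite ptpt add0r.
by rewrite e; congr (_ + _); apply: eq_bigr => j _; rewrite ptpt ?add0r.
Qed.

Lemma fin_delta (I : finType) (P : I -> R -> Prop) :
  (forall i, exists2 d : R, 0 < d & P i d) -> (forall i (d d' : R), d' <= d -> P i d -> P i d') ->
  exists2 d : R, 0 < d & forall i, P i d.
Proof.
move=> h mono.
suff [d d0 hd] : exists2 d : R, 0 < d & forall i, i \in enum I -> P i d.
  by exists d => // i; apply: hd; rewrite mem_enum.
elim: (enum I) => [|i r [d d0 hd]]; first by exists 1.
have [d' d'0 hd'] := h i; exists (Num.min d d'); first by rewrite lt_min d0.
move=> j; rewrite inE => /orP[/eqP->|jr]; first by apply: mono hd'; rewrite ge_min lexx orbT.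
by apply: mono (hd j jr); rewrite ge_min lexx.
Qed.

Section Edge.
Variables (K D : C -> Prop) (psi g : C -> C) (a b : C).
Hypotheses (cD : ccompact D) (mD : midconvex D) (Da : D a) (Db : D b).
Hypotheses (gc : forall w, D w -> ccont g w) (pc : forall w, D w -> ccont psi w).

Let k z w := g w / (psi w - psi z).

Lemma edge_pap n : (forall w, D w -> pap K psi (fun z => (psi w - psi z)^-1)) ->
  pap K psi (fun z => midsum (k z) n a b).
Proof.
move=> hp; elim: n a b Da Db => [|n ih] a' b' Da' Db' /=.
  apply: (@pap_ext _ _ _ (fun z => (b' - a') * g (mid a' b') * (psi (mid a' b') - psi z)^-1)).
    by move=> z _; rewrite /k; ring.
  by apply: papZ; apply: hp; exact: mD.
by apply: papD; apply: ih => //; exact: mD.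
Qed.

(** Uniform in [n] because [midsum_bound] sees only the integrand, whose variation is controlled by
    [cm (psi y - psi x)] as long as [psi x] keeps its distance from [psi] on [D]. *)
Lemma edge_equicont x : ccont psi x -> (forall w, D w -> psi w <> psi x) -> forall e : R, 0 < e ->
  exists2 d : R, 0 < d & forall y, cm (y - x) < d -> forall n, cm (midsum (k y) n a b - midsum (k x) n a b) <= e.
Proof.
move=> px hx e e0.
have [G [G0 hG]] := ccompact_bounded_fun cD (ccont_cont_on gc).
have [d d0 hd] : exists2 d : R, 0 < d & forall w, D w -> d <= cm (psi w - psi x).
  apply: (@ccompact_away _ _ (fun w => psi w - psi x)) => //.
    by apply: cont_onB; [exact: ccont_cont_on|exact: cont_on_cst].
  by move=> w /hx ne /eqP; rewrite subr_eq0 => /eqP.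
pose l := cm (b - a) + 1; have l0 : 0 < l by have := cm_ge0 (b - a); rewrite /l; lra.
have e1 : 0 < Num.min (d / 2) (e * d ^+ 2 / (2 * G * l)).
  rewrite lt_min; apply/andP; split; apply: divr_gt0 => //; rewrite !mulr_gt0//.
have [r r0 hr] := px _ e1; exists r => // y /hr; rewrite lt_min => /andP[y1 y2] n.
rewrite -midsumB; apply: le_trans (midsum_bound _ mD Da Db _) (_ : G * (2 * cm (psi y - psi x) / d ^+ 2) * cm (b - a) <= e).
  move=> w Dw; have h1 := hd w Dw.
  have h2 : d / 2 <= cm (psi w - psi y).
    by have := cm_tri (psi y) (psi w) (psi x); lra.
  have n1 : psi w - psi x != 0 by rewrite -cm_gt0; lra.
  have n2 : psi w - psi y != 0 by rewrite -cm_gt0; lra.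
  have -> : k y w - k x w = g w * ((psi y - psi x) / (psi w - psi y) / (psi w - psi x)).
    by rewrite /k; field; rewrite n1 n2.
  rewrite cmM !cmf; apply: ler_pM; rewrite ?cm_ge0 ?hG ?divr_ge0 ?cm_ge0//.
  have -> : 2 * cm (psi y - psi x) / d ^+ 2 = cm (psi y - psi x) / (d / 2) / d.
    by field; rewrite gt_eqF.
  apply: ler_pM; rewrite ?invr_ge0 ?divr_ge0 ?cm_ge0//; last by rewrite lef_pV2 ?posrE ?cm_gt0.
  by rewrite ler_wpM2l ?cm_ge0// lef_pV2 ?posrE ?cm_gt0//; lra.
move: y2; rewrite ltr_pdivlMr ?mulr_gt0// => y2.
have : cm (psi y - psi x) * (2 * G * cm (b - a)) <= e * d ^+ 2.
  apply: le_trans (ltW y2); rewrite ler_wpM2l ?cm_ge0// ler_pM2l ?mulr_gt0//.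
  by rewrite /l; lra.
rewrite -ler_pdivrMr ?exprn_gt0// => h; apply: le_trans h.
by rewrite le_eqVlt; apply/orP; left; apply/eqP; field; rewrite gt_eqF.
Qed.

End Edge.

(** The zero of [psi w - psi z] at [z] is simple, so both kernels have the same principal part
    there. Their difference is the bounded integrand handed to Goursat's lemma. *)
Lemma kernel_locbounded U psi t z : copen U -> hol_on U psi -> hol_on U t -> U z -> dv psi z <> 0 ->
  exists2 r : R, 0 < r & exists B : R, forall w, cm (w - z) < r ->
    cm (t w * dv psi w / (psi w - psi z) - t z / (w - z)) <= B.
Proof.
move=> oU hpsi ht Uz /eqP d0.
have [r1 r10 [K K0 hK]] := local_quad oU hpsi Uz.
have [r2 r20 [L hL]] := cdiff_loclip (cdiffM (ht z Uz) (dv_hol oU hpsi Uz)).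
pose D := cm (dv psi z); have D0 : 0 < D by rewrite /D cm_gt0.
pose r := Num.min (Num.min r1 r2) (D / (2 * K)).
have r0 : 0 < r by rewrite !lt_min r10 r20 divr_gt0// mulr_gt0.
exists r => //; exists ((`|L| + cm (t z) * K) * 2 / D) => w.
rewrite !lt_min => /andP[/andP[w1 w2]]; rewrite ltr_pdivlMr ?mulr_gt0// => w3.
have B0 : 0 <= (`|L| + cm (t z) * K) * 2 / D.
  by rewrite divr_ge0 ?(ltW D0)// mulr_ge0// addr_ge0// mulr_ge0 ?cm_ge0 ?(ltW K0).
have [->|wz] := eqVneq w z; first by rewrite !subrr !invr0 !mulr0 subrr cm0.
have c0 : 0 < cm (w - z) by rewrite cm_gt0 subr_eq0.
have zz : cm (z - z) < r1 by rewrite subrr cm0.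
have [_ q] := hK z w zz w1; have l := hL w w2.
have low : D / 2 * cm (w - z) <= cm (psi w - psi z).
  have := cm_rev (dv psi z * (w - z)) (psi w - psi z); rewrite (cmC (dv psi z * _)) cmM -/D => h.
  have : K * cm (w - z) ^+ 2 <= D / 2 * cm (w - z).
    by rewrite expr2 mulrA ler_pM2r//; lra.
  lra.
have p0 : 0 < cm (psi w - psi z) by apply: lt_le_trans low; rewrite mulr_gt0// divr_gt0.
have pn : psi w - psi z != 0 by rewrite -cm_gt0.
have wn : w - z != 0 by rewrite subr_eq0.
set A := t w * dv psi w in l *.
have -> : A / (psi w - psi z) - t z / (w - z) =
   ((A - t z * dv psi z) * (w - z) - t z * (psi w - psi z - dv psi z * (w - z))) /
   ((psi w - psi z) * (w - z)).
  by field; rewrite pn wn.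
rewrite cmf ler_pdivrMr; last by rewrite cmM mulr_gt0.
apply: (@le_trans _ _ ((`|L| + cm (t z) * K) * cm (w - z) ^+ 2)).
  apply: le_trans (cmB _ _) _; rewrite [leRHS]mulrDl lerD//.
    rewrite cmM expr2 mulrA ler_wpM2r ?cm_ge0//; apply: (le_trans l).
    by rewrite ler_wpM2r ?cm_ge0// ler_norm.
  by rewrite cmM -mulrA ler_wpM2l ?cm_ge0.
have h5 : cm (w - z) <= 2 / D * cm (psi w - psi z) by rewrite mulrAC ler_pdivlMr//; lra.
have -> : (`|L| + cm (t z) * K) * 2 / D * cm ((psi w - psi z) * (w - z)) =
    (`|L| + cm (t z) * K) * (2 / D * cm (psi w - psi z) * cm (w - z)) by rewrite cmM; ring.
rewrite ler_wpM2l ?addr_ge0 ?mulr_ge0 ?cm_ge0 ?(ltW K0)//.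
by rewrite expr2 ler_pM2r.
Qed.

End Runge.

(** * Approximation by polynomials in an injective holomorphic map *)

Section RungeTheorem.
Variable R : realType.
Local Notation C := R[i].
Local Notation Re := complex.Re.
Local Notation Im := complex.Im.
Implicit Types (x y z w a b c v : C) (F f g : C -> C).
Variables (U K : C -> Prop) (psi t : C -> C).
Hypotheses (oU : copen U) (cK : ccompact K) (KU : forall z, K z -> U z).
Hypotheses (hpsi : hol_on U psi) (ht : hol_on U t).
Hypothesis inj : forall y z, U y -> U z -> psi y = psi z -> y = z.
Hypothesis hpap : forall w, U w -> ~ K w -> pap K psi (fun z => (psi w - psi z)^-1).

(** Substituting [psi] in Cauchy's formula for [t] composed with the inverse of [psi] gives the
    kernel [g w / (psi w - psi z)], which depends on [z] through [psi z] only. *)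
Let g w := t w * dv psi w.
Let k z w := g w / (psi w - psi z).

Let hg : hol_on U g.
Proof. by move=> z Uz; apply: cdiffM; [exact: ht|exact: (dv_hol oU hpsi)]. Qed.

(* Equicontinuity transfers the approximation at nearby points where the
   derivative of [psi] does not vanish to all points of [K]. *)
Let good (r : nat -> C -> C) := (forall n, pap K psi (r n)) /\
  forall x, K x -> forall e : R, 0 < e -> exists2 d : R, 0 < d &
    forall y, cm (y - x) < d -> forall n, cm (r n y - r n x) <= e.

Let good_ext r r' : (forall n z, r n z = r' n z) -> good r -> good r'.
Proof.
move=> rr [h1 h2]; split=> [n|x Kx e e0]; first by apply: pap_ext (h1 n) => z _.
by have [d d0 hd] := h2 x Kx e e0; exists d => // y yd n; rewrite -!rr; exact: hd.
Qed.

Let good0 : good (fun _ _ => 0).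
Proof.
split=> [n|x Kx e e0]; first exact: pap_cst.
by exists 1 => // y _ n; rewrite subrr cm0 ltW.
Qed.

Let goodD r r' : good r -> good r' -> good (fun n z => r n z + r' n z).
Proof.
move=> [a1 a2] [b1 b2]; split=> [n|x Kx e e0]; first exact: papD.
have e2 : 0 < e / 2 by lra.
have [d d0 hd] := a2 x Kx _ e2; have [d' d'0 hd'] := b2 x Kx _ e2.
exists (Num.min d d'); rewrite ?lt_min ?d0// => y; rewrite lt_min => /andP[y1 y2] n.
rewrite opprD addrACA (le_trans (cmD _ _))//; have := hd y y1 n; have := hd' y y2 n; lra.
Qed.

Let goodZ c r : good r -> good (fun n z => c * r n z).
Proof.
move=> [a1 a2]; split=> [n|x Kx e e0]; first exact: papZ.
have c1 : 0 < cm c + 1 by have := cm_ge0 c; lra.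
have [d d0 hd] := a2 x Kx _ (divr_gt0 e0 c1); exists d => // y yd n.
rewrite -mulrBr cmM; have := hd y yd n; rewrite ler_pdivlMr// => h.
apply: le_trans h; rewrite mulrC ler_wpM2l ?cm_ge0//; lra.
Qed.

Let good_sum N (r : 'I_N -> nat -> C -> C) : (forall i, good (r i)) ->
  good (fun n z => \sum_(i < N) r i n z).
Proof.
move=> h; have : forall s : seq 'I_N, good (fun n z => \sum_(i <- s) r i n z).
  elim=> [|i s ih]; first by apply: good_ext good0 => n z; rewrite big_nil.
  by apply: good_ext (goodD (h i) ih) => n z; rewrite big_cons.
exact.
Qed.

(** The edge lies in the intersection of two squares: one is inside [U], where the integrand is
    defined, and the other misses [K], so that the denominator has no zero. *)
Let good_edge Q Q' (h : R) a b : 0 < h -> inSq Q h a -> inSq Q h b -> inSq Q' h a -> inSq Q' h b ->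
  (forall w, inSq Q h w -> U w) -> (forall w, inSq Q' h w -> ~ K w) ->
  good (fun n z => midsum (k z) n a b).
Proof.
move=> h0 a1 b1 a2 b2 QU QK.
pose D w := inSq Q h w /\ inSq Q' h w.
have cD : ccompact D.
  apply: ccompact_closedI; first exact: inSq_ccompact.
  exact: (ccompact_closed (@inSq_ccompact R Q' h h0)).
have mD : midconvex D by move=> u v [? ?] [? ?]; split; exact: midconvex_inSq.
have gc w : D w -> ccont g w by move=> [/QU Uw _]; apply: cdiff_cont; exact: hg.
have pc w : D w -> ccont psi w by move=> [/QU Uw _]; apply: cdiff_cont; exact: hpsi.
split=> [n|x Kx e e0].
  by apply: (edge_pap g mD) => // w [/QU Uw /QK Kw]; exact: hpap.
apply: (edge_equicont cD mD _ _ gc pc) => //.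
  by apply: cdiff_cont; apply: hpsi; exact: KU.
by move=> w [/QU Uw /QK Kw] pe; apply: Kw; rewrite (inj Uw (KU Kx) pe).
Qed.

Section Grid.
Variables (c0 : C) (h : R) (m N : nat).
Hypotheses (h0 : 0 < h) (eN : (2 ^ m)%N = N.+1).
Let V i j := pt c0 (i%:R * h) (j%:R * h).
Let E i j := `[< exists2 z, inSq (V i j) h z & K z >].
Let e i j : C := (E i j)%:R.
Hypothesis box : forall x, K x -> inSqS c0 (2 ^+ m * h) x.
Hypothesis EU : forall i j w, E i j -> inSq (V i j) h w -> U w.
Hypotheses (E1 : forall i, E i 0 = false) (E2 : forall i, E i N = false).
Hypotheses (E3 : forall j, E 0 j = false) (E4 : forall j, E N j = false).

Let EK i j w : ~~ E i j -> inSq (V i j) h w -> ~ K w.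
Proof. by move=> /asboolPn nE win Kw; apply: nE; exists w. Qed.

Let inV i j : [/\ inSq (V i j) h (V i j), inSq (V i j) h (V i.+1 j),
    inSq (V i j) h (V i.+1 j.+1) & inSq (V i j) h (V i j.+1)].
Proof.
have [h1 h2 h3 h4] := inSq_corners (V i j) (ltW h0).
by move: h2 h3 h4; rewrite /V !ptpt !addr0 -!natr1 !mulrDl !mul1r.
Qed.

Definition boundary_integral n z :=
  \sum_(i < N.+1) \sum_(j < N) (e i j.+1 - e i j) * midsum (k z) n (V i j.+1) (V i.+1 j.+1) -
  \sum_(j < N.+1) \sum_(i < N) (e i.+1 j - e i j) * midsum (k z) n (V i.+1 j) (V i.+1 j.+1).

Let boundary_good : good boundary_integral.
Proof.
have term (P Q : bool) i j i' j' a b : P = E i j -> Q = E i' j' ->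
   inSq (V i j) h a -> inSq (V i j) h b -> inSq (V i' j') h a -> inSq (V i' j') h b ->
   good (fun n z => (P%:R - Q%:R) * midsum (k z) n a b).
  move=> eP eQ a1 b1 a2 b2.
  have [PQ|PQ] := eqVneq P Q.
    by apply: good_ext good0 => n z; rewrite PQ subrr mul0r.
  apply: goodZ; case: P Q eP eQ PQ => -[]// eP eQ _.
    apply: (good_edge h0 a1 b1 a2 b2) => w; first by apply: EU; rewrite -eP.
    by apply: EK; rewrite -eQ.
  apply: (good_edge h0 a2 b2 a1 b1) => w; first by apply: EU; rewrite -eQ.
  by apply: EK; rewrite -eP.
have H1 : good (fun n z => \sum_(i < N.+1) \sum_(j < N) (e i j.+1 - e i j) * midsum (k z) n (V i j.+1) (V i.+1 j.+1)).
  apply: good_sum => i; apply: good_sum => j; have [a1 a2 _ _] := inV i j.+1; have [_ _ b2 b1] := inV i j.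
  exact: term a1 a2 b1 b2.
have H2 : good (fun n z => \sum_(j < N.+1) \sum_(i < N) (e i.+1 j - e i j) * midsum (k z) n (V i.+1 j) (V i.+1 j.+1)).
  apply: good_sum => j; apply: good_sum => i; have [a1 _ _ a2] := inV i.+1 j; have [_ b1 b2 _] := inV i j.
  exact: term a1 a2 b1 b2.
by apply: good_ext (goodD H1 (goodZ (-1) H2)) => n z; rewrite mulN1r.
Qed.

Let sumE (F : C -> C) n := \sum_(i < N.+1) \sum_(j < N.+1) e i j * sqsum F n (V i j) h.

Let sumE_boundary z n : sumE (k z) n = boundary_integral n z.
Proof.
rewrite /boundary_integral.
have := @boundary_sum _ e (fun i j => midsum (k z) n (V i j) (V i.+1 j)) (fun i j => midsum (k z) n (V i j) (V i j.+1)) N.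
move=> <-; last first.
- by move=> j; rewrite /e E4.
- by move=> j; rewrite /e E3.
- by move=> i; rewrite /e E2.
- by move=> i; rewrite /e E1.
apply: eq_bigr => i _; apply: eq_bigr => j _; congr (_ * _).
have ad (l : nat) : l.+1%:R * h = l%:R * h + h by rewrite -natr1 mulrDl mul1r.
rewrite /sqsum /V !ptpt !addr0 -!ad.
rewrite (midsum_anti (k z) n (pt c0 (i%:R * h) (j.+1%:R * h))).
by rewrite (midsum_anti (k z) n (pt c0 (i%:R * h) (j%:R * h)) (pt c0 (i%:R * h) (j.+1%:R * h))).
Qed.

Let inside z := inSqS c0 (2 ^+ m * h) z /\ forall i j : 'I_N.+1, ~~ E i j -> ~ inSq (V i j) h z.

(** Unmarked squares miss [z] and contribute nothing in the limit, so the marked ones carry the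
    winding sum of the big square. Its level is [n + m] because the grid arises from [m]
    bisections. *)
Let sumE_winding z : inside z ->
  tend0 (fun n => sumE (fun w => (w - z)^-1) n - kappa R (n + m)).
Proof.
move=> [zin zE].
have b0 : 0 < 2 ^+ m * h by rewrite mulr_gt0// exprn_gt0.
have T1 := tend0_shift m (sqsum_winding b0 zin).
have T2 (i j : 'I_N.+1) : tend0 (fun n => (e i j - 1) * sqsum (fun w => (w - z)^-1) n (V i j) h).
  rewrite /e; case: (boolP (E i j)) => [_|/zE nz].
    by apply: tend0_ext (@tend0_cst0 R) => n; rewrite subrr mul0r.
  apply: (@tend0Ml _ (fun=> 0 - 1) _ _ (fun=> lexx _)).
  have fd w : inSq (V i j) h w -> cdiff (fun w => (w - z)^-1) w.
    move=> win; apply: cdiffV; first by apply: cdiffB; [exact: cdiff_id|exact: cdiff_cst].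
    by rewrite subr_eq0; apply/eqP => wz; apply: nz; rewrite -wz.
  have [B [_ hB]] := Sq_bounded h0 (fun w win => cdiff_cont (fd w win)).
  by apply: (goursat (X := [::]) h0 hB) => w /fd.
have T3 : tend0 (fun n => \sum_(i < N.+1) \sum_(j < N.+1) (e i j - 1) * sqsum (fun w => (w - z)^-1) n (V i j) h).
  by apply: tend0_sum => i _; apply: tend0_sum => j _.
apply: tend0_ext (tend0D T3 T1) => n.
rewrite sqsum_grid eN /sumE addrA -big_split/=; congr (_ - _); apply: eq_bigr => i _.
by rewrite -big_split/=; apply: eq_bigr => j _; rewrite -/(V i j); ring.
Qed.

(** The difference [F] of the kernels is bounded with [z] as its only singularity, so Goursat's
    lemma applies on each marked square; what remains is [t z] times the winding sum. *)
Let boundary_limit z : inside z -> U z -> dv psi z <> 0 ->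
  tend0 (fun n => t z * kappa R (n + m) - boundary_integral n z).
Proof.
move=> zin Uz dz.
pose F w := k z w - t z * (w - z)^-1.
have T1 : tend0 (fun n => sumE F n).
  apply: tend0_sum => i _; apply: tend0_sum => j _; rewrite /e; case: (boolP (E i j)) => [Eij|_]; last first.
    by apply: tend0_ext (@tend0_cst0 R) => n; rewrite mul0r.
  apply: (@tend0Ml _ (fun=> 1) _ _ (fun=> lexx _)).
  have fd w : inSq (V i j) h w -> w != z -> cdiff F w.
    move=> /(EU Eij) Uw wz; apply: cdiffB; apply: cdiffM.
    - exact: hg.
    - apply: cdiffV; first by apply: cdiffB; [exact: hpsi|exact: cdiff_cst].
      by rewrite subr_eq0; apply: contra_neq wz; exact: inj.
    - exact: cdiff_cst.
    - apply: cdiffV; first by apply: cdiffB; [exact: cdiff_id|exact: cdiff_cst].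
      by rewrite subr_eq0.
  have [B [_ hB]] : exists B : R, 0 < B /\ forall w, inSq (V i j) h w -> cm (F w) <= B.
    apply: Sq_locbounded => // w win; have [->|wz] := eqVneq w z.
      exact: (kernel_locbounded oU hpsi ht Uz dz).
    have [r r0 hr] := ccont_bounded (cdiff_cont (fd w win wz)).
    by exists r => //; exists (cm (F w) + 1).
  by apply: (goursat (X := [:: z]) h0 hB) => w win; rewrite inE; exact: fd.
have T2 := tend0Ml (fun=> lexx (cm (t z))) (sumE_winding zin).
apply: tend0_ext (tend0N (tend0D T1 T2)) => n.
rewrite -sumE_boundary.
have -> : sumE F n = sumE (k z) n - t z * sumE (fun w => (w - z)^-1) n.
  rewrite /sumE mulr_sumr -sumrB; apply: eq_bigr => i _.
  rewrite mulr_sumr -sumrB; apply: eq_bigr => j _.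
  by rewrite /F sqsumB sqsumZ; ring.
by ring.
Qed.

Lemma grid_approx : pap K psi t.
Proof.
apply: pap_lim => eps eps0.
have [hp heq] := boundary_good.
suff [n hn] : exists n, forall y, K y -> forall n', (n <= n')%N ->
    cm (t y * kappa R (n' + m) - boundary_integral n' y) <= eps.
  exists (fun y => (kappa R (n + m))^-1 * boundary_integral n y); first exact: papZ.
  move=> y Ky; have := hn y Ky n (leqnn n).
  have k0 := kappa_neq0 R (n + m); have k4 := kappa_ge R (n + m).
  have -> : (kappa R (n + m))^-1 * boundary_integral n y - t y =
     - (t y * kappa R (n + m) - boundary_integral n y) / kappa R (n + m) by field.
  rewrite cmf cmN ler_pdivrMr; last lra.
  by move=> q; apply: (le_trans q); rewrite ler_peMr ?(ltW eps0)//; lra.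
apply: cK => x Kx; have Ux := KU Kx.
have e4 : 0 < eps / 4 by lra.
have [d1 d10 hd1] := heq x Kx _ e4.
(* Two variations of [t] by [eps / 64], multiplied by [cm (kappa R _) <= 8], cost [eps / 4], one of
   four equal errors. *)
have e64 : 0 < eps / 64 by lra.
have [d2 d20 hd2] := cdiff_cont (ht Ux) e64.
have [d3 d30 hd3] := inSqS_marg (box Kx).
(* The auxiliary point found near [x] need not lie in [K]; this radius keeps it out of the unmarked
   squares. *)
have [d4 d40 hd4] : exists2 d : R, 0 < d & forall i : 'I_N.+1 * 'I_N.+1, forall y, cm (y - x) < d ->
    ~~ E i.1 i.2 -> ~ inSq (V i.1 i.2) h y.
  apply: fin_delta => [i|i d d' dd hd y yd]; last by apply: hd; lra.
  have [Ei|nE] := boolP (E i.1 i.2); first by exists 1.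
  have xn : ~ inSq (V i.1 i.2) h x by move=> /(EK nE).
  have [d d0 hd] := ccompact_closed (@inSq_ccompact R (V i.1 i.2) h h0) xn.
  by exists d => // y yd _; exact: hd.
pose d := Num.min (Num.min d1 d2) (Num.min d3 d4).
have d0 : 0 < d by rewrite !lt_min d10 d20 d30.
have dd y : cm (y - x) < d -> [/\ cm (y - x) < d1, cm (y - x) < d2, cm (y - x) < d3 & cm (y - x) < d4].
  by rewrite !lt_min => /andP[/andP[? ?] /andP[? ?]].
have [x' [Ux' x'd dx']] := injective_dv_neq0 oU hpsi inj Ux d0.
have [x1 x2 x3 x4] := dd _ x'd.
have x'in : inside x'.
  by split; [have [] := hd3 _ x3|move=> i j; exact: (hd4 (i, j) _ x4)].
have [n hn] := boundary_limit x'in Ux' dx' e4.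
exists d => //; exists n => y Ky yd n' /hn h1; have [y1 y2 _ _] := dd _ yd.
have h2 := hd1 y y1 n'; have h3 := hd1 x' x1 n'.
have h4 : cm (t y - t x') <= eps / 32.
  by have := hd2 y y2; have := hd2 x' x2; have := cm_tri (t x) (t y) (t x'); rewrite (cmC (t x)); lra.
have h5 : cm ((t y - t x') * kappa R (n' + m)) <= eps / 32 * 8.
  by rewrite cmM ler_pM ?cm_ge0 ?kappa_le.
have -> : t y * kappa R (n' + m) - boundary_integral n' y =
   (t y - t x') * kappa R (n' + m) + (t x' * kappa R (n' + m) - boundary_integral n' x')
   + ((boundary_integral n' x' - boundary_integral n' x) - (boundary_integral n' y - boundary_integral n' x)).
  by ring.
apply: le_trans (cmD _ _) _; apply: le_trans (lerD (cmD _ _) (cmB _ _)) _.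
lra.
Qed.

End Grid.

Theorem runge : pap K psi t.
Proof.
have [d d0 hd] := ccompact_open_margin cK oU KU.
(* With [h] a quarter of the margin [d], points of one square are at most [2 * h] apart, so a square
   meeting [K] lies in [U]. *)
have [B [B0 hB]] := ccompact_bounded cK.
pose h := d / 4; have h0 : 0 < h by rewrite /h; lra.
have [n hn] := archi_nat (2 * (B + h) / h).
pose m := n.+1.
(* Half the side of the grid exceeds [B] by more than [h], so the outermost rows and columns miss
   [K]. *)
have m2 : B + h < 2 ^+ m * h / 2.
  have := hn (2 ^ m)%N _; rewrite ltr_pdivrMr// natrX.
  have nm : (n <= 2 ^ m)%N by rewrite (leq_trans (leqnSn n))// ltnW// ltn_expl.
  by move=> /(_ nm); rewrite /m; set q := 2 ^+ _ * h; lra.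
have eN : (2 ^ m)%N = (2 ^ m).-1.+1 by rewrite prednK// expn_gt0.
set L := 2 ^+ m * h / 2 in m2.
have L2 : 2 ^+ m * h = 2 * L by rewrite /L; field.
have bd x : K x -> [/\ - B <= Re x, Re x <= B, - B <= Im x & Im x <= B].
  move=> /hB xB; have := le_trans (cm_Re x) xB; have := le_trans (cm_Im x) xB.
  by rewrite !ler_norml => /andP[? ?] /andP[? ?].
have NL : (2 ^ m).-1%:R * h = 2 * L - h.
  have : (2 ^ m)%N%:R * h = 2 * L by rewrite natrX.
  by rewrite {1}eN -natr1 mulrDl mul1r; lra.
apply: (@grid_approx (pt 0 (- L) (- L)) h m (2 ^ m).-1 h0 eN).
- move=> x /bd[? ? ? ?]; rewrite L2; split; rewrite !(Re_pt, Im_pt) /=; lra.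
- move=> i j w /asboolP[z zin Kz] win; apply: (hd z w Kz).
  by have := inSq_cm win zin; rewrite /h; lra.
- move=> i; apply/asboolPn => -[z [_ _ _]]; rewrite !(Re_pt, Im_pt) /= mul0r => z4 /bd[? ? ? ?]; lra.
- move=> i; apply/asboolPn => -[z [_ _ z4 _]]; rewrite !(Re_pt, Im_pt) /= NL in z4; move=> /bd[? ? ? ?]; lra.
- move=> i; apply/asboolPn => -[z [_ z4 _ _]]; rewrite !(Re_pt, Im_pt) /= mul0r in z4; move=> /bd[? ? ? ?]; lra.
- move=> i; apply/asboolPn => -[z [z4 _ _ _]]; rewrite !(Re_pt, Im_pt) /= NL in z4; move=> /bd[? ? ? ?]; lra.
Qed.

End RungeTheorem.

(** * Consequences of Runge's theorem *)

Section RungeCorollaries.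
Variable R : realType.
Local Notation C := R[i].
Implicit Types (x y z w a b c v : C) (U X Y K : C -> Prop) (F f g psi t : C -> C) (p q : {poly C}).

Lemma hol_pap U K f : copen U -> ccompact K -> full K -> (forall z, K z -> U z) -> hol_on U f ->
  pap K id f.
Proof.
move=> oU cK fK KU hf; apply: (@runge _ U K id f) => //.
- by move=> z _; exact: cdiff_id.
- move=> w _ Kw; apply: (@pap_ext _ _ _ (fun z => -1 * (z - w)^-1)).
    by move=> z _; rewrite mulN1r -invrN opprB.
  by apply: papZ; apply: Out_pap => //; exact: fK.
Qed.

Lemma hol_cont_on U K f : (forall z, K z -> U z) -> hol_on U f -> cont_on K f.
Proof. by move=> KU hf; apply: ccont_cont_on => x /KU Ux; apply: cdiff_cont; exact: hf. Qed.

Lemma conformal_full U K phi : copen U -> ccompact K -> full K -> (forall z, K z -> U z) ->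
  hol_on U phi -> (forall y z, U y -> U z -> phi y = phi z -> y = z) -> full (cimage phi K).
Proof.
move=> oU cK fK KU hf inj; apply: full_image => //.
- exact: hol_cont_on hf.
- by move=> y z /KU Uy /KU Uz; exact: inj.
- exact: hol_pap hf.
Qed.

(** Fullness of the image places [phi w] in its unbounded complement, and pole pushing there
    approximates [1 / (phi w - phi z)] by polynomials in [phi z]. *)
Lemma conformal_pap U K phi t : copen U -> ccompact K -> full K -> (forall z, K z -> U z) ->
  hol_on U phi -> (forall y z, U y -> U z -> phi y = phi z -> y = z) -> hol_on U t ->
  pap K phi t.
Proof.
move=> oU cK fK KU hf inj ht; apply: (runge oU cK KU hf ht inj) => w Uw Kw.
have cI : ccompact (cimage phi K) by apply: ccompact_image => //; exact: hol_cont_on hf.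
have Ow : Out (cimage phi K) (phi w).
  apply: (conformal_full oU cK fK KU hf inj) => -[z Kz e]; apply: Kw.
  by rewrite (inj _ _ Uw (KU _ Kz) e).
have := pap_image (papZ (-1) (Out_pap cI Ow)).
by apply: pap_ext => z _; rewrite mulN1r -invrN opprB.
Qed.

Lemma full_ext X Y : (forall z, X z <-> Y z) -> full X -> full Y.
Proof. by move=> XY fX a Ya; apply: (@Out_mono _ _ X) => [z /XY//|]; apply: fX => /XY. Qed.

(** On disjoint neighbourhoods of the two sets, [P] and [Q] form a single holomorphic function, to
    which Runge's theorem applies on the full union. *)
Lemma poly_glue X Y P Q (e : R) : ccompact X -> ccompact Y -> (forall z, X z -> Y z -> False) ->
  full (fun z => X z \/ Y z) -> 0 < e ->
  exists P', (forall z, X z -> cm (P'.[z] - P.[z]) <= e) /\ (forall z, Y z -> cm (P'.[z] - Q.[z]) <= e).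
Proof.
move=> cX cY XY fXY e0.
have [d d0 hd] := ccompact_open_margin cX (ccompact_closed cY) (fun z Xz Yz => XY z Xz Yz).
pose d2 := d / 2; have d20 : 0 < d2 by rewrite /d2; lra.
pose N X z := exists2 x, X x & cm (z - x) < d2.
have oN Z : copen (N Z).
  move=> z [x Zx zx]; exists (d2 - cm (z - x)); first by lra.
  by move=> y yz; exists x => //; have := cm_tri z y x; lra.
have NN z : N X z -> N Y z -> False.
  move=> [x Xx zx] [y Yy zy]; apply: (hd x y Xx) => //.
  by have := cm_tri z y x; rewrite (cmC y z); rewrite /d2 in zx zy; lra.
have sN (Z : C -> Prop) z : Z z -> N Z z by move=> Zz; exists z => //; rewrite subrr cm0.
pose f z := if `[< N X z >] then P.[z] else Q.[z].
have [||||p hp] := @hol_pap (fun z => N X z \/ N Y z) (fun z => X z \/ Y z) f _ _ fXY _ _ e e0.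
- move=> z [] h.
    by have [r r0 hr] := oN X z h; exists r => // y /hr; left.
  by have [r r0 hr] := oN Y z h; exists r => // y /hr; right.
- exact: ccompactU.
- by move=> z [/sN|/sN]; [left|right].
- move=> z [] h; have [r r0 hr] := oN _ z h.
    apply: (cdiff_near r0 _ (cdiff_poly P z)) => w /hr Nw.
    by rewrite /f asboolT.
  apply: (cdiff_near r0 _ (cdiff_poly Q z)) => w /hr Nw.
  by rewrite /f asboolF// => /NN; apply.
exists p; split=> z Zz.
  by have := hp z (or_introl Zz); rewrite /f asboolT//; exact: sN.
have := hp z (or_intror Zz); rewrite /f asboolF// => /NN; apply; exact: sN.
Qed.

End RungeCorollaries.

(** * A countable dense family of polynomials *)

Section RationalPolynomials.
Variable R : realType.
Local Notation C := R[i].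

Definition gauss_rat (ab : rat * rat) : C := (ratr ab.1 +i* ratr ab.2)%C.

Lemma gauss_rat_dense (c : C) (e : R) : 0 < e -> exists ab, cm (gauss_rat ab - c) <= e.
Proof.
move=> e0.
have key (x : R) : exists q : rat, `|ratr q - x| <= e / 2.
  have [|q] := @rat_in_itvoo R (x - e / 2) (x + e / 2); first lra.
  rewrite in_itv /= => /andP[q1 q2]; exists q; rewrite ler_norml; lra.
have [a ha] := key (complex.Re c); have [b hb] := key (complex.Im c); exists (a, b).
apply: le_trans (cm_le _) _; rewrite !cE /=; lra.
Qed.

Definition rat_poly (n : nat) : {poly C} :=
  Poly [seq gauss_rat ab | ab <- odflt [::] (unpickle n : option (seq (rat * rat)))].

Lemma rat_poly_dense (p : {poly C}) (B e : R) : 0 < e -> exists j, forall z, cm z <= B ->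
  cm ((rat_poly j).[z] - p.[z]) <= e.
Proof.
move=> e0; suff [s hs] : exists s : seq (rat * rat), forall z, cm z <= B ->
    cm ((Poly [seq gauss_rat ab | ab <- s]).[z] - p.[z]) <= e.
  by exists (pickle s) => z /hs; rewrite /rat_poly pickleK.
elim/poly_ind: p e e0 => [|p c ih] e e0.
  by exists [::] => z _; rewrite horner0 subrr cm0 ltW.
have B1 : 0 < `|B| + 1 by rewrite ltr_wpDl.
have e2 : 0 < e / 2 by lra.
have [s hs] := ih _ (divr_gt0 e2 B1); have [ab hab] := gauss_rat_dense c e2.
exists (ab :: s) => z zB; rewrite /= cons_poly_def !hornerE.
set P := _.[z]; have -> : P * z + gauss_rat ab - (p.[z] * z + c) = (P - p.[z]) * z + (gauss_rat ab - c) by ring.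
apply: le_trans (cmD _ _) _; rewrite cmM.
have : cm (P - p.[z]) * cm z <= e / 2 / (`|B| + 1) * (`|B| + 1).
  rewrite ler_pM ?cm_ge0//; first exact: hs.
  by apply: (le_trans zB); have := ler_norm B; lra.
by rewrite divfK ?gt_eqF//; lra.
Qed.

(** The last component of the encoded triple is discarded; varying it makes every pair occur at
    infinitely many [n]. Invalid codes give [(0, 0)]. *)
Definition code2 (n : nat) : nat * nat :=
  let t := odflt (0, 0, 0)%N (unpickle n : option (nat * nat * nat)) in (t.1.1, t.1.2).

Lemma code2_infinite i j N : exists n, [/\ (N <= n)%N, (0 < n)%N & code2 n = (i, j)].
Proof.
have inj : injective (fun l : nat => pickle (i, j, l)).
  by move=> l l' /(pcan_inj pickleK)[].
have [n [l nl]] : exists n, (maxn N 1 <= n)%N /\ exists l : nat, n = pickle (i, j, l).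
  apply: contrapT => no.
  have lt (l : nat) : (pickle (i, j, l) < maxn N 1)%N.
    by rewrite ltnNge; apply/negP => h; apply: no; exists (pickle (i, j, l)); split=> //; exists l.
  pose F (l : 'I_(maxn N 1).+1) : 'I_(maxn N 1) := Ordinal (lt l).
  have Finj : injective F by move=> l l' /(congr1 val)/= /inj/val_inj.
  by have := leq_card F Finj; rewrite !card_ord ltnn.
exists n; move: l; rewrite geq_max => /andP[-> ->]; split=> //.
by case: nl => l ->; rewrite /code2 pickleK.
Qed.

End RationalPolynomials.

(** * The operator *)

Section Interpolation.
Variable R : realType.
Local Notation C := R[i].
Implicit Types (x y z w a u : C) (f g t : C -> C).
Variables (G : C -> Prop) (K : nat -> C -> Prop) (phi : nat -> C -> C) (idx : nat * nat -> Prop).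
Implicit Types p q : nat * nat.
Let L p := cimage (phi p.1) (K p.2).
Hypotheses (oG : copen G) (cK : forall nu, (0 < nu)%N -> ccompact (K nu)).
Hypotheses (fK : forall nu, (0 < nu)%N -> full (K nu)) (KG : forall nu, (0 < nu)%N -> forall z, K nu z -> G z).
Hypothesis (Kmono : forall nu, (0 < nu)%N -> forall z, K nu z -> K nu.+1 z).
Hypothesis (Kloc : forall x, G x -> exists2 d : R, 0 < d & exists2 nu, (0 < nu)%N &
  forall y, cm (y - x) < d -> K nu y).
Hypothesis (idx0 : forall p, idx p -> (0 < p.1)%N /\ (0 < p.2)%N).
Hypothesis (hphi : forall n, (0 < n)%N -> hol_on G (phi n)).
Hypothesis (phiG : forall n, (0 < n)%N -> forall z, G z -> G (phi n z)).
Hypothesis (phi_inj : forall n, (0 < n)%N -> forall y z, G y -> G z -> phi n y = phi n z -> y = z).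
Hypothesis (Ldisj : forall p q u, idx p -> idx q -> L p u -> L q u -> p = q).
Hypothesis (Lfin : forall nu, (0 < nu)%N -> exists s : seq (nat * nat), forall p, idx p ->
  (exists2 u, K nu u & L p u) -> p \in s).

Lemma exhaust_mono n m : (0 < n)%N -> (n <= m)%N -> forall z, K n z -> K m z.
Proof.
move=> n0 /subnK <-; elim: (m - n)%N => [//|k ih] z /ih.
by rewrite addSn; apply: Kmono; rewrite addn_gt0 n0 orbT.
Qed.

Lemma exhaust_ccompact X : ccompact X -> (forall z, X z -> G z) -> exists N, forall n, (N <= n)%N ->
  forall z, X z -> K n z.
Proof.
move=> cX XG; have [|N hN] := cX (fun n x => K n x).
  move=> x /XG/Kloc[d d0 [nu nu0 hnu]]; exists d => //; exists nu => y _ /hnu Ky n nun.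
  exact: (exhaust_mono nu0 nun).
by exists N => n Nn z Xz; exact: hN.
Qed.

Let LG p u : idx p -> L p u -> G u.
Proof. by move=> /idx0[p1 p2] [z Kz ->]; apply: phiG => //; exact: KG Kz. Qed.

Let cL p : idx p -> ccompact (L p).
Proof.
move=> /idx0[p1 p2]; apply: ccompact_image; first exact: cK.
exact: (hol_cont_on (KG p2) (hphi p1)).
Qed.

Let fL p : idx p -> full (L p).
Proof.
by move=> /idx0[p1 p2]; apply: (conformal_full oG (cK p2) (fK p2) (KG p2) (hphi p1)); exact: phi_inj.
Qed.

Let meets k p := exists2 u, K k.+1 u & L p u.
Let base k z := K k.+1 z \/ exists2 p, idx p /\ meets k p & L p z.
(** Images meeting [K k.+1] are taken in whole, so that none straddles the boundary of [base k]. An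
    image that misses [base k] may still run into the filled holes, but these are open, so its part
    outside stays compact. *)
Definition filled k := hull (base k).

Let base_ccompact k : ccompact (base k).
Proof.
have [s hs] := Lfin (ltn0Sn k).
have c2 : ccompact (fun z => exists2 p, idx p /\ meets k p & L p z).
  apply: (@ccompact_ext _ (fun z => exists2 p, p \in s /\ (idx p /\ meets k p) & L p z)).
    move=> z; split=> [[p [_ ?] ?]|[p [ip mp] Lp]]; first by exists p.
    by exists p => //; split=> //; exact: hs.
  elim: s {hs} => [|q s ih].
    by apply: ccompact_ext (@ccompact0 R) => z; split=> // -[p []].
  have [Q|Q] := pselect (idx q /\ meets k q).
    apply: ccompact_ext (ccompactU (cL Q.1) ih) => z; split.
      move=> [Lz|[p [ps ?] ?]]; first by exists q; rewrite ?mem_head.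
      by exists p; rewrite ?inE ?ps ?orbT.
    move=> [p [+ h] Lp]; rewrite inE => /orP[/eqP e|ps]; first by left; rewrite -e.
    by right; exists p.
  apply: ccompact_ext ih => z; split=> -[p [+ h] Lp].
    by move=> ps; exists p; rewrite ?inE ?ps ?orbT.
  rewrite inE => /orP[/eqP e|ps]; last by exists p.
  by exfalso; apply: Q; rewrite -e.
exact: (ccompactU (cK (ltn0Sn k)) c2).
Qed.

Lemma sub_filled k z : K k.+1 z -> filled k z.
Proof. by move=> Kz; apply: sub_hull; left. Qed.

Lemma filled_bounded k : exists2 nu, (0 < nu)%N & forall z, filled k z -> K nu z.
Proof.
have [|N hN] := exhaust_ccompact (base_ccompact (k := k)).
  by move=> z [/(KG (ltn0Sn k))//|[p [ip _] /(LG ip)]].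
exists N.+1 => //; apply: hull_sub; last exact: fK.
exact: hN.
Qed.

Lemma filled_G k z : filled k z -> G z.
Proof. by have [nu nu0 h] := filled_bounded k; move=> /h/(KG nu0). Qed.

Lemma filled_ccompact k : ccompact (filled k).
Proof.
have [nu nu0 h] := filled_bounded k.
apply: (@ccompact_ext _ (fun z => K nu z /\ filled k z)).
  by move=> z; split=> [[]//|Fz]; split=> //; exact: h.
apply: ccompact_closedI; first exact: cK.
move=> z /contrapT Oz; have [d d0 hd] := Out_open (base_ccompact (k := k)) Oz.
by exists d => // y /hd Oy; apply.
Qed.

Lemma filled_mono k m z : (k <= m)%N -> filled k z -> filled m z.
Proof.
move=> km; apply: hull_mono => {}z [Kz|[p [ip [u Ku Lu]] Lz]].
  by left; apply: exhaust_mono Kz.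
right; exists p => //; split=> //; exists u => //.
exact: exhaust_mono Ku.
Qed.

(** Either the image belongs to [base k] and nothing is left, or by disjointness it misses [base k],
    and then removing [filled k] amounts to removing an open set. *)
Let L_unfilled p k : idx p -> ccompact (fun z => L p z /\ ~ filled k z).
Proof.
move=> ip; have [mp|mp] := pselect (meets k p).
  apply: ccompact_ext (@ccompact0 R) => z; split=> // -[Lz]; apply.
  by apply: sub_hull; right; exists p.
apply: (@ccompact_ext _ (fun z => L p z /\ ~ (hull (base k) z /\ ~ base k z))).
  move=> z; split=> -[Lz h]; split=> //; last by move=> [/h].
  move=> hz; apply: h; split=> // -[Kz|[q [iq mq] Lqz]].
    by apply: mp; exists z.
  by apply: mp; rewrite (Ldisj ip iq Lz Lqz).
apply: ccompact_closedI; first exact: cL.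
move=> z /contrapT hz; have [d d0 hd] := bounded_component_open (base_ccompact (k := k)) hz.
by exists d => // y /hd; tauto.
Qed.

(** One image at a time: its part outside the set already treated is compact, so [full_union] keeps
    the union full, and [poly_glue] joins the previous polynomial to one whose composition with
    [phi q.1] approximates [t q]. Halving the error leaves room for the gluing. *)
Let step_list k (P : {poly C}) (t : nat * nat -> {poly C}) (s : seq (nat * nat)) :
  uniq s -> (forall p, p \in s -> idx p) -> forall e : R, 0 < e ->
  [/\ ccompact (fun z => filled k z \/ exists2 p, p \in s & L p z),
   full (fun z => filled k z \/ exists2 p, p \in s & L p z) &
   exists P' : {poly C}, (forall z, filled k z -> cm (P'.[z] - P.[z]) <= e) /\
    forall p, p \in s -> forall z, K p.2 z -> ~ filled k (phi p.1 z) ->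
      cm (P'.[phi p.1 z] - (t p).[z]) <= e].
Proof.
elim: s => [|q s ih] /= us si e e0.
  have E z : filled k z <-> filled k z \/ exists2 p, p \in [::] & L p z.
    by split=> [|[//|[p]]]; [left|].
  split.
  - exact: ccompact_ext E (filled_ccompact (k := k)).
  - exact: full_ext E (hull_full (X := base k)).
  - by exists P; split=> // z _; rewrite subrr cm0 ltW.
move: us => /andP[qs us].
have iq : idx q by apply: si; rewrite mem_head.
have si' p : p \in s -> idx p by move=> ps; apply: si; rewrite inE ps orbT.
have e2 : 0 < e / 2 by lra.
have [cX fX [P1 [hP1 hP1']]] := ih us si' _ e2.
pose X z := filled k z \/ exists2 p, p \in s & L p z.
have E z : X z \/ L q z <-> filled k z \/ exists2 p, p \in q :: s & L p z.
  split=> [[[h|[p ps Lp]]|Lq]|[h|[p]]].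
  - by left.
  - by right; exists p; rewrite // inE ps orbT.
  - by right; exists q; rewrite // mem_head.
  - by left; left.
  - by rewrite inE => /orP[/eqP->|ps] Lp; [right|left; right; exists p].
have qX z : L q z -> ~ filled k z -> ~ X z.
  move=> Lq nf [//|[p ps Lp]]; move: qs; rewrite (Ldisj iq (si' p ps) Lq Lp) ps//.
have cY : ccompact (fun z => L q z /\ ~ X z).
  apply: (@ccompact_ext _ (fun z => L q z /\ ~ filled k z)); last exact: L_unfilled.
  move=> z; split=> -[Lz nz]; split=> //; first exact: qX.
  by move=> fz; apply: nz; left.
have cXq : ccompact (fun z => X z \/ L q z) := ccompactU cX (cL iq).
have fXq : full (fun z => X z \/ L q z) := full_union cX (cL iq) fX (fL iq) cY.
split; [exact: ccompact_ext E cXq|exact: full_ext E fXq|].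
have [q1 q2] := idx0 iq.
have tq : hol_on G (horner (t q)) by move=> z _; exact: cdiff_poly.
have [Q hQ] := conformal_pap oG (cK q2) (fK q2) (KG q2) (hphi q1) (phi_inj q1) tq e2.
have [||P2 [h1 h2]] := @poly_glue _ X (fun z => L q z /\ ~ X z) P1 Q (e / 2) cX cY _ _ e2.
- by move=> z Xz [].
- apply: full_ext fXq => z; split=> [[Xz|Lz]|[Xz|[Lz _]]]; [by left| |by left|by right].
  by have [Xz|Xz] := pselect (X z); [left|right].
exists P2; split=> [z fz|p].
  have := hP1 z fz; have := h1 z (or_introl fz); have := cm_tri P1.[z] P2.[z] P.[z]; lra.
rewrite inE => /orP[/eqP->|ps] z Kz nf.
  have Lz : L q (phi q.1 z) by exists z.
  have := h2 _ (conj Lz (qX _ Lz nf)); have := hQ z Kz.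
  have := cm_tri Q.[phi q.1 z] P2.[phi q.1 z] (t q).[z]; lra.
have Xz : X (phi p.1 z) by right; exists p => //; exists z.
have := h1 _ Xz; have := hP1' p ps z Kz nf.
have := cm_tri P1.[phi p.1 z] P2.[phi p.1 z] (t p).[z]; lra.
Qed.

Let step k (P : {poly C}) (t : nat * nat -> {poly C}) (e : R) : 0 < e ->
  exists P' : {poly C}, (forall z, filled k z -> cm (P'.[z] - P.[z]) <= e) /\
    forall p, idx p -> (exists2 u, filled k.+1 u & L p u) ->
      forall z, K p.2 z -> ~ filled k (phi p.1 z) -> cm (P'.[phi p.1 z] - (t p).[z]) <= e.
Proof.
move=> e0; have [nu nu0 h] := filled_bounded k.+1.
have [s hs] := Lfin nu0.
pose s' := undup [seq p <- s | `[< idx p >]].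
have [|p|_ _ [P' [h1 h2]]] := @step_list k P t s' _ _ e e0.
- exact: undup_uniq.
- by rewrite mem_undup mem_filter => /andP[/asboolP].
exists P'; split=> // p ip [u fu Lu]; apply: h2; rewrite mem_undup mem_filter.
by apply/andP; split; [exact/asboolP|apply: hs => //; exists u => //; exact: h].
Qed.

(** The function is a limit of polynomials: the step at [k] changes little on [filled k] and sets
    the values on those finitely many images that meet [filled k.+1], as far as they lie outside
    [filled k]. *)
Lemma interpolation i (D : {poly C}) (t : nat * nat -> {poly C}) (e : R) : 0 < e ->
  exists g : C -> C, [/\ hol_on G g, forall z, filled i z -> cm (g z - D.[z]) <= e &
    forall k, (i <= k)%N -> forall p, idx p -> forall z, K p.2 z -> ~ filled k (phi p.1 z) ->
      cm (g (phi p.1 z) - (t p).[z]) <= e / 2 ^+ k].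
Proof.
move=> e0.
(* The errors from stage [k] on sum to [2 * ee k], half of [e / 2 ^+ k]; the relation
   [ee k = 2 * ee k.+1] telescopes that sum. *)
pose ee k : R := e / (4 * 2 ^+ k).
have p2 k : 0 < (2 : R) ^+ k by rewrite exprn_gt0.
have ee0 k : 0 < ee k by rewrite divr_gt0// mulr_gt0.
have eeS k : ee k = 2 * ee k.+1 by rewrite /ee exprS; field; rewrite gt_eqF.
have [nxt hnxt] := choice (fun kP : nat * {poly C} => step kP.1 kP.2 t (ee0 kP.1)).
pose P := fix P j := if j is j'.+1 then nxt (i + j', P j')%N else D.
have P1 j z : filled (i + j) z -> cm ((P j.+1).[z] - (P j).[z]) <= ee (i + j)%N.
  by have [h _] := hnxt ((i + j)%N, P j); exact: h.
have P2 j p z : idx p -> (exists2 u, filled (i + j).+1 u & L p u) -> K p.2 z ->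
    ~ filled (i + j) (phi p.1 z) -> cm ((P j.+1).[phi p.1 z] - (t p).[z]) <= ee (i + j)%N.
  by move=> ip mu; have [_ h] := hnxt ((i + j)%N, P j); exact: h.
have tele j l z : filled (i + j) z ->
    cm ((P (j + l)%N).[z] - (P j).[z]) <= 2 * ee (i + j)%N - 2 * ee (i + (j + l))%N.
  move=> fz; elim: l => [|l ih]; first by rewrite addn0 !subrr cm0.
  have fz' : filled (i + (j + l)) z by apply: filled_mono fz; rewrite leq_add2l leq_addr.
  have := P1 _ _ fz'; have := cm_tri (P (j + l)%N).[z] (P (j + l).+1).[z] (P j).[z].
  by rewrite !addnS; have := eeS (i + (j + l))%N; lra.
have fG z : G z -> exists j, filled (i + j) z.
  move=> /Kloc[d d0 [nu nu0 h]]; exists nu.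
  have Kz : K nu z by apply: h; rewrite subrr cm0.
  by apply: sub_filled; apply: exhaust_mono Kz => //; rewrite leqW// leq_addl.
have lim z : exists l, G z -> ccvg (fun j => (P j).[z]) l.
  have [Gz|nG] := pselect (G z); last by exists 0.
  have [j fz] := fG z Gz.
  suff [l hl] : exists l, ccvg (fun j => (P j).[z]) l by exists l.
  apply: ccauchy_cvg => d d0.
  have [N hN] := half_small e d0; exists (maxn j N) => n m.
  rewrite !geq_max => /andP[jn Nn] /andP[jm Nm].
  have bnd n' : (N <= n')%N -> (j <= n')%N -> cm ((P n').[z] - (P (maxn j N)).[z]) <= d / 2.
    move=> a b; have f2 : filled (i + maxn j N) z by apply: filled_mono fz; rewrite leq_add2l leq_maxl.
    have mn : (maxn j N <= n')%N by rewrite geq_max b a.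
    have := tele (maxn j N) (n' - maxn j N)%N z f2; rewrite (subnKC mn) => q.
    apply: (le_trans q); have := ee0 (i + n')%N.
    have : ee (i + maxn j N)%N <= e / 2 ^+ N / 4.
      rewrite /ee -mulrA -invfM ler_pM2l// (mulrC 4) lef_pV2 ?posrE ?mulr_gt0// ler_pM2r//.
      rewrite ler_weXn2l ?ler1n// (leq_trans (leq_maxr j N))// leq_addl//.
    by lra.
  have := bnd n Nn jn; have := bnd m Nm jm.
  have := cm_tri (P (maxn j N)).[z] (P n).[z] (P m).[z].
  by rewrite (cmC (P (maxn j N)).[z]); lra.
have [g hg] := choice lim.
have gP j z : filled (i + j) z -> cm (g z - (P j).[z]) <= 2 * ee (i + j)%N.
  move=> fz; apply/ler_addgt0Pl => d d0.
  have [N hN] := hg z (filled_G fz) d d0.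
  have := hN (j + N)%N (leq_addl _ _); have := tele j N z fz.
  have := cm_tri (P (j + N)%N).[z] (g z) (P j).[z]; rewrite (cmC (g z) (P (j + N)%N).[z]).
  have := ee0 (i + (j + N))%N; lra.
exists g; split.
- apply: (@hol_lim _ G (fun j => horner (P j))) => //.
    by move=> j z _; exact: cdiff_poly.
  move=> x Gx; have [d d0 [nu nu0 hnu]] := Kloc Gx; exists d => // d' d'0.
  have [N hN] := half_small e d'0; exists (maxn nu N) => y yx.
  have fy : filled (i + maxn nu N) y.
    apply: sub_filled; apply: (@exhaust_mono nu) => //; last exact: hnu.
    by rewrite leqW// (leq_trans (leq_maxl nu N))// leq_addl.
  rewrite cmC; apply: le_trans (gP _ _ fy) _; apply: le_trans (ltW hN).
  rewrite /ee (_ : 2 * (e / (4 * 2 ^+ (i + maxn nu N))) = e / (2 * 2 ^+ (i + maxn nu N))); last first.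
    by field; rewrite gt_eqF.
  rewrite ler_pM2l// lef_pV2 ?posrE ?mulr_gt0// -exprS.
  by rewrite ler_weXn2l ?ler1n// leqW// (leq_trans (leq_maxr nu N))// leq_addl.
- move=> z fz; have := @gP 0 z; rewrite addn0 => /(_ fz) q; apply: (le_trans q).
  rewrite /ee (_ : 2 * (e / (4 * 2 ^+ i)) = e / (2 * 2 ^+ i)); last by field; rewrite gt_eqF.
  by rewrite ler_pdivrMr ?mulr_gt0// ler_peMr ?(ltW e0)// -exprS exprn_ege1 ?ler1n.
- move=> k ik p ip z Kz nf.
  have Lu : L p (phi p.1 z) by exists z.
  have ex : exists m, `[< filled m (phi p.1 z) >].
    by have [j fj] := fG _ (LG ip Lu); exists (i + j)%N; exact/asboolP.
  (* The point first enters at [filled m.+1]: the step at [m] sets its value up to [ee m], and all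
     later steps together change it by at most [2 * ee m.+1]. *)
  have [[|m] /asboolP fm mmin] := ex_minnP ex.
    by exfalso; apply: nf; exact: filled_mono fm.
  have nfm : ~ filled m (phi p.1 z).
    by move=> h; have := mmin m (asboolT h); rewrite ltnn.
  have km : (k <= m)%N.
    by rewrite leqNgt; apply/negP => mk; apply: nf; exact: filled_mono fm.
  have eim : (i + (m - i) = m)%N by rewrite subnKC// (leq_trans ik).
  have := @P2 (m - i)%N p z ip; rewrite eim => /(_ _ Kz nfm) q1.
  have {}q1 := q1 (ex_intro2 _ _ _ fm Lu).
  have := @gP (m - i).+1 (phi p.1 z); rewrite addnS eim => /(_ fm) q2.
  have := cm_tri (P (m - i).+1).[phi p.1 z] (g (phi p.1 z)) (t p).[z].
  have : 2 * ee m <= e / 2 ^+ k.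
    rewrite /ee (_ : 2 * (e / (4 * 2 ^+ m)) = e / (2 * 2 ^+ m)); last by field; rewrite gt_eqF.
    rewrite ler_pM2l// lef_pV2 ?posrE ?mulr_gt0// -exprS ler_weXn2l ?ler1n//.
    exact: leqW.
  by have := eeS m; lra.
Qed.

Variables (w0 : C) (r0 : R).
Hypotheses (r0_gt0 : 0 < r0) (Gsq : forall z, inSq (pt w0 (- r0) (- r0)) (2 * r0) z -> G z).
Hypothesis Gconn : cconnected G.

Let Gw0 : G w0.
Proof. by apply: Gsq; apply: inSqSW; exact: csq_center. Qed.

Let ic n := (code2 n).1.
Let Q n : {poly C} := rat_poly R (code2 n).2.

Let hp k : R := (2 ^+ k)^-1.
Let hp_gt0 k : 0 < hp k. Proof. by rewrite invr_gt0 exprn_gt0. Qed.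
Let hpS k : hp k = 2 * hp k.+1.
Proof. by rewrite /hp exprS; field; rewrite gt_eqF// exprn_gt0. Qed.
Let hp_le k m : (k <= m)%N -> hp m <= hp k.
Proof. by move=> km; rewrite lef_pV2 ?posrE ?exprn_gt0// ler_weXn2l ?ler1n. Qed.

(* Closeness to a multiple of [Q i] gives the density of the range of the
   operator, and the values on the images [phi p.1 @` K p.2] its universality;
   [code2] makes every index [i] meet every polynomial at infinitely many [nu]. *)
Let building_blocks : exists (g : nat -> C -> C) (al : nat -> R), [/\ forall i, hol_on G (g i),
  forall i, 0 < al i, forall i z, filled i z -> cm (g i z) <= 2 * hp i,
  forall i z, filled i z -> cm (g i z - (al i)%:C%C * (Q i).[z]) <= al i * hp i &
  forall i k p z, (i <= k)%N -> idx p -> K p.2 z -> ~ filled k (phi p.1 z) ->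
    cm (g i (phi p.1 z) - (if i == ic p.2 then Q p.2 else 0).[z]) <= hp i * hp k].
Proof.
have blk i : exists ga : (C -> C) * R, [/\ hol_on G ga.1,
  0 < ga.2, forall z, filled i z -> cm (ga.1 z) <= 2 * hp i,
  forall z, filled i z -> cm (ga.1 z - (ga.2)%:C%C * (Q i).[z]) <= ga.2 * hp i &
  forall k p z, (i <= k)%N -> idx p -> K p.2 z -> ~ filled k (phi p.1 z) ->
    cm (ga.1 (phi p.1 z) - (if i == ic p.2 then Q p.2 else 0).[z]) <= hp i * hp k].
  have [B [B0 hB]] : exists B : R, 0 < B /\ forall z, filled i z -> cm (Q i).[z] <= B.
    apply: ccompact_bounded_fun; first exact: filled_ccompact.
    by apply: ccont_cont_on => z _; apply: cdiff_cont; exact: cdiff_poly.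
  (* Makes the multiple of [Q i] at most [hp i] on [filled i], so that the series converges, while
     the error [al * hp i] remains small relative to the factor [al]. *)
  pose al := hp i / (B + 1).
  have B1 : 0 < B + 1 by lra.
  have al0 : 0 < al by rewrite divr_gt0.
  have ale : al <= hp i by rewrite ler_pdivrMr// ler_peMr ?(ltW (hp_gt0 i))//; lra.
  have alB : al * B <= hp i.
    by rewrite /al mulrAC ler_pdivrMr// ler_pM2l//; lra.
  have hp1 : hp i <= 1 by rewrite -(invr1 R) lef_pV2 ?posrE ?exprn_gt0// exprn_ege1 ?ler1n.
  have e0 : 0 < al * hp i by rewrite mulr_gt0.
  have [g [g1 g2 g3]] := interpolation i ((al%:C)%C *: Q i) (fun p => if i == ic p.2 then Q p.2 else 0) e0.
  exists (g, al); split=> //= [z fz|z /g2|k p z ik ip Kz nf].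
  - have := g2 z fz; rewrite hornerZ => h1.
    have := cm_rev (g z) ((al%:C)%C * (Q i).[z]); rewrite cmM cm_real gtr0_norm// => h2.
    have h3 : al * cm (Q i).[z] <= al * B by rewrite ler_pM2l// hB.
    have h4 : al * hp i <= hp i * 1 by rewrite ler_pM ?(ltW al0) ?(ltW (hp_gt0 i)).
    lra.
  - by rewrite hornerZ.
  - apply: le_trans (g3 k ik p ip z Kz nf) _.
    by rewrite -/(hp k) ler_pM2r// ler_piMl ?(ltW (hp_gt0 i))//; lra.
have [ga hga] := choice blk.
exists (fun i => (ga i).1), (fun i => (ga i).2); split=> i; have [h1 h2 h3 h4 h5] := hga i => //.
Qed.

(** * The series defining the operator *)

Section Operator.
Variables (g : nat -> C -> C).
Hypothesis g_hol : forall i, hol_on G (g i).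
Hypothesis g_bound : forall i z, filled i z -> cm (g i z) <= 2 * hp i.
Hypothesis g_interp : forall i k p z, (i <= k)%N -> idx p -> K p.2 z -> ~ filled k (phi p.1 z) ->
    cm (g i (phi p.1 z) - (if i == ic p.2 then Q p.2 else 0).[z]) <= hp i * hp k.

Let bounded (c : nat -> C) := exists A : R, forall i, cm (c i) <= A.
Let partial (c : nat -> C) n z := \sum_(i < n) c i * g i z.
Let T (c : nat -> C) z : C := xget 0 [set l | ccvg (fun n => partial c n z) l]%classic.

(** A geometric tail in telescoped form: the bound [2 * hp k] on one term is
    [4 * hp k - 4 * hp k.+1]. *)
Let partial_tail c (A : R) m l z : (forall i, cm (c i) <= A) -> filled m z ->
  cm (partial c (m + l) z - partial c m z) <= A * (4 * hp m - 4 * hp (m + l)).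
Proof.
move=> cA fz; have A0 : 0 <= A := le_trans (cm_ge0 _) (cA 0).
elim: l => [|l ih]; first by rewrite addn0 !subrr cm0 mulr0.
rewrite addnS /partial big_ord_recr/= -/(partial c (m + l) z) addrAC.
apply: le_trans (cmD _ _) _; rewrite cmM.
have : cm (c (m + l)%N) * cm (g (m + l)%N z) <= A * (2 * hp (m + l)).
  by rewrite ler_pM ?cm_ge0// g_bound//; apply: filled_mono fz; exact: leq_addr.
have -> : A * (4 * hp m - 4 * hp (m + l).+1) = A * (4 * hp m - 4 * hp (m + l)) + A * (2 * hp (m + l)).
  by rewrite (hpS (m + l)); ring.
by rewrite /partial in ih *; lra.
Qed.

Let filled_ex z : G z -> exists m, forall n, (m <= n)%N -> filled n z.
Proof.
move=> /Kloc[d d0 [nu nu0 h]]; exists nu => n nun.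
by apply: sub_filled; apply: (@exhaust_mono nu) => //; [exact: leqW|apply: h; rewrite subrr cm0].
Qed.

Let hp_small (d A : R) : 0 < d -> exists m, forall n, (m <= n)%N -> A * hp n <= d.
Proof.
move=> d0; have [m hm] := half_small `|A| d0; exists m => n mn.
apply: le_trans (ltW hm); apply: (@le_trans _ _ (`|A| * hp n)).
  by rewrite ler_pM2r// ler_norm.
by rewrite ler_wpM2l// hp_le.
Qed.

Let T_cvg c z : bounded c -> G z -> ccvg (fun n => partial c n z) (T c z).
Proof.
move=> [A cA] Gz; rewrite /T; apply: (@xgetPex _ _ [set l | ccvg (fun n => partial c n z) l]%classic).
have A0 : 0 <= A := le_trans (cm_ge0 _) (cA 0).
apply: ccauchy_cvg => e e0; have [m hm] := filled_ex Gz.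
have [m' hm'] := @hp_small e (8 * A) e0; pose M := maxn m m'.
have bnd n : (M <= n)%N -> cm (partial c n z - partial c M z) <= e / 2.
  move=> Mn; have := partial_tail (n - M)%N cA (hm M (leq_maxl _ _)); rewrite subnKC// => h.
  have := hm' M (leq_maxr _ _); have : 0 <= A * hp n by rewrite mulr_ge0// ltW.
  by move: h; rewrite mulrBr !(mulrCA A 4); lra.
exists M => n n' /bnd h1 /bnd h2.
have := cm_tri (partial c M z) (partial c n z) (partial c n' z).
by rewrite (cmC (partial c M z)); lra.
Qed.

Let T_tail c (A : R) m z : (forall i, cm (c i) <= A) -> filled m z ->
  cm (T c z - partial c m z) <= 4 * A * hp m.
Proof.
move=> cA fz; have A0 : 0 <= A := le_trans (cm_ge0 _) (cA 0).
apply/ler_addgt0Pl => d d0.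
have [N hN] := T_cvg (ex_intro _ A cA) (filled_G fz) d0.
have := hN (m + N)%N (leq_addl _ _); have := partial_tail N cA fz.
have := cm_tri (partial c (m + N) z) (T c z) (partial c m z).
rewrite (cmC (T c z) (partial c (m + N) z)).
have : 0 <= A * hp (m + N) by rewrite mulr_ge0// ltW.
rewrite mulrBr !(mulrCA A 4); lra.
Qed.

Let T_hol c : bounded c -> hol_on G (T c).
Proof.
move=> [A cA]; apply: (@hol_lim _ G (partial c)) => //.
  move=> n z Gz; apply: (@cdiff_near _ (fun z => \sum_(i <- index_enum 'I_n) c i * g i z) _ _ 1) => //.
  elim: (index_enum 'I_n) => [|i s ih].
    by apply: cdiff_near (cdiff_cst 0 z) => [|y _]; [exact: ltr01|rewrite big_nil].
  apply: cdiff_near (cdiffD (cdiffM (cdiff_cst (c i) z) (g_hol i Gz)) ih) => [|y _]; first exact: ltr01.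
  by rewrite big_cons.
move=> x /Kloc[d d0 [nu nu0 h]]; exists d => // e e0.
have [m hm] := @hp_small e (4 * A) e0; exists (maxn nu m) => y /h Ky.
have fy : filled (maxn nu m) y.
  by apply: sub_filled; apply: (@exhaust_mono nu) => //; apply: leqW; exact: leq_maxl.
by rewrite cmC; apply: le_trans (T_tail cA fy) _; apply: hm; exact: leq_maxr.
Qed.

Let T_lin a b c d z : bounded b -> bounded c -> bounded d -> (forall i, d i = a * b i + c i) -> G z ->
  T d z = a * T b z + T c z.
Proof.
move=> bb bc bd dE Gz; apply: (ccvg_unique (T_cvg bd Gz)) => e e0.
have a1 : 0 < cm a + 1 by have := cm_ge0 a; lra.
have [N hN] := T_cvg bb Gz (divr_gt0 (divr_gt0 e0 (ltr0n R 2)) a1).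
have [N' hN'] := T_cvg bc Gz (divr_gt0 e0 (ltr0n R 2)); exists (maxn N N') => n.
rewrite geq_max => /andP[/hN h1 /hN' h2].
have -> : partial d n z = a * partial b n z + partial c n z.
  rewrite /partial mulr_sumr -big_split/=; apply: eq_bigr => i _.
  by rewrite dE mulrDl mulrA.
rewrite opprD addrACA -mulrBr; apply: le_trans (cmD _ _) _; rewrite cmM.
move: h1; rewrite ler_pdivlMr// => h1.
have : cm a * cm (partial b n z - T b z) <= cm (partial b n z - T b z) * (cm a + 1).
  by rewrite mulrC ler_wpM2l ?cm_ge0//; lra.
lra.
Qed.

Let T_delta (c : nat -> C) i : (forall k, k != i -> c k = 0) -> forall z, G z -> T c z = c i * g i z.
Proof.
move=> ci z Gz.
have bc : bounded c.
  exists (cm (c i)) => k; have [->//|ki] := eqVneq k i.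
  by rewrite ci// cm0 cm_ge0.
apply: (ccvg_unique (T_cvg bc Gz)) => e e0; exists i.+1 => n ni.
rewrite /partial (bigD1 (Ordinal ni))//= big1 ?addr0 ?subrr ?cm0 ?(ltW e0)// => k ki.
by rewrite ci ?mul0r.
Qed.

(** Indices up to [m] use the interpolation at stage [m]. A later index [i] has target 0, and [g i]
    is small there either because the point lies in [filled i], or by the interpolation at its own
    stage [i]. *)
Let T_interp c (A : R) p z m : (forall i, cm (c i) <= A) -> idx p -> K p.2 z -> (ic p.2 <= m)%N ->
  ~ filled m (phi p.1 z) -> cm (T c (phi p.1 z) - c (ic p.2) * (Q p.2).[z]) <= 4 * A * hp m.
Proof.
move=> cA ip Kz im nf; have A0 : 0 <= A := le_trans (cm_ge0 _) (cA 0).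
set u := phi p.1 z; pose tau i : C := (if i == ic p.2 then Q p.2 else 0).[z].
have Gu : G u by apply: (LG ip); exists z.
have key1 l : (l <= m.+1)%N -> cm (\sum_(i < l) c i * (g i u - tau i)) <= A * (hp m * (2 - 2 * hp l)).
  elim: l => [|l ih] lm; first by rewrite big_ord0 cm0 mulr_ge0// mulr_ge0 ?(ltW (hp_gt0 _))// /hp expr0 invr1; lra.
  rewrite big_ord_recr/=; apply: le_trans (cmD _ _) _; rewrite cmM.
  have := ih (ltnW lm).
  have : cm (c l) * cm (g l u - tau l) <= A * (hp l * hp m) by rewrite ler_pM ?cm_ge0// g_interp.
  have -> : A * (hp m * (2 - 2 * hp l.+1)) = A * (hp m * (2 - 2 * hp l)) + A * (hp l * hp m).
    by rewrite (hpS l); ring.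
  lra.
have key2 l : cm (\sum_(i < m.+1 + l) c i * (g i u - tau i)) <= A * (4 * hp m - 2 * hp (m + l)).
  elim: l => [|l ih].
    rewrite !addn0; apply: le_trans (key1 _ (leqnn _)) _; rewrite ler_wpM2l//.
    have : 0 <= hp m * hp m.+1 by rewrite mulr_ge0 ?(ltW (hp_gt0 _)).
    by rewrite (_ : 4 * hp m - 2 * hp m = hp m * 2); [lra|ring].
  rewrite addnS big_ord_recr/=; apply: le_trans (cmD _ _) _; rewrite cmM.
  have : cm (c (m.+1 + l)%N) * cm (g (m.+1 + l)%N u - tau (m.+1 + l)%N) <= A * (2 * hp (m.+1 + l)).
    rewrite ler_pM ?cm_ge0//.
    have tau0 : tau (m.+1 + l)%N = 0.
      by rewrite /tau gtn_eqF ?horner0// addSn ltnS (leq_trans im)// leq_addr.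
    have [fu|nfu] := pselect (filled (m.+1 + l) u); first by rewrite tau0 subr0 g_bound.
    apply: le_trans (g_interp (leqnn _) ip Kz nfu) _.
    rewrite ler_wpM2r ?(ltW (hp_gt0 _))//; apply: (@le_trans _ _ 1); last by lra.
    by rewrite /hp invf_le1 ?exprn_gt0// exprn_ege1// ler1n.
  have -> : A * (4 * hp m - 2 * hp (m + l.+1)) = A * (4 * hp m - 2 * hp (m + l)) + A * (2 * hp (m.+1 + l)).
    by rewrite addnS addSn (hpS (m + l)); ring.
  lra.
apply/ler_addgt0Pl => d d0.
have [N hN] := T_cvg (ex_intro _ A cA) Gu d0.
have := hN (m.+1 + N)%N (leq_addl _ _); have := key2 N.
have -> : \sum_(i < m.+1 + N) c i * (g i u - tau i) = partial c (m.+1 + N) u - c (ic p.2) * (Q p.2).[z].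
  have iN : (ic p.2 < m.+1 + N)%N by rewrite addSn ltnS (leq_trans im)// leq_addr.
  have -> : c (ic p.2) * (Q p.2).[z] = \sum_(i < m.+1 + N) c i * tau i.
    rewrite (bigD1 (Ordinal iN))//= /tau eqxx big1 ?addr0// => k ki.
    by rewrite ifN// horner0 mulr0.
  by rewrite /partial -sumrB; apply: eq_bigr => i _; rewrite mulrBr.
have := cm_tri (partial c (m.+1 + N) u) (T c u) (c (ic p.2) * (Q p.2).[z]).
rewrite (cmC (T c u) (partial c (m.+1 + N) u)).
have : 0 <= A * hp (m + N) by rewrite mulr_ge0// ltW.
rewrite (mulrBr A) !(mulrCA A 4) (mulrCA A 2); lra.
Qed.

Let T_universal c i : bounded c -> c i <> 0 -> forall h, hol_on G h -> forall X, ccompact X ->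
  (forall z, X z -> G z) -> forall e : R, 0 < e -> exists2 nu, (0 < nu)%N & exists s : seq (nat * nat),
  (forall z, X z -> K nu z) /\ forall n, idx (n, nu) -> (n, nu) \notin s -> forall z, X z -> cm (T c (phi n z) - h z) <= e.
Proof.
move=> [A cA] /eqP ci h hh X cX XG e e0.
have ci0 : 0 < cm (c i) by rewrite cm_gt0.
have [N hN] := exhaust_ccompact cX XG.
have NX z : X z -> K N.+1 z by apply: hN.
(* Near the images, [T c] composed with [phi n] is close to [c i] times a polynomial, so the target
   to approximate is [h] divided by [c i]. *)
have [P hP] : exists P : {poly C}, forall z, X z -> cm (P.[z] - (c i)^-1 * h z) <= e / 4 / cm (c i).
  have pp := papZ (c i)^-1 (hol_pap oG (cK (ltn0Sn N)) (fK (ltn0Sn N)) (KG (ltn0Sn N)) hh).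
  have [P hP] := pp _ (divr_gt0 (divr_gt0 e0 (ltr0n R 4)) ci0).
  by exists P => z /NX Kz; exact: hP.
have [B [B0 hB]] := ccompact_bounded cX.
have [j hj] := rat_poly_dense P B (divr_gt0 (divr_gt0 e0 (ltr0n R 4)) ci0).
have [m hm] := @hp_small (e / 2) (4 * A) (divr_gt0 e0 (ltr0n R 2)).
have [nu [nuN nu0 nuc]] := code2_infinite i j N.
pose M := maxn m i.
have [nu' nu'0 hnu'] := filled_bounded M.
(* Only finitely many images meet a set containing [filled M]; these pairs are the exceptions, and
   all other images are subject to [T_interp] at stage [M]. *)
have [s hs] := Lfin nu'0.
exists nu => //; exists s; split=> [z|n ip ns z Xz]; first exact: hN.
have Kz : K nu z by exact: (hN nu).
have icE : ic nu = i by rewrite /ic nuc.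
have nf : ~ filled M (phi n z).
  move=> fz; move/negP: ns; apply; apply: hs => //; exists (phi n z); first exact: hnu'.
  by exists z.
have := @T_interp c A (n, nu) z M cA ip Kz; rewrite /= icE => /(_ (leq_maxr _ _) nf) h1.
have h2 := hm M (leq_maxl _ _).
have -> : T c (phi n z) - h z = (T c (phi n z) - c i * (Q nu).[z]) +
   c i * (((Q nu).[z] - P.[z]) + (P.[z] - (c i)^-1 * h z)) by field.
apply: le_trans (cmD _ _) _; rewrite cmM.
have h3 := hP z Xz; have h4 := hj z (hB z Xz).
have h5 : cm ((Q nu).[z] - P.[z] + (P.[z] - (c i)^-1 * h z)) <= e / 2 / cm (c i).
  apply: le_trans (cmD _ _) _; rewrite /Q nuc /=.
  have -> : e / 2 / cm (c i) = e / 4 / cm (c i) + e / 4 / cm (c i) by field; rewrite gt_eqF.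
  exact: lerD.
have : cm (c i) * cm ((Q nu).[z] - P.[z] + (P.[z] - (c i)^-1 * h z)) <= e / 2.
  by rewrite mulrC -ler_pdivlMr.
lra.
Qed.

(* The factor [(r0 / 3) ^+ i] makes this sequence of functionals bounded at [f]. *)
Let ell f i : C := (((r0 / 3) ^+ i)%:C)%C * tcoef w0 f i.

Let ell_bounded f : hol_on G f -> bounded (ell f).
Proof.
move=> hf; have r20 : 0 < 2 * r0 by rewrite mulr_gt0.
have [B [B0 hB]] := Sq_bounded r20 (fun w win => cdiff_cont (hf w (Gsq win))).
exists (2 * B) => i.
have [_ /(_ w0 r0 r0_gt0)] := iterB_bound i oG hf Gw0 r0_gt0 Gsq (fun z bz => hB z (bdSq_in bz)).
rewrite !subrr cm0 => /(_ (lexx 0)); rewrite -/(tcoef w0 f i) => h.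
rewrite /ell cmM cm_real ger0_norm ?exprn_ge0 ?divr_ge0 ?(ltW r0_gt0)//.
apply: le_trans (ler_wpM2l _ h) _; first by rewrite exprn_ge0// divr_ge0// (ltW r0_gt0).
have -> : (r0 / 3) ^+ i * (2 * r0 * (B * (3 / r0) ^+ i) / r0) = 2 * B * ((r0 / 3) ^+ i * (3 / r0) ^+ i).
  by field; rewrite gt_eqF.
by rewrite -exprMn (_ : r0 / 3 * (3 / r0) = 1) ?expr1n ?mulr1//; field; rewrite gt_eqF.
Qed.

Definition sum_op f z := T (ell f) z.

Lemma sum_op_hol f : hol_on G f -> hol_on G (sum_op f).
Proof. by move=> hf; apply: T_hol; exact: ell_bounded. Qed.

Lemma sum_op_lin a f1 f2 f3 : hol_on G f1 -> hol_on G f2 -> hol_on G f3 ->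
  (forall z, G z -> f3 z = a * f1 z + f2 z) -> forall z, G z -> sum_op f3 z = a * sum_op f1 z + sum_op f2 z.
Proof.
move=> h1 h2 h3 e z Gz; apply: T_lin => //; try exact: ell_bounded.
by move=> i; rewrite /ell (tcoef_lin i oG Gw0 h1 h2 h3 e); ring.
Qed.

Lemma sum_op_universal f : hol_on G f -> ~ (forall z, G z -> f z = 0) ->
  forall h, hol_on G h -> forall X, ccompact X ->
  (forall z, X z -> G z) -> forall e : R, 0 < e -> exists2 nu, (0 < nu)%N & exists s : seq (nat * nat),
  (forall z, X z -> K nu z) /\ forall n, idx (n, nu) -> (n, nu) \notin s -> forall z, X z -> cm (sum_op f (phi n z) - h z) <= e.
Proof.
move=> hf f0.
have [i ti] : exists i, tcoef w0 f i <> 0.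
  apply: contrapT => no; apply: f0; apply: (identity_theorem oG Gconn hf Gw0) => j.
  by apply: contrapT => tj; apply: no; exists j.
apply: (@T_universal _ i (ell_bounded hf)).
by move/eqP: ti => ti; apply/eqP; rewrite mulf_neq0// -cm_gt0 cm_real gtr0_norm exprn_gt0// divr_gt0.
Qed.

Variable al : nat -> R.
Hypothesis al0 : forall i, 0 < al i.
Hypothesis g_dense : forall i z, filled i z -> cm (g i z - (al i)%:C%C * (Q i).[z]) <= al i * hp i.

(** On a multiple of [(z - w0) ^+ i] every functional but the [i]-th vanishes, so the series reduces
    to one term; scaled suitably it is [g i] divided by [al i], within [hp i] of [Q i]. *)
Lemma sum_op_dense h X (e : R) : hol_on G h -> ccompact X -> (forall z, X z -> G z) -> 0 < e ->
  exists2 f, hol_on G f & forall z, X z -> cm (sum_op f z - h z) <= e.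
Proof.
move=> hh cX XG e0; have e2 : 0 < e / 2 by lra.
have e4 : 0 < e / 4 by lra.
have [N hN] := exhaust_ccompact cX XG.
have [P hP] := hol_pap oG (cK (ltn0Sn N)) (fK (ltn0Sn N)) (KG (ltn0Sn N)) hh e4.
have [B [B0 hB]] := ccompact_bounded cX.
have [j hj] := rat_poly_dense P B e4.
have [m hm] := @hp_small (e / 2) 1 e2.
(* Only the polynomial attached to [i] matters here, so the first component 0 is arbitrary; [i] is
   large enough for [X] to lie in [filled i] and for [hp i <= e / 2]. *)
have [i [iN _ ij]] := code2_infinite 0 j (maxn N m).
move: iN; rewrite geq_max => /andP[iN im].
pose lam : C := ((al i * (r0 / 3) ^+ i)%:C)%C^-1.
have ln0 : al i * (r0 / 3) ^+ i != 0 by rewrite gt_eqF// mulr_gt0// exprn_gt0// divr_gt0.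
pose mono z : C := (z - w0) ^+ i.
have hm1 : hol_on G mono.
  move=> z _; apply: (@cdiff_near _ (horner (('X - w0%:P) ^+ i)) _ _ 1) => //; last exact: cdiff_poly.
  by move=> w _; rewrite horner_exp hornerXsubC.
pose f z := lam * mono z.
have hf : hol_on G f by move=> z Gz; apply: cdiffM; [exact: cdiff_cst|exact: hm1].
have h0 : hol_on G (fun=> 0) by move=> z _; exact: cdiff_cst.
have t0 k : tcoef w0 (fun=> 0) k = 0.
  have /eqP : tcoef w0 (fun=> 0) k = 1 * tcoef w0 (fun=> 0) k + tcoef w0 (fun=> 0) k :> C.
    by apply: (tcoef_lin k oG Gw0 h0 h0 h0) => z _; rewrite mulr0 addr0.
  by rewrite mul1r -subr_eq0 opprD addrA subrr sub0r oppr_eq0 => /eqP.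
exists f => // z Xz.
have tf k : tcoef w0 f k = lam * (k == i)%:R.
  rewrite (tcoef_lin (f := mono) (g := fun=> 0) (a := lam) k oG Gw0) ?t0 ?addr0//.
    by rewrite (tcoef_monomial (n := i) k oG Gw0).
  by move=> y _; rewrite addr0.
have -> : sum_op f z = (al i)%:C%C^-1 * g i z.
  rewrite /sum_op (@T_delta _ i); last exact: XG.
    rewrite /ell tf eqxx mulr1 /lam rmorphM/= invfM; congr (_ * _).
    by rewrite mulrCA mulfV ?mulr1// -cm_gt0 cm_real gtr0_norm exprn_gt0// divr_gt0.
  by move=> k ki; rewrite /ell tf (negbTE ki) !mulr0.
have fz : filled i z by apply: sub_filled; apply: (hN i.+1) => //; exact: leqW.
have an0 : ((al i)%:C)%C != 0 :> C by rewrite -cm_gt0 cm_real gtr0_norm.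
have h1 : cm ((al i)%:C%C^-1 * g i z - (Q i).[z]) <= hp i.
  have -> : (al i)%:C%C^-1 * g i z - (Q i).[z] = (g i z - (al i)%:C%C * (Q i).[z]) / (al i)%:C%C.
    by field.
  by rewrite cmf cm_real gtr0_norm// ler_pdivrMr// [leRHS]mulrC g_dense.
have h2 := hm i im; rewrite mul1r in h2.
have h3 := hP z (hN _ (leqnSn N) z Xz); have := hj z (hB z Xz).
rewrite /Q ij /= in h1 *.
have := cm_tri (rat_poly R j).[z] ((al i)%:C%C^-1 * g i z) (h z).
have := cm_tri P.[z] (rat_poly R j).[z] (h z); lra.
Qed.

End Operator.

Theorem universal_operator : exists T : (C -> C) -> C -> C, [/\  forall f, hol_on G f -> hol_on G (T f),
  forall a f1 f2 f3, hol_on G f1 -> hol_on G f2 -> hol_on G f3 ->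
    (forall z, G z -> f3 z = a * f1 z + f2 z) -> forall z, G z -> T f3 z = a * T f1 z + T f2 z,
  forall f, hol_on G f -> ~ (forall z, G z -> f z = 0) -> forall h, hol_on G h -> forall X, ccompact X ->
    (forall z, X z -> G z) -> forall e : R, 0 < e -> exists2 nu, (0 < nu)%N & exists s : seq (nat * nat),
    (forall z, X z -> K nu z) /\ forall n, idx (n, nu) -> (n, nu) \notin s -> forall z, X z -> cm (T f (phi n z) - h z) <= e &
  forall h X (e : R), hol_on G h -> ccompact X -> (forall z, X z -> G z) -> 0 < e ->
    exists2 f, hol_on G f & forall z, X z -> cm (T f z - h z) <= e].
Proof.
have [g [al [h1 h2 h3 h4 h5]]] := building_blocks.
exists (sum_op g); split.
- by move=> f; exact: sum_op_hol.
- by move=> *; exact: sum_op_lin.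
- by move=> f hf f0; exact: (sum_op_universal h3 h5 hf f0).
- by move=> *; exact: (sum_op_dense h3 h2 h4).
Qed.

End Interpolation.

(** * The space of holomorphic functions *)

Section Bridge.
Variable R : realType.
Local Notation C := (plane R).

Lemma nbhs_cm (x : C) (A : set C) : nbhs x A <-> exists2 d : R, 0 < d & forall y : C, cm (y - x) < d -> A y.
Proof.
split=> [/nbhs_ballP[e /= e0 he]|[d d0 hd]].
  (* Positivity in [R[i]] includes being real, so the radius is a real number. *)
  have [e1 e2] : 0 < complex.Re e /\ e = ((complex.Re e)%:C)%C.
    by move: e0; rewrite ltcE /= => /andP[/eqP h ->]; split=> //; apply: complex_ext.
  exists (complex.Re e) => // y yx; apply: he; rewrite -ball_normE /= normcE e2 ltcR cmC.
  exact: yx.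
apply/nbhs_ballP; exists ((d%:C)%C : R[i]) => /=; first by rewrite ltcR.
move=> y; rewrite -ball_normE /= normcE ltcR cmC; exact: hd.
Qed.

Lemma open_copen (A : set C) : open A <-> copen (A : R[i] -> Prop).
Proof.
rewrite openE; split=> [h x Ax|h x Ax]; first by apply/nbhs_cm; exact: h.
by rewrite /interior; apply/nbhs_cm; exact: h.
Qed.

(** This is the near-covering form of compactness for the filter of neighbourhoods of infinity on
    [nat], applied to tail statements. *)
Lemma compact_ccompact (K : set C) : compact K -> ccompact (K : R[i] -> Prop).
Proof.
move=> /compact_near_coveringP/near_covering_withinP cK P hP.
have [|N _ hN] := cK nat \oo (fun N x => forall n, (N <= n)%N -> P n x) _.
  move=> x Kx; have [d d0 [N hN]] := hP x Kx.
  exists ([set y : C | cm (y - x) < d], [set n | (N <= n)%N]) => /=.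
    by split; [apply/nbhs_cm; exists d|exists N].
  by move=> [y n] /= [yd Nn] Ky n' nn; apply: hN => //; exact: leq_trans nn.
by exists N => y Ky n Nn; exact: (hN N (leqnn N) y Ky n Nn).
Qed.

Lemma derivable_cdiff (f : C -> C) (z : C) : derivable f z 1 <-> cdiff (f : R[i] -> R[i]) z.
Proof.
split=> [|[d fd]].
  move=> /cvg_ex[/= l /cvgrPdist_lt fl]; exists l => e e0.
  have e0' : 0 < (e%:C)%C :> R[i] by rewrite ltcR.
  have [r r0 hr] := (nbhs_cm 0 _).1 (fl _ e0').
  exists r => // h hr0; have [->|hn0] := eqVneq h 0.
    by rewrite addr0 mulr0 !subrr cm0 mulr0.
  have := hr h; rewrite subr0 => /(_ hr0 hn0).
  rewrite normcE ltcR => /ltW; rewrite /= -[h *: 1]/(h * 1) mulr1 -[_ *: _]/(_ * _).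
  rewrite cmC => q.
  have -> : f (z + h) - f z - l * h = (h^-1 * (f (h + z) - f z) - l) * h.
    by rewrite (addrC h z); field.
  by rewrite cmM ler_wpM2r ?cm_ge0.
apply/cvg_ex; exists (d : C); apply/cvgrPdist_lt => e /=.
rewrite ltcE /= => /andP[/eqP ei e0].
have {ei} -> : e = ((complex.Re e)%:C)%C by apply: complex_ext.
set t := complex.Re e in e0 *.
have [r r0 hr] := fd _ (divr_gt0 e0 (ltr0n R 2)).
apply/nbhs_cm; exists r => // h; rewrite subr0 => hr0 hn0.
rewrite normcE ltcR -[h *: 1]/(h * 1) mulr1 -[_ *: _]/(_ * _) cmC.
have c0 : 0 < cm h by rewrite cm_gt0.
have -> : h^-1 * (f (h + z) - f z) - d = (f (z + h) - f z - d * h) / h.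
  by rewrite (addrC h z); field.
rewrite cmf ltr_pdivrMr//; apply: le_lt_trans (hr h hr0) _.
by rewrite ltr_pM2r//; lra.
Qed.

End Bridge.

(** * Hamel bases and lower density *)

Section Hamel.
Variables (F : fieldType) (X : lmodType F).
Implicit Types (B : set X).

Lemma exists_hamel_basis : exists B : set X, hamel_basis setT B.
Proof.
have [F0 FP totF|A [liA maxA]] := @Zorn_bigcup X (@linearly_independent F X).
  move=> s a us sB sum0 x xs.
  (* A finite part of the union of a chain lies in one of its members, where independence is
     known. *)
  have [Y FY sY] : exists2 Y, F0 Y & [set` s] `<=` Y.
    have s0 : s != [::] by apply: contraTneq xs => ->.
    elim: s s0 sB {us sum0 xs} => // y s ih _ sB.
    have [Y FY Yy] := sB y (mem_head _ _).
    have [->|s0] := eqVneq s [::].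
      by exists Y => // z /=; rewrite inE => /eqP->.
    have [|Y' FY' sY'] := ih s0 _.
      by move=> z /= zs; apply: sB => /=; rewrite inE zs orbT.
    have [YY'|YY'] := totF Y Y' FY FY'.
      by exists Y' => // z /=; rewrite inE => /orP[/eqP->|/sY'//]; exact: YY'.
    by exists Y => // z /=; rewrite inE => /orP[/eqP->//|/sY']; exact: YY'.
  exact: (FP Y FY s a us sY sum0 x xs).
exists A; split=> //; apply/seteqP; split=> // v _; apply: contrapT => nv.
apply: (maxA (A `|` [set v])).
  split; first by move=> x; left.
  move=> h; apply: nv; exists [:: v], (fun=> 1); split.
    by move=> x /=; rewrite inE => /eqP->; apply: h; right.
  by rewrite big_seq1 scale1r.
move=> s a us sB sum0.
have [vs|vs] := boolP (v \in s); last first.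
  apply: (liA s a us) => // x /= xs; have [//|/= xv] := sB x xs.
  by rewrite -xv xs in vs.
have sr : [set` rem v s] `<=` A.
  move=> x /=; rewrite mem_rem_uniq// inE => /andP[xv xs].
  by have [//|/= e] := sB x xs; rewrite e eqxx in xv.
move: sum0; rewrite (big_rem v)//= => sum0.
have av : a v = 0.
  apply: contrapT => /eqP av; apply: nv.
  exists (rem v s), (fun x => - ((a v)^-1 * a x)); split=> //.
  apply: (@scalerI _ _ (a v)) => //; rewrite scaler_sumr.
  under eq_bigr do rewrite scalerA mulrN mulrA mulfV// mul1r scaleNr.
  by rewrite sumrN; apply/eqP; rewrite -addr_eq0; apply/eqP.
move=> x xs; have [->//|xv] := eqVneq x v.
apply: (liA (rem v s) a (rem_uniq v us) sr).
  by move: sum0; rewrite av scale0r add0r.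
by rewrite mem_rem_uniq// inE xv.
Qed.

Variable T : X -> X.
Hypothesis Tlin : forall a u v, T (a *: u + v) = a *: T u + T v.
Hypothesis Tinj : forall u, T u = 0 -> u = 0.

Let T0 : T 0 = 0.
Proof.
have := Tlin 1 0 0; rewrite !scale1r addr0 => /eqP.
by rewrite -subr_eq0 opprD addNKr oppr_eq0 => /eqP.
Qed.

Let Tsum (s : seq X) (a : X -> F) : T (\sum_(x <- s) a x *: x) = \sum_(x <- s) a x *: T x.
Proof. by elim: s => [|x s ih]; rewrite ?big_nil// !big_cons Tlin ih. Qed.

Let Tinj2 : injective T.
Proof.
move=> u v e; apply/eqP; rewrite -subr_eq0; apply/eqP/Tinj.
by rewrite addrC -scaleN1r Tlin e scaleN1r addNr.
Qed.

(** The image of a Hamel basis under the injective [T] is a Hamel basis of the range, in bijection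
    with the original one. *)
Lemma same_dim_range : same_dim (range T) setT.
Proof.
have [B [liB spB]] := exists_hamel_basis.
exists (T @` B), B; split; last exact: (inj_card_eq (in2W Tinj2)).
  split.
    move=> s a us sB sum0 x xs.
    have [s' es] : exists s', s = [seq T y | y <- s'] /\ [set` s'] `<=` B.
      elim: s sB {us sum0 xs} => [|y s ih] sB; first by exists [::].
      have [y' By' yy'] := sB y (mem_head _ _).
      have [|s' [es s'B]] := ih; first by move=> z /= zs; apply: sB => /=; rewrite inE zs orbT.
      exists (y' :: s'); split; first by rewrite /= yy' es.
      by move=> z /=; rewrite inE => /orP[/eqP->//|/s'B].
    case: es => es s'B; move: us sum0 xs; rewrite es big_map => us sum0 /mapP[y ys ->].
    apply: (liB s' (fun y => a (T y)) (map_uniq us) s'B) => //.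
    by apply: Tinj; rewrite (Tsum s' (fun y => a (T y))).
  apply/seteqP; split=> [v [s [a [sB ->]]]|_ [u _ <-]].
    have [s' [es s'B]] : exists s', s = [seq T y | y <- s'] /\ [set` s'] `<=` B.
      elim: s sB => [|y s ih] sB; first by exists [::].
      have [y' By' yy'] := sB y (mem_head _ _).
      have [|s' [es s'B]] := ih; first by move=> z /= zs; apply: sB => /=; rewrite inE zs orbT.
      exists (y' :: s'); split; first by rewrite /= yy' es.
      by move=> z /=; rewrite inE => /orP[/eqP->//|/s'B].
    exists (\sum_(y <- s') a (T y) *: y) => //.
    by rewrite es big_map (Tsum s' (fun y => a (T y))).
  have : linear_span B u by rewrite spB.
  move=> [s [a [sB ->]]].
  have [inv invK] : exists inv, cancel T inv.
    exists (fun v => xget 0 [set u | T u = v]) => w.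
    by apply: Tinj2; exact: (@xgetPex _ 0 [set u | T u = T w] (ex_intro _ w erefl)).
  exists [seq T x | x <- s], (fun v => a (inv v)); split.
    by move=> x /= /mapP[y ys ->]; exists y => //; exact: sB.
  by rewrite Tsum big_map; apply: eq_bigr => x _; rewrite invK.
split=> //.
Qed.

End Hamel.

Section LowerDensity.
Variable R : realType.
Implicit Types A B : set nat.

Definition count A n := #|` fset_set (A `&` [set k | (1 <= k <= n)%N])|.

(** The limit inferior is the supremum of the infima over tails, one of which must be positive. At
    [n = 0] the quotient is 0, so a suitable [N] is automatically positive. *)
Lemma lower_density_gt0P A : (0 < lower_density R A)%E <->
  exists2 c : R, 0 < c & exists N, forall n, (N <= n)%N -> c <= (count A n)%:R / n%:R.
Proof.
rewrite /lower_density -/(count A _).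
set u := (fun n => _).
have lE : limn_einf u = ereal_sup (range (einfs u)).
  by rewrite limn_einf_lim; apply/cvg_lim => //; exact: cvg_einfs_sup.
rewrite lE; split.
  move=> /ereal_sup_gt[_ [N _ <-]] e0.
  have le n : (N <= n)%N -> (einfs u N <= u n)%E.
    by move=> Nn; apply: ereal_inf_lbound; exists n.
  have := le N (leqnn N); move: e0 le; case: (einfs u N) => [c| |]//.
  rewrite lte_fin => c0 le _; exists c => //; exists N => n Nn.
  by have := le n Nn; rewrite /u lee_fin.
move=> [c c0 [N hN]]; apply: (@lt_le_trans _ _ c%:E); first by rewrite lte_fin.
apply: (@le_trans _ _ (einfs u N)); last by apply: ereal_sup_ubound; exists N.
by apply: le_ereal_inf_tmp => _ [n Nn <-]; rewrite /u lee_fin; exact: hN.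
Qed.

Lemma lower_density_almost A B (s : seq nat) : (forall n, A n -> n \notin s -> B n) ->
  (0 < lower_density R A)%E -> (0 < lower_density R B)%E.
Proof.
move=> AB /lower_density_gt0P[c c0 [N hN]]; apply/lower_density_gt0P.
have fI (D : set nat) n : finite_set (D `&` [set k | (1 <= k <= n)%N]).
  apply: (@sub_finite_set _ _ `I_n.+1); last exact: finite_II.
  by move=> k [_ /= /andP[_]]; rewrite ltnS.
pose S0 := #|` [fset x in s]%fset|.
have cnt n : (count A n <= count B n + S0)%N.
  apply: leq_trans (leq_card_fsetU _ _); apply: fsubset_leq_card; apply/fsubsetP => k.
  rewrite in_fset_set// => /set_mem[Ak kn]; rewrite in_fsetU in_fset_set// in_fset.
  have [ks|ks] := boolP (k \in s); first by rewrite orbT.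
  by rewrite orbF; apply: mem_set; split=> //; exact: AB.
exists (c / 2); first by rewrite divr_gt0.
(* From there on the [S0] exceptional indices cost less than [c / 2] in density. *)
have [N' hN'] := archi_nat (2 * S0%:R / c); exists (maxn (maxn N N') 1) => n.
rewrite !geq_max => /andP[/andP[/hN h1 /hN' h2] n1].
have n0 : 0 < n%:R :> R by rewrite ltr0n.
move: h1 h2; rewrite ler_pdivlMr// ltr_pdivrMr// ler_pdivlMr// => h1 h2.
have : (count A n)%:R <= (count B n)%:R + S0%:R :> R by rewrite -natrD ler_nat.
lra.
Qed.

(** A set contained in a finite list would pass its positive density on to the empty set. *)
Lemma lower_density_infinite A (s : seq nat) : (0 < lower_density R A)%E -> exists2 n, A n & n \notin s.
Proof.
move=> dA; apply: contrapT => no.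
have : (0 < lower_density R set0)%E.
  by apply: (@lower_density_almost A set0 s) => // n An ns; apply: no; exists n.
move=> /lower_density_gt0P[c c0 [N hN]].
have := hN N (leqnn N); rewrite /count set0I fset_set0 cardfs0 mul0r; lra.
Qed.

End LowerDensity.

(** * Neighbourhoods and elements of the space of holomorphic functions *)

Section HolomorphicFunctions.
Variables (R : realType) (G : domain R).
Local Notation C := (plane R).

(** Sets containing a uniform ball over some compact subset form a filter [F] that converges to [f]
    for compact convergence; hence [F] contains all neighbourhoods of [f], and [hol G] has the
    induced topology. *)
Lemma hol_nbhs (f : hol G) (V : set (hol G)) : nbhs f V -> exists (X : set C) (e : R),
  [/\ compact X, X `<=` G, 0 < e & forall h : hol G, (forall z, X z -> cm (h z - f z) <= e) -> V h].
Proof.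
pose F : set_system (C -> C) := fun W => exists (X : set C) (e : R),
  [/\ compact X, X `<=` G, 0 < e & forall h : C -> C, (forall z, X z -> cm (h z - f z) <= e) -> W h].
have FF : Filter F.
  split.
  - by exists set0, 1; split=> //; exact: compact0.
  - move=> P Q [X [e [cX XG e0 h]]] [Y [e' [cY YG e'0 h']]].
    exists (X `|` Y), (Num.min e e'); split.
    + exact: compactU.
    + by move=> z [/XG|/YG].
    + by rewrite lt_min e0.
    + move=> k hk; split; [apply: h|apply: h'] => z Zz.
        by apply: le_trans (hk z (or_introl Zz)) _; rewrite ge_min lexx.
      by apply: le_trans (hk z (or_intror Zz)) _; rewrite ge_min lexx orbT.
  - move=> P Q PQ [X [e [cX XG e0 h]]]; exists X, e; split=> // k /h; exact: PQ.
have Fcvg : {family compactly_in (G : set C), F --> (hol_val f)}.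
  apply/fam_cvgP => X [XG cX] W /uniform_nbhs[E [entE EW]].
  have [e /= e0 he] : exists2 e : R[i], 0 < e & forall x y : C, `|x - y| < e -> E (x, y).
    move: entE; rewrite -entourage_ballE => -[e /= e0 he]; exists e => // x y xy.
    by apply: he => /=; rewrite -ball_normE.
  (* Half the radius, because the bound at hand on the compact set is not strict. *)
  have [r r0 er] : exists2 r : R, 0 < r & e = ((2 * r)%:C)%C.
    move: e0; rewrite ltcE /= => /andP[/eqP ei er]; exists (complex.Re e / 2).
      by rewrite divr_gt0.
    by apply: complex_ext => //=; rewrite mulrC divfK.
  exists X, r; split=> // k hk; apply: EW => y Xy; apply: he.
  by rewrite normcE er ltcR cmC; have := hk y Xy; lra.
case=> /= O [[W oW WO] Of OV].
have /Fcvg : nbhs (hol_val f : {family compactly_in (G : set C), C -> C}) W.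
  apply: open_nbhs_nbhs; split=> //.
  by move: Of; rewrite -WO.
move=> [X [e [cX XG e0 h]]]; exists X, e; split=> // k hk; apply: OV.
by rewrite -WO; apply: h.
Qed.

Lemma hol_funP (f : C -> C) : f \in @hol_fun R G <->
  holomorphic_on G f /\ forall z, ~ (G : set C) z -> f z = 0.
Proof. by rewrite /hol_fun; split=> [/set_mem|/mem_set]. Qed.

Lemma hol_on_hol (f : hol G) : hol_on (G : set C) (f : R[i] -> R[i]).
Proof.
by move=> z Gz; apply/derivable_cdiff; have [+ _] := (hol_funP f).1 (holP f); apply.
Qed.

Lemma hol_out (f : hol G) (z : C) : ~ (G : set C) z -> f z = 0.
Proof. by have [_] := (hol_funP f).1 (holP f); apply. Qed.

Lemma domain_copen : copen (G : set C).
Proof. by apply/open_copen; exact: domain_open. Qed.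

Lemma patch_hol_fun (f : C -> C) : hol_on (G : set C) f -> f \_ G \in @hol_fun R G.
Proof.
move=> hf; apply/hol_funP; split=> z Gz; last by rewrite patchE memNset.
apply/derivable_cdiff; have [d d0 hd] := domain_copen Gz.
by apply: (cdiff_near d0 _ (hf z Gz)) => w /hd Gw; rewrite patchE mem_set.
Qed.

Lemma connected_cconnected (A : set C) : connected A -> cconnected A.
Proof.
move=> cA B BA [z Bz] oB oAB; suff -> : A = B by [].
apply/esym/cA; first by exists z.
  by exists B; [exact/open_copen|apply/seteqP; split=> w; [move=> Bw; split=> //; exact: BA|case]].
exists (~` (fun z => A z /\ ~ B z)).
  by rewrite closedC; apply/open_copen.
apply/seteqP; split=> w; first by move=> Bw; split; [exact: BA|case].
by move=> [Aw nAB]; apply: contrapT => nB; exact: nAB.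
Qed.

End HolomorphicFunctions.

(** * The operator on the space of holomorphic functions *)

Section Universality.
Variables (R : realType) (G : domain R) (phi : nat -> holSelfMap G).
Local Notation C := (plane R).
Hypothesis hphi : strongly_frequently_runaway phi.
Hypothesis huni : forall n : nat, (0 < n)%N -> univalent (phi n).

Lemma frequently_universal_operator : exists T : hol G -> hol G, [/\
  forall a u v, T (a *: u + v) = a *: T u + T v,
  forall f, f <> 0 -> forall (h : hol G) (X : set C) (e : R), compact X -> X `<=` G -> 0 < e ->
    exists (A : set nat) (s : seq nat), (0 < lower_density R A)%E /\
      forall n, A n -> n \notin s -> forall z, X z -> cm (comp_op (phi n) (T f) z - h z) <= e &
  forall (h : hol G) (X : set C) (e : R), compact X -> X `<=` G -> 0 < e ->
    exists f, forall z, X z -> cm (T f z - h z) <= e].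
Proof.
have [K [A [[cK UK intK] KM Apos [dA disjA disjI finI]]]] := hphi.
have oG := domain_copen (G := G).
pose idx (p : nat * nat) := (0 < p.2)%N /\ A p.2 p.1.
have cKc nu : (0 < nu)%N -> ccompact (K nu : R[i] -> Prop) by move=> /cK/compact_ccompact.
have KG nu : (0 < nu)%N -> forall z, K nu z -> (G : set C) z.
  by move=> /KM[_ h _] z /h.
have fK nu : (0 < nu)%N -> full (K nu : R[i] -> Prop).
  move=> nu0; apply: connected_full; first exact: cKc.
  by apply: connected_cconnected; have [] := KM nu nu0.
have Kmono nu : (0 < nu)%N -> forall z, K nu z -> K nu.+1 z.
  by move=> nu0 z /(intK nu nu0)/interior_subset.
have Kloc (x : C) : (G : set C) x -> exists2 d : R, 0 < d & exists2 nu, (0 < nu)%N &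
    forall y : C, cm (y - x) < d -> K nu y.
  rewrite -UK => -[nu /= nu0 Kx]; have /nbhs_cm[d d0 hd] := intK nu nu0 x Kx.
  by exists d => //; exists nu.+1.
have idx0 p : idx p -> (0 < p.1)%N /\ (0 < p.2)%N.
  by move=> [p2 Ap]; split=> //; exact: (Apos p.2 p2 p.1 Ap).
have hphi' n : (0 < n)%N -> hol_on (G : set C) (phi n : R[i] -> R[i]).
  by move=> _ z Gz; apply/derivable_cdiff; exact: (holSelfMap_hol Gz).
have phiG n : (0 < n)%N -> forall z, (G : set C) z -> (G : set C) (phi n z).
  by move=> _ z Gz; exact: (@holSelfMap_self _ _ (phi n) z Gz).
have phi_inj n : (0 < n)%N -> forall y z, (G : set C) y -> (G : set C) z -> phi n y = phi n z -> y = z.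
  by move=> n0 y z Gy Gz; apply: (huni n0); apply: mem_set.
have Ldisj p q u : idx p -> idx q -> cimage (phi p.1) (K p.2) u -> cimage (phi q.1) (K q.2) u -> p = q.
  move=> ip iq [x Kx ux] [y Ky uy]; apply: (disjI p q ip iq).
  by exists u; split; [exists x|exists y].
have Lfin nu : (0 < nu)%N -> exists s : seq (nat * nat), forall p, idx p ->
    (exists2 u, K nu u & cimage (phi p.1) (K p.2) u) -> p \in s.
  move=> nu0; have [_ KnG _] := KM nu nu0.
  have /finite_seqP[s hs] := finI (K nu) (cK nu nu0) KnG; exists s => p ip [u Ku [x Kx ux]].
  suff : [set` s] p by [].
  by rewrite -hs; split; [case: ip|exists u; split=> //; exists x].
have [w0 Gw0] := domain_nonempty G.
have [d d0 hd] := oG w0 Gw0.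
have r0 : 0 < d / 8 by rewrite divr_gt0.
have Gsq z : inSq (pt w0 (- (d / 8)) (- (d / 8))) (2 * (d / 8)) z -> (G : set C) z.
  by move=> /(csq_cm r0) h; apply: hd; lra.
have cG : cconnected (G : set C) by apply: connected_cconnected; exact: domain_connected.
have [T [T1 T2 T3 T4]] := universal_operator oG cKc fK KG Kmono Kloc idx0 hphi' phiG phi_inj Ldisj Lfin r0 Gsq cG.
(* Elements of [hol G] vanish off [G], while [T f] is controlled on [G] only; hence the extension by
   0. *)
pose TT (f : hol G) : hol G := Hol (patch_hol_fun (T1 f (hol_on_hol f))).
have TTE f z : (G : set C) z -> TT f z = T f z by move=> Gz; rewrite /TT /= patchE mem_set.
exists TT; split.
- move=> a u v; apply: val_inj; apply/funext => z.
  have [Gz|nG] := pselect ((G : set C) z); last exact: etrans (hol_out _ nG) (esym (hol_out _ nG)).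
  rewrite [LHS]TTE//; rewrite [RHS](_ : _ = a * TT u z + TT v z)// !TTE//.
  by apply: (T2 a u v) => //; exact: hol_on_hol.
- move=> f f0 h X e cX XG e0.
  have nf : ~ (forall z, (G : set C) z -> f z = 0).
    move=> fz; apply: f0; apply: val_inj; apply/funext => z.
    by have [Gz|nG] := pselect ((G : set C) z); [apply: fz|exact: hol_out].
  have [nu nu0 [s [XK hs]]] := T3 f (hol_on_hol f) nf h (hol_on_hol h) X (compact_ccompact cX) XG e e0.
  exists (A nu), [seq p.1 | p <- s]; split; first exact: dA.
  move=> n An ns z Xz; have Gz := XG z Xz.
  have n0 : (0 < n)%N by exact: (Apos nu nu0 n An).
  have -> : comp_op (phi n) (TT f) z = TT f (phi n z) by rewrite [LHS]patchE mem_set.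
  rewrite TTE; last exact: phiG.
  apply: hs => //; apply: contra ns => ns; by apply/mapP; exists (n, nu).
- move=> h X e cX XG e0.
  have [f hf fX] := T4 h X e (hol_on_hol h) (compact_ccompact cX) XG e0.
  pose f' : hol G := Hol (patch_hol_fun hf).
  exists f' => z Xz; have Gz := XG z Xz; rewrite TTE//.
  (* The functions [f'] and [f] agree on [G] only. Linearity of [T], which compares values on [G],
     gives the equality once [T] is known to send 0 to 0 on [G]. *)
  have -> : T f' z = T f z; last exact: fX.
  have h0 : hol_on (G : set C) (fun=> 0) by move=> y _; exact: cdiff_cst.
  have z0 : T (fun=> 0) z = 0.
    have := T2 (-1) _ _ _ h0 h0 h0 (fun y _ => esym (_ : -1 * 0 + 0 = 0)) z Gz.
    by move=> ->; [rewrite mulN1r addNr|move=> *; rewrite mulr0 addr0].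
  have := T2 1 f (fun=> 0) f' hf h0 (hol_on_hol f') _ z Gz; rewrite mul1r z0 addr0; apply.
  by move=> y Gy; rewrite mul1r addr0 /f' /= patchE mem_set.
Qed.

End Universality.

Theorem theorem3p3 (R : realType) (G : domain R) (phi : nat -> holSelfMap G)
  (hG : simply_connected G)
  (hphi : strongly_frequently_runaway phi)
  (huni : forall n : nat, (0 < n)%N -> univalent (phi n)) :
  maximal_dense_lineable (F := R[i])
    (FHC R (fun n : nat => comp_op (phi n))).
Proof.
have [T [Tlin Tuniv Tdense]] := frequently_universal_operator hphi huni.
have Tfhc f : f <> 0 -> FHC R (fun n : nat => comp_op (phi n)) (T f).
  move=> f0 V oV [h Vh].
  have [X [e [cX XG e0 hV]]] := hol_nbhs (open_nbhs_nbhs (conj oV Vh)).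
  have [A [s [dA hA]]] := Tuniv f f0 h X e cX XG e0.
  by apply: lower_density_almost dA => n An /(hA n An) q; apply: hV => z /q.
(* For [f <> 0] some [comp_op (phi n) (T f)] would be within 1/2 of the constant 1 at a point of
   [G], which is absurd if [T f = 0]. *)
have Tinj f : T f = 0 -> f = 0.
  move=> Tf0; apply: contrapT => f0.
  have [w0 Gw0] := domain_nonempty G.
  have one_hol : hol_on (G : set (plane R)) (fun=> 1) by move=> z _; exact: cdiff_cst.
  pose one : hol G := Hol (patch_hol_fun one_hol).
  have [||A [s [dA hA]]] := Tuniv f f0 one [set w0] (1 / 2) (@compact_set1 _ _) _ _.
  - by move=> z ->.
  - by rewrite divr_gt0.
  have [n An ns] := lower_density_infinite s dA.
  have := hA n An ns w0 erefl; rewrite Tf0 /comp_op /= !patchE !mem_set//= sub0r cmN cm1; lra.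
exists (range T); split.
- split=> [|a u v].
    have := Tlin (-1) 0 0; rewrite scaler0 addr0 scaleN1r addNr => T0.
    by apply/mem_set; exists 0.
  move=> /set_mem[u' _ <-] /set_mem[v' _ <-]; apply/mem_set.
  by exists (a *: u' + v') => //; exact: Tlin.
- move=> O [h Oh] oO.
  have [X [e [cX XG e0 hV]]] := hol_nbhs (open_nbhs_nbhs (conj oO Oh)).
  have [f hf] := Tdense h X e cX XG e0.
  by exists (T f); split; [exact: hV|exists f].
- exact: same_dim_range.
- move=> _ [f _ <-]; have [->|/eqP f0] := eqVneq f 0; last by left; exact: Tfhc.
  right; have := Tlin (-1) 0 0; rewrite scaler0 addr0 scaleN1r addNr => T0.
  by rewrite T0.
Qed.
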